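(* Let $f$ be a transcendental meromorphic function in $\mathbb{C}$, let $\varphi(z)\not\equiv 0,\infty$ be a small function of $f$, and let $k\ge 1$, $q_0\ge 3$, $q_i\ge 0$ $(i=1,2,\ldots,k-1)$, $q_k\ge 1$ be integers. Let $a(z)\not\equiv 0,\infty$ be a small function of $f$, and put $M[f]=a(z)(f)^{q_0}(f')^{q_1}\cdots(f^{(k)})^{q_k}$. Then $$T(r,f)\le \frac{1}{q_0-2}N\left(r,\frac{1}{M[f]-\varphi(z)}\right)+S(r,f).$$
   Context: Standard notation of Nevanlinna theory is used: $T(r,f)$ is the Nevanlinna characteristic, and $N\left(r,\frac{1}{M[f]-\varphi}\right)$ is the integrated counting function of the zeros of $M[f]-\varphi$ counted with multiplicity. $S(r,f)$ denotes any quantity satisfying $S(r,f)=o(T(r,f))$ as $r\to\infty$, $r\notin E$, where $E$ is a set of positive real numbers of finite linear (Lebesgue) measure, not necessarily the same at each occurrence. A meromorphic function $b(z)\not\equiv 0,\infty$ is a small function of (with respect to) $f$ if $T(r,b)=S(r,f)$. *)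

(* Defs.v *)
From HB Require Import structures.
From mathcomp Require Import all_boot all_order all_algebra.
From mathcomp Require Import complex.
From mathcomp Require Import all_classical all_reals all_analysis.
Set Implicit Arguments.
Unset Strict Implicit.
Unset Printing Implicit Defensive.
Import Order.TTheory GRing.Theory Num.Theory numFieldNormedType.Exports.
Local Open Scope classical_set_scope.
Local Open Scope ring_scope.

(* R[i] as a numFieldType: this is what gives it the topology of its norm, and
   makes [derivable g z 1] and [derive1n] complex differentiation. *)
Definition CC (R : realType) : numFieldType := R[i].

(* A meromorphic function is represented by a total function CC R -> CC R whose
   values at isolated points (poles, removable singularities) are irrelevant;
   hence every identity between meromorphic functions is stated on punctured
   neighbourhoods [z^'].  Pointwise +, *, ^-1 and [derive1n] then represent the
   operations on meromorphic functions. *)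

Definition holomorphic_at (R : realType) (g : CC R -> CC R) (z : CC R) : Prop :=
  \forall w \near z, derivable g w 1.

Definition meromorphic (R : realType) (f : CC R -> CC R) : Prop :=
  forall z : CC R, exists n : nat, exists2 g : CC R -> CC R,
    holomorphic_at g z & \forall w \near z^', f w = g w / (w - z) ^+ n.

Definition mero_eq (R : realType) (f g : CC R -> CC R) : Prop :=
  forall z : CC R, \forall w \near z^', f w = g w.

Definition transcendental (R : realType) (f : CC R -> CC R) : Prop :=
  ~ exists p q : {poly CC R}, q != 0 /\ mero_eq f (fun z => p.[z] / q.[z]).

Definition has_order (R : realType) (f : CC R -> CC R) (z : CC R) (m : int) :
    Prop :=
  exists g : CC R -> CC R, [/\ holomorphic_at g z, g z != 0 &
    \forall w \near z^', f w = (w - z) ^ m * g w].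

(* The order of f at z, with value 0 when f vanishes identically near z. *)
Definition mero_order (R : realType) (f : CC R -> CC R) (z : CC R) : int :=
  xget 0 [set m | has_order f z m].

Definition pole_mult (R : realType) (f : CC R -> CC R) (z : CC R) : nat :=
  let m := mero_order f z in if m < 0 then `|m|%N else 0%N.

Definition cabs (R : realType) (z : CC R) : R := complex.Re `|z|.

(* n(t, f); the sum has finite support when f is meromorphic. *)
Definition unint_counting (R : realType) (f : CC R -> CC R) (t : R) : R :=
  \sum_(z \in [set z : CC R | cabs z <= t]) ((pole_mult f z)%:R : R).

Definition nevanlinna_N (R : realType) (f : CC R -> CC R) (r : R) : R :=
  \int[lebesgue_measure]_(t in `]0, r])
     ((unint_counting f t - unint_counting f 0) / t)
  + unint_counting f 0 * ln r.

(* [ln] is 0 on nonpositive reals, so logp 0 = 0 as usual. *)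
Definition logp (R : realType) (x : R) : R := Num.max 0 (ln x).

Definition circle_pt (R : realType) (r t : R) : CC R :=
  Complex (r * cos t) (r * sin t).

Definition nevanlinna_m (R : realType) (f : CC R -> CC R) (r : R) : R :=
  (2 * pi)^-1 * \int[lebesgue_measure]_(t in `[0, 2 * pi])
     logp (cabs (f (circle_pt r t))).

Definition nevanlinna_T (R : realType) (f : CC R -> CC R) (r : R) : R :=
  nevanlinna_m f r + nevanlinna_N f r.

(* s(r) = S(r, f).  Restricting to Borel sets E loses nothing, since a Lebesgue
   measurable set is contained in a Borel set of the same measure. *)
Definition is_S (R : realType) (f : CC R -> CC R) (s : R -> R) : Prop :=
  exists E : set R, [/\ measurable E, E `<=` [set r | 0 < r],
    (lebesgue_measure E < +oo)%E &
    forall e : R, 0 < e ->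
      \forall r \near +oo, ~ E r -> `|s r| <= e * `|nevanlinna_T f r|].

Definition small_function (R : realType) (f b : CC R -> CC R) : Prop :=
  [/\ meromorphic b, ~ mero_eq b (fun=> 0) & is_S f (nevanlinna_T b)].

Definition diff_monomial (R : realType) (k : nat) (q : 'I_k.+1 -> nat)
    (a f : CC R -> CC R) : CC R -> CC R :=
  fun z => a z * \prod_(i < k.+1) (derive1n i f z) ^+ q i.

(* Main.v *)
Require Import Defs.
From HB Require Import structures.
From mathcomp Require Import all_boot all_order all_algebra.
From mathcomp Require Import complex.
From mathcomp Require Import all_classical all_reals all_analysis.
From mathcomp Require Import zify ring lra.
Set Implicit Arguments.
Unset Strict Implicit.
Unset Printing Implicit Defensive.
Import Order.TTheory GRing.Theory Num.Theory numFieldNormedType.Exports.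
Local Open Scope classical_set_scope.
Local Open Scope ring_scope.

(** Put F = M[f]/phi and G = F'/(F - 1).  Since 1/F = 1 - (F'/F)(1/G) and
    f^-d = (1/F)(a/phi) prod (f^(i)/f)^(q_i) with d = sum q_i, the lemma on the
    logarithmic derivative and Jensen's formula for G give
    d m(r,1/f) <= N(r,G) - N(r,1/G) + S(r,f).  A comparison of orders at each
    point shows that (q_0 - 1) N(r,1/f) + N(r,G) - N(r,1/G) is at most
    N(r,f) + N(r,1/(M[f] - phi)) + S(r,f); adding the two and using
    T(r,f) = T(r,1/f) + O(1) leaves (q_0 - 2) T(r,f) on the left.  If F' = 0,
    the same steps give T(r,f) = S(r,f), which is absurd.

    The lemma on the logarithmic derivative is obtained without averaging:
    after removing radii close to the moduli of zeros and poles (a set of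
    finite measure), the Poisson-Jensen formula bounds f'/f pointwise on
    |z| = r by a power of T(R,f) R/(R - r), and Borel's growth lemma lets
    R = r + O(1/T(r,f)).  It absorbs the terms O(log r) because a function with
    T(r,f) = O(log r) along a sequence has finitely many poles, so becomes
    polynomial, by Liouville, after multiplication by a polynomial. *)

(** * Complex numbers: real embedding, modulus, neighbourhoods *)

Section ComplexBasics.
Context {R : realType}.
Local Notation C := (CC R).
Implicit Types (x y z w : C) (r s t : R).

(** The identity for 1/F bounds m(r,1/F) by m(r,F'/F) and m(r,1/G); Jensen's formula trades m(r,1/G)
    for m(r,G), which is small because G is the logarithmic derivative of F - 1. The price N(r,G) -
    N(r,1/G) cancels against the comparison of orders. There q_0 - 1 arises as follows: at a zero of
    f of order p where a and phi have order 0, F' vanishes to order at least q_0 p - 1 >= (q_0 - 1)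
    p and F - 1 does not vanish. N(r,f) enters because a pole of f can make a simple pole of G. As d
    >= q_0, the proximity term carries the coefficient q_0 - 1 as well, and N(r,f) <= T(r,f) costs
    one more.

    Two obstacles shape the development: the values of a meromorphic function at isolated points are
    arbitrary, and ln |f| is unbounded near zeros and poles. Neither is felt on a circle along which
    f is holomorphic and nonzero. All but countably many radii are of this kind ([generic]), so the
    circle means that are estimated have continuous integrands, and the other radii join the
    exceptional set. *)

Definition rc r : C := Complex r 0.
Definition cRe z : R := complex.Re z.
Definition cIm z : R := complex.Im z.

Lemma cRe_D z w : cRe (z + w) = cRe z + cRe w. Proof. by case: z; case: w. Qed.
Lemma cIm_D z w : cIm (z + w) = cIm z + cIm w. Proof. by case: z; case: w. Qed.
Lemma cRe_N z : cRe (- z) = - cRe z. Proof. by case: z. Qed.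
Lemma cIm_N z : cIm (- z) = - cIm z. Proof. by case: z. Qed.
Lemma cRe_M z w : cRe (z * w) = cRe z * cRe w - cIm z * cIm w.
Proof. by case: z; case: w. Qed.
Lemma cIm_M z w : cIm (z * w) = cRe z * cIm w + cIm z * cRe w.
Proof. by case: z => a b; case: w. Qed.
Lemma cRe_0 : cRe 0 = 0. Proof. by []. Qed.
Lemma cIm_0 : cIm 0 = 0. Proof. by []. Qed.
Lemma cRe_1 : cRe 1 = 1. Proof. by []. Qed.
Lemma cIm_1 : cIm 1 = 0. Proof. by []. Qed.
Lemma cRe_rc r : cRe (rc r) = r. Proof. by []. Qed.
Lemma cIm_rc r : cIm (rc r) = 0. Proof. by []. Qed.
Definition cReE := (cRe_D, cRe_N, cRe_M, cRe_0, cRe_1, cRe_rc).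
Definition cImE := (cIm_D, cIm_N, cIm_M, cIm_0, cIm_1, cIm_rc).

Lemma ceqP z w : cRe z = cRe w -> cIm z = cIm w -> z = w.
Proof. by case: z => a b; case: w => c d; rewrite /cRe /cIm /= => -> ->. Qed.

Lemma rcD r s : rc (r + s) = rc r + rc s.
Proof. by apply: ceqP; rewrite ?cReE ?cImE ?addr0. Qed.
Lemma rcN r : rc (- r) = - rc r.
Proof. by apply: ceqP; rewrite ?cReE ?cImE ?oppr0. Qed.
Lemma rcB r s : rc (r - s) = rc r - rc s.
Proof. by rewrite rcD rcN. Qed.
Lemma rcM r s : rc (r * s) = rc r * rc s.
Proof. by apply: ceqP; rewrite ?cReE ?cImE; ring. Qed.
Lemma rc0 : rc 0 = 0. Proof. by []. Qed.
Lemma rc1 : rc 1 = 1. Proof. by []. Qed.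
Lemma rc_inj : injective rc. Proof. by move=> a b []. Qed.
Lemma rc_eq0 r : (rc r == 0) = (r == 0).
Proof. by apply/eqP/eqP => [[]|->]. Qed.
Lemma rcV r : rc r^-1 = (rc r)^-1.
Proof.
have [->|r0] := eqVneq r 0; first by rewrite rc0 !invr0 rc0.
apply: (mulfI (_ : rc r != 0)); first by rewrite rc_eq0.
by rewrite -rcM !divff ?rc_eq0// rc1.
Qed.
Lemma rc_nat n : rc n%:R = n%:R.
Proof. by elim: n => [|n IH]; rewrite ?rc0// -!natr1 rcD IH rc1. Qed.

Lemma cabsE z : cabs z = Num.sqrt (cRe z ^+ 2 + cIm z ^+ 2).
Proof. by case: z. Qed.
Lemma normE z : `|z| = rc (cabs z).
Proof. by case: z. Qed.
Lemma cabs_ge0 z : 0 <= cabs z. Proof. by rewrite cabsE sqrtr_ge0. Qed.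
Lemma cabs_sqr z : cabs z ^+ 2 = cRe z ^+ 2 + cIm z ^+ 2.
Proof. by rewrite cabsE sqr_sqrtr// addr_ge0// sqr_ge0. Qed.
Lemma cabs0 : cabs (0 : C) = 0. Proof. by apply: rc_inj; rewrite -normE normr0. Qed.
Lemma cabs1 : cabs (1 : C) = 1. Proof. by apply: rc_inj; rewrite -normE normr1. Qed.
Lemma cabsM z w : cabs (z * w) = cabs z * cabs w.
Proof. by apply: rc_inj; rewrite rcM -!normE normrM. Qed.
Lemma cabsX z n : cabs (z ^+ n) = cabs z ^+ n.
Proof. by elim: n => [|n IH]; rewrite ?cabs1// !exprS cabsM IH. Qed.
Lemma cabsV z : cabs z^-1 = (cabs z)^-1.
Proof. by apply: rc_inj; rewrite rcV -!normE normfV. Qed.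
Lemma cabs_div z w : cabs (z / w) = cabs z / cabs w.
Proof. by rewrite cabsM cabsV. Qed.
Lemma cabsN z : cabs (- z) = cabs z.
Proof. by apply: rc_inj; rewrite -!normE normrN. Qed.
Lemma cabsB z w : cabs (z - w) = cabs (w - z).
Proof. by rewrite -cabsN opprB. Qed.
Lemma cle z w : (z <= w) = (cIm w == cIm z) && (cRe z <= cRe w).
Proof. by case: z; case: w. Qed.
Lemma clt z w : (z < w) = (cIm w == cIm z) && (cRe z < cRe w).
Proof. by case: z; case: w. Qed.
Lemma rc_le r s : (rc r <= rc s) = (r <= s).
Proof. by rewrite cle !cIm_rc eqxx. Qed.
Lemma rc_lt r s : (rc r < rc s) = (r < s).
Proof. by rewrite clt !cIm_rc eqxx. Qed.
Lemma cabsD z w : cabs (z + w) <= cabs z + cabs w.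
Proof. by rewrite -rc_le rcD -!normE ler_normD. Qed.
Lemma cabsBD z w : cabs (z - w) <= cabs z + cabs w.
Proof. by rewrite -(cabsN w) cabsD. Qed.
Lemma cabs_eq0 z : (cabs z == 0) = (z == 0).
Proof. by rewrite -rc_eq0 -normE normr_eq0. Qed.
Lemma cabs_gt0 z : (0 < cabs z) = (z != 0).
Proof. by rewrite lt0r cabs_eq0 cabs_ge0 andbT. Qed.
Lemma cabs_rc r : cabs (rc r) = `|r|.
Proof. by rewrite cabsE cRe_rc cIm_rc expr0n addr0 sqrtr_sqr. Qed.
Lemma cabs_sub z w : cabs z - cabs w <= cabs (z - w).
Proof. by rewrite lerBlDr -{1}(subrK w z) cabsD. Qed.
Lemma cabs_dist z w : `|cabs z - cabs w| <= cabs (z - w).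
Proof.
by rewrite ler_norml cabs_sub andbT lerNl opprB cabsB cabs_sub.
Qed.
Lemma cabs_sum (I : Type) (s : seq I) (F : I -> C) :
  cabs (\sum_(i <- s) F i) <= \sum_(i <- s) cabs (F i).
Proof.
elim/big_ind2: _ => [|x1 x2 y1 y2 h1 h2|//]; first by rewrite cabs0.
exact: le_trans (cabsD _ _) (lerD h1 h2).
Qed.
Lemma cabs_prod (I : Type) (s : seq I) (F : I -> C) :
  cabs (\prod_(i <- s) F i) = \prod_(i <- s) cabs (F i).
Proof. exact: (big_morph _ cabsM cabs1). Qed.
Lemma Re_le z : `|cRe z| <= cabs z.
Proof. by rewrite cabsE -sqrtr_sqr ler_wsqrtr// lerDl sqr_ge0. Qed.
Lemma Im_le z : `|cIm z| <= cabs z.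
Proof. by rewrite cabsE -sqrtr_sqr ler_wsqrtr// lerDr sqr_ge0. Qed.
Lemma cabs_le_ReIm z : cabs z <= `|cRe z| + `|cIm z|.
Proof.
rewrite cabsE -(ger0_norm (addr_ge0 (normr_ge0 (cRe z)) (normr_ge0 (cIm z)))).
rewrite -sqrtr_sqr ler_wsqrtr// sqrrD !real_normK ?num_real//.
by rewrite lerD2r lerDl mulrn_wge0// mulr_ge0.
Qed.

(** Balls of [CC R] have radii in [CC R], which is only partially ordered. A positive radius has
    imaginary part 0, hence is [rc] of a real number, so epsilon-delta arguments can be run with
    real radii. *)
Lemma near_cabs z (P : C -> Prop) : (\forall w \near z, P w) <->
  exists2 d : R, 0 < d & forall w, cabs (w - z) < d -> P w.
Proof.
split.
  move/nbhs_normP => [/= d d0 h].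
  have dE : d = rc (cRe d) by move: d0; rewrite clt => /andP[/eqP h0 _]; apply: ceqP.
  exists (cRe d); first by move: d0; rewrite clt => /andP[].
  by move=> w wz; apply: h => /=; rewrite normE dE rc_lt cabsB.
move=> [d d0 h]; apply/nbhs_normP; exists (rc d) => /=; first by rewrite -rc0 rc_lt.
by move=> w /=; rewrite normE rc_lt cabsB => /h.
Qed.

Lemma near_pcabs z (P : C -> Prop) : (\forall w \near z^', P w) <->
  exists2 d : R, 0 < d & forall w, cabs (w - z) < d -> w != z -> P w.
Proof. by rewrite -near_cabs /dnbhs near_withinE. Qed.

Lemma pnear_near z (P : C -> Prop) : (\forall w \near z, P w) ->
  \forall w \near z^', P w.
Proof. by move=> /near_cabs[d d0 h]; apply/near_pcabs; exists d => // w /h. Qed.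

(** The disc around [w] must stay in the given one and must also miss [z]; hence the two terms of
    the minimum. *)
Lemma pnear_near_all z (P : C -> Prop) : (\forall w \near z^', P w) ->
  \forall w \near z^', \forall u \near w, P u.
Proof.
move=> /near_pcabs[d d0 h]; apply/near_pcabs; exists d => // w wz wnz.
apply/near_cabs; exists (Num.min (d - cabs (w - z)) (cabs (w - z))).
  by rewrite lt_min subr_gt0 wz cabs_gt0 subr_eq0.
move=> u; rewrite lt_min => /andP[u1 u2]; apply: h.
  rewrite -(subrK w u) -addrA (le_lt_trans (cabsD _ _))//; lra.
by apply: contraTneq u2 => ->; rewrite cabsB ltxx.
Qed.

Lemma cnear_near z (P : C -> Prop) : (\forall w \near z, P w) ->
  \forall w \near z, \forall u \near w, P u.
Proof.
move=> /near_cabs[d d0 h]; apply/near_cabs; exists d => // w wz.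
apply/near_cabs; exists (d - cabs (w - z)); first by rewrite subr_gt0.
move=> u u1; apply: h.
rewrite -(subrK w u) -addrA (le_lt_trans (cabsD _ _))//; lra.
Qed.

Lemma pnear_ex z (P : C -> Prop) : (\forall w \near z^', P w) -> exists w, P w.
Proof.
move=> /near_pcabs[d d0 h]; exists (z + rc (d / 2)); apply: h.
  by rewrite addrC addKr cabs_rc gtr0_norm; lra.
by rewrite -subr_eq0 addrC addKr rc_eq0; apply/eqP; lra.
Qed.

Lemma ccontP (g : C -> C) z : {for z, continuous g} <->
  forall e : R, 0 < e -> exists2 d : R, 0 < d &
    forall w, cabs (w - z) < d -> cabs (g w - g z) < e.
Proof.
split.
  move=> H e e0; have /cvgrPdist_lt h : g w @[w --> z] --> g z by exact: H.
  have /near_cabs[d d0 hd] := h (rc e) ltac:(by rewrite -rc0 rc_lt).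
  by exists d => // w /hd; rewrite normE rc_lt cabsB.
move=> h; apply: (cvgrPdist_lt (F := nbhs z) _ _).2 => e.
rewrite clt => /andP[/eqP h0 e0]; have -> : e = rc (cRe e) by apply: ceqP.
have [d d0 hd] := h _ e0; apply/near_cabs; exists d => // w /hd.
by rewrite normE rc_lt cabsB.
Qed.

Lemma ccont_near_ne0 (g : C -> C) z : {for z, continuous g} -> g z != 0 ->
  \forall w \near z, g w != 0.
Proof.
move=> /ccontP h g0; have [d d0 hd] := h (cabs (g z)) ltac:(by rewrite cabs_gt0).
apply/near_cabs; exists d => // w /hd; apply: contraTneq => ->.
by rewrite sub0r cabsN ltxx.
Qed.

(** Identities between meromorphic functions are known on punctured neighbourhoods only; this is the
    device that carries them to the centre. *)
Lemma ccont_eq (g h : C -> C) z : {for z, continuous g} -> {for z, continuous h} ->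
  (\forall w \near z^', g w = h w) -> g z = h z.
Proof.
move=> cg ch gh; apply/eqP; rewrite -subr_eq0; apply/negPn/negP => n0.
have cgh : {for z, continuous (fun w => g w - h w)} by exact: (cvgB (F := nbhs z) cg ch).
have /pnear_near := ccont_near_ne0 cgh n0.
move=> H; have [w] : exists w, g w = h w /\ g w - h w != 0.
  by apply: (@pnear_ex z); near=> w; split; near: w.
by case=> ->; rewrite subrr eqxx.
Unshelve. all: by end_near. Qed.

Lemma is_derive_ccont (g : C -> C) z l : is_derive z 1 g l -> {for z, continuous g}.
Proof.
by move=> [h _]; apply: differentiable_continuous; exact: (derivable1_diffP _ _).1.
Qed.

Lemma derivable_ccont (g : C -> C) z : derivable g z 1 -> {for z, continuous g}.
Proof.
by move=> h; apply: differentiable_continuous; exact: (derivable1_diffP _ _).1.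
Qed.

(** With the denominator cleared, h = 0 becomes harmless, and remainders can be added, composed and
    integrated. *)
Lemma cderP (g : C -> C) z l : is_derive z 1 g l <->
  forall e : R, 0 < e -> exists2 d : R, 0 < d &
    forall h, cabs h < d -> cabs (g (z + h) - g z - h * l) <= e * cabs h.
Proof.
have E m h : h != 0 -> cabs (m - h^-1 *: (g (h *: 1 + z) - g z)) =
    (cabs h)^-1 * cabs (g (z + h) - g z - h * m).
  move=> h0; rewrite -cabsV -cabsM cabsB; congr cabs.
  by rewrite /GRing.scale /= mulr1 [in RHS]mulrBr mulKf// (addrC h z).
split.
  move=> [dg <-] e e0; set l' := 'D_1 g z.
  have /cvgrPdist_le H : h^-1 *: (g (h *: 1 + z) - g z) @[h --> 0^'] --> l'.
    exact: dg.
  have /near_pcabs[d d0 hd] := H (rc e) ltac:(by rewrite -rc0 rc_lt).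
  exists d => // h hh; have [->|h0] := eqVneq h 0.
    by rewrite mul0r subr0 addr0 subrr cabs0 mulr0.
  have := hd h; rewrite subr0 => /(_ hh h0); rewrite normE rc_le.
  by rewrite E// mulrC ler_pdivrMr// cabs_gt0.
move=> H.
have cv : h^-1 *: (g (h *: 1 + z) - g z) @[h --> 0^'] --> l.
  apply/cvgrPdist_le => e.
  rewrite clt => /andP[/eqP h0 e0]; have -> : e = rc (cRe e) by apply: ceqP.
  have [d d0 hd] := H _ e0; apply/near_pcabs; exists d => // h; rewrite subr0 => hh hn0.
  by rewrite normE rc_le E// mulrC ler_pdivrMr ?cabs_gt0// hd.
by apply: DeriveDef; [apply: cvgP cv|apply: cvg_lim cv].
Qed.

End ComplexBasics.

(** * Curves in the plane and their derivatives *)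

Section Curves.
Context {R : realType}.
Local Notation C := (CC R).
Implicit Types (x y z w : C) (r s t : R) (P Q : R -> C).

(** Componentwise over the reals, to match the integral [cI], so that the real fundamental theorem
    of calculus applies to each component. *)
Definition pder P t (l : C) := is_derive t 1 (fun s => cRe (P s)) (cRe l) /\
  is_derive t 1 (fun s => cIm (P s)) (cIm l).

Lemma cRe_cont : continuous (@cRe R).
Proof.
move=> z; apply: (cvgrPdist_lt (F := nbhs z) _ _).2 => e e0; apply/near_cabs; exists e => // w h.
by rewrite (le_lt_trans _ h)// cabsB (le_trans _ (Re_le _))// ?cReE.
Qed.

Lemma cIm_cont : continuous (@cIm R).
Proof.
move=> z; apply: (cvgrPdist_lt (F := nbhs z) _ _).2 => e e0; apply/near_cabs; exists e => // w h.
by rewrite (le_lt_trans _ h)// cabsB (le_trans _ (Im_le _))// ?cImE.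
Qed.

Lemma cabs_cont : continuous (@cabs R).
Proof.
move=> z; apply: (cvgrPdist_lt (F := nbhs z) _ _).2 => e e0; apply/near_cabs; exists e => // w h.
by rewrite (le_lt_trans _ h)// cabsB cabs_dist.
Qed.

Lemma rc_cont : continuous (@rc R).
Proof.
move=> r; apply: (cvgrPdist_lt (F := nbhs r) _ _).2 => e.
rewrite clt => /andP[/eqP h0 e0]; have -> : e = rc (cRe e) by apply: ceqP.
have := (cvgrPdist_lt (F := nbhs r) id r).1 cvg_id _ e0.
move=> H; near=> s; rewrite -rcB normE rc_lt cabs_rc; near: s; exact: H.
Unshelve. all: by end_near. Qed.

Lemma rder_eps (u : R -> R) t l : is_derive t 1 u l <->
  forall e : R, 0 < e -> \forall h \near (0 : R), `|u (t + h) - u t - h * l| <= e * `|h|.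
Proof.
have E m h : h != 0 -> `|m - h^-1 *: (u (h *: 1 + t) - u t)| =
    `|h|^-1 * `|u (t + h) - u t - h * m|.
  move=> h0; rewrite -normfV -normrM distrC; congr `|_|.
  by rewrite /GRing.scale /= mulr1 [in RHS]mulrBr mulKf// (addrC h t).
split.
  move=> [dg <-] e e0; set l' := 'D_1 u t.
  have /cvgrPdist_le H : h^-1 *: (u (h *: 1 + t) - u t) @[h --> 0^'] --> l'.
    exact: dg.
  have := H _ e0; rewrite near_withinE; apply: filterS => h hd.
  have [->|h0] := eqVneq h 0; first by rewrite mul0r subr0 addr0 subrr normr0 mulr0.
  by have := hd h0; rewrite E// mulrC ler_pdivrMr// normr_gt0.
move=> H.
have cv : h^-1 *: (u (h *: 1 + t) - u t) @[h --> 0^'] --> l.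
  apply/cvgrPdist_le => e e0; rewrite near_withinE.
  apply: filterS (H _ e0) => h hd hn0.
  by rewrite E// mulrC ler_pdivrMr ?normr_gt0.
by apply: DeriveDef; [apply: cvgP cv|apply: cvg_lim cv].
Qed.

Lemma pder_eps P t l : pder P t l <-> forall e : R, 0 < e ->
  \forall h \near (0 : R), cabs (P (t + h) - P t - rc h * l) <= e * `|h|.
Proof.
split.
  move=> [/rder_eps d1 /rder_eps d2] e e0.
  have e20 : 0 < e / 2 by lra.
  near=> h; rewrite (le_trans (cabs_le_ReIm _))// (splitr e) mulrDl.
  rewrite ?cReE ?cImE !mul0r subr0 addr0; apply: lerD; near: h; [exact: d1|exact: d2].
move=> H; split; apply/rder_eps => e /H; apply: filterS => h.
  by apply: le_trans; rewrite (le_trans _ (Re_le _))// ?cReE ?cImE mul0r subr0.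
by apply: le_trans; rewrite (le_trans _ (Im_le _))// ?cReE ?cImE mul0r addr0.
Unshelve. all: by end_near. Qed.

Lemma pder_cont P t l : pder P t l -> {for t, continuous P}.
Proof.
move=> [[d1 _] [d2 _]].
have -> : P = fun s => rc (cRe (P s)) + Complex 0 1 * rc (cIm (P s)).
  by apply/funext => s; apply: ceqP; rewrite ?cReE ?cImE /cRe /cIm /=; ring.
apply: continuousD; first apply: continuous_comp; last 1 first.
- apply: continuousM; first exact: cst_continuous.
  apply: continuous_comp; last exact: rc_cont.
  by apply: differentiable_continuous; exact: (derivable1_diffP _ _).1.
- by apply: differentiable_continuous; exact: (derivable1_diffP _ _).1.
- exact: rc_cont.
Qed.

Lemma pder_near (P : R -> C) t l : pder P t l -> forall d, 0 < d ->
  \forall h \near (0 : R), cabs (P (t + h) - P t) < d.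
Proof.
move=> /pder_cont c d d0.
have /cvgrPdist_lt/(_ (rc d)) : P s @[s --> t] --> P t by exact: c.
rewrite -rc0 rc_lt => /(_ d0) H.
have G : (t + h) @[h --> (0:R)] --> t.
  by rewrite -[X in _ --> X]addr0; apply: cvgD; [exact: cvg_cst|exact: cvg_id].
near=> h.
have : `|P t - P (t + h)| < rc d by near: h; exact: (G _ H).
by rewrite normE rc_lt cabsB.
Unshelve. all: by end_near. Qed.

(** The chain rule with a complex derivative outside and a real parameter inside. The remainder is
    that of [G] at the increment of [P] plus [l] times that of [P]; each receives half of [e]. *)
Lemma pder_comp (G : C -> C) P t (l m : C) : is_derive (P t) 1 G l -> pder P t m ->
  pder (fun s => G (P s)) t (l * m).
Proof.
move=> /cderP dG dP; apply/pder_eps => e e0.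
have M0 : 0 < cabs m + 1 by rewrite ltr_pwDr// cabs_ge0.
have L0 : 0 < cabs l + 1 by rewrite ltr_pwDr// cabs_ge0.
have e10 : 0 < e / 2 / (cabs m + 1) by rewrite !divr_gt0.
have e20 : 0 < e / 2 / (cabs l + 1) by rewrite !divr_gt0.
have [d d0 hd] := dG _ e10.
near=> h.
have kd : cabs (P (t + h) - P t) < d by near: h; exact: pder_near dP _ d0.
have kh : cabs (P (t + h) - P t - rc h * m) <= e / 2 / (cabs l + 1) * `|h|.
  by near: h; exact: (pder_eps _ _ _).1 dP _ e20.
have km : cabs (P (t + h) - P t - rc h * m) <= 1 * `|h|.
  by near: h; exact: (pder_eps _ _ _).1 dP _ ltr01.
set k := P (t + h) - P t in kd kh km *.
have kM : cabs k <= (cabs m + 1) * `|h|.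
  rewrite -(subrK (rc h * m) k) (le_trans (cabsD _ _))// mulrDl addrC lerD//.
  by rewrite cabsM cabs_rc mulrC.
have -> : G (P (t + h)) - G (P t) - rc h * (l * m) =
  (G (P t + k) - G (P t) - k * l) + l * (k - rc h * m).
  by rewrite /k (addrC (P t)) subrK; ring.
apply: (le_trans (cabsD _ _)).
have -> : e * `|h| = e / 2 * `|h| + e / 2 * `|h| by field.
apply: lerD.
  rewrite (le_trans (hd _ kd))// -mulrA ler_wpM2l// ?ler_pdivrMl//; first lra.
rewrite cabsM (le_trans (ler_wpM2l (cabs_ge0 _) kh))// mulrA ler_wpM2r//.
by rewrite mulrCA ger_pMr ?divr_gt0// ler_pdivrMr// mul1r lerDl.
Unshelve. all: by end_near. Qed.

Lemma pder_D P Q t (l m : C) : pder P t l -> pder Q t m ->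
  pder (fun s => P s + Q s) t (l + m).
Proof.
move=> [d1 d2] [d3 d4]; split; rewrite ?cReE ?cImE.
  under eq_fun do rewrite cRe_D; exact: is_deriveD.
under eq_fun do rewrite cIm_D; exact: is_deriveD.
Qed.

Lemma pder_cst (z : C) t : pder (fun=> z) t 0.
Proof. by split; exact: is_derive_cst. Qed.

Lemma pder_rc t : pder rc t 1.
Proof.
split; first exact: is_derive_id.
exact: is_derive_cst.
Qed.

Lemma pder_M P Q t (l m : C) : pder P t l -> pder Q t m ->
  pder (fun s => P s * Q s) t (P t * m + Q t * l).
Proof.
move=> [d1 d2] [d3 d4]; split; rewrite ?cReE ?cImE.
  under eq_fun do rewrite cRe_M.
  apply: (is_derive_eq (is_deriveB (is_deriveM d1 d3) (is_deriveM d2 d4))).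
  by rewrite ?cReE /GRing.scale/=; ring.
under eq_fun do rewrite cIm_M.
apply: (is_derive_eq (is_deriveD (is_deriveM d1 d4) (is_deriveM d2 d3))).
by rewrite ?cImE /GRing.scale/=; ring.
Qed.

Definition eit t : C := Complex (cos t) (sin t).

Lemma pder_eit t : pder eit t (Complex 0 1 * eit t).
Proof.
split.
  have -> : cRe (Complex 0 1 * eit t) = - sin t by rewrite ?cReE /cRe/cIm/=; ring.
  exact: is_derive_cos.
have -> : cIm (Complex 0 1 * eit t) = cos t by rewrite ?cImE /cRe/cIm/=; ring.
exact: is_derive_sin.
Qed.

Lemma cabs_eit t : cabs (eit t) = 1.
Proof. by rewrite cabsE /cRe /cIm /= cos2Dsin2 sqrtr1. Qed.

Lemma circle_ptE r t : circle_pt r t = rc r * eit t.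
Proof. by apply: ceqP; rewrite ?cReE ?cImE /cRe /cIm /=; ring. Qed.

Lemma eit_2pi : eit (2 * pi) = eit 0.
Proof. by rewrite /eit mulrC mulr_natr cos2pi sin2pi cos0 sin0. Qed.

End Curves.

(** * Integrals of continuous functions on intervals *)

Section Integrals.
Context {R : realType}.
Local Notation C := (CC R).
Local Notation mu := (@lebesgue_measure R).
Implicit Types (x y z w : C) (a b c r s t : R) (u v : R -> R) (F G : R -> C).

(** Continuity in a full neighbourhood of each point of the interval, end points included, so that
    it composes without one-sided limits. *)
Definition contin (T : topologicalType) a b (u : R -> T) :=
  forall t, a <= t -> t <= b -> {for t, continuous u}.

Definition I a b u : R := \int[mu]_(t in `[a, b]) u t.
Definition cI a b F : C := Complex (I a b (cRe \o F)) (I a b (cIm \o F)).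

Lemma contin_within a b u : contin a b u -> {within `[a, b], continuous u}.
Proof.
move=> h; apply: continuous_in_subspaceT => t /set_mem /=.
by rewrite in_itv/= => /andP[? ?]; exact: h.
Qed.

Lemma contin_integrable a b u : contin a b u -> mu.-integrable `[a, b] (EFin \o u).
Proof.
move=> h; apply: continuous_compact_integrable; first exact: segment_compact.
exact: contin_within.
Qed.

Lemma contin_Re a b F : contin a b F -> contin a b (cRe \o F).
Proof. by move=> h t at_ tb; apply: continuous_comp; [exact: h|exact: cRe_cont]. Qed.
Lemma contin_Im a b F : contin a b F -> contin a b (cIm \o F).
Proof. by move=> h t at_ tb; apply: continuous_comp; [exact: h|exact: cIm_cont]. Qed.
Lemma contin_abs a b F : contin a b F -> contin a b (@cabs R \o F).
Proof. by move=> h t at_ tb; apply: continuous_comp; [exact: h|exact: cabs_cont]. Qed.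
Lemma contin_rc a b u : contin a b u -> contin a b (@rc R \o u).
Proof. by move=> h t at_ tb; apply: continuous_comp; [exact: h|exact: rc_cont]. Qed.
Lemma contin_D a b F G : contin a b F -> contin a b G -> contin a b (fun t => F t + G t).
Proof. by move=> h k t at_ tb; apply: continuousD; [exact: h|exact: k]. Qed.
Lemma contin_M a b F G : contin a b F -> contin a b G -> contin a b (fun t => F t * G t).
Proof. by move=> h k t at_ tb; apply: continuousM; [exact: h|exact: k]. Qed.
Lemma contin_cst (T : topologicalType) a b (x : T) : contin a b (fun=> x).
Proof. by move=> t _ _; exact: cst_continuous. Qed.
Lemma contin_comp (S T : topologicalType) a b (f : R -> S) (g : S -> T) : contin a b f ->
  (forall t, a <= t -> t <= b -> {for f t, continuous g}) -> contin a b (g \o f).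
Proof. by move=> h k t at_ tb; apply: continuous_comp; [exact: h|exact: k]. Qed.
Lemma contin_Du a b u v : contin a b u -> contin a b v -> contin a b (fun t => u t + v t).
Proof. by move=> h k t at_ tb; apply: continuousD; [exact: h|exact: k]. Qed.
Lemma contin_Mu a b u v : contin a b u -> contin a b v -> contin a b (fun t => u t * v t).
Proof. by move=> h k t at_ tb; apply: continuousM; [exact: h|exact: k]. Qed.

Lemma I_ext a b u v : (forall t, a <= t -> t <= b -> u t = v t) -> I a b u = I a b v.
Proof.
move=> h; apply: eq_Rintegral => t /set_mem/=; rewrite in_itv/= => /andP[? ?].
exact: h.
Qed.
Lemma I_D a b u v : contin a b u -> contin a b v -> I a b (fun t => u t + v t) = I a b u + I a b v.
Proof. by move=> h k; rewrite /I RintegralD//; exact: contin_integrable. Qed.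
Lemma I_Z a b k u : contin a b u -> I a b (fun t => k * u t) = k * I a b u.
Proof. by move=> h; rewrite /I RintegralZl//; exact: contin_integrable. Qed.
Lemma I_N a b u : contin a b u -> I a b (fun t => - u t) = - I a b u.
Proof.
move=> h; rewrite -mulN1r -I_Z//; apply: I_ext => t _ _.
by rewrite mulN1r.
Qed.
Lemma I_le a b u v : contin a b u -> contin a b v ->
  (forall t, a <= t -> t <= b -> u t <= v t) -> I a b u <= I a b v.
Proof.
move=> h k uv; apply: le_Rintegral => //; [exact: contin_integrable|exact: contin_integrable|].
by move=> t /=; rewrite in_itv/= => /andP[? ?]; exact: uv.
Qed.
Lemma I_cst a b k : a <= b -> I a b (fun=> k) = k * (b - a).
Proof.
rewrite le_eqVlt => /predU1P[->|ab].
  by rewrite /I set_itv1 Rintegral_set1 subrr mulr0.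
by rewrite /I Rintegral_cst//= lebesgue_measure_itv/= lte_fin ab.
Qed.
Lemma I_abs a b u : contin a b u -> `|I a b u| <= I a b (fun t => `|u t|).
Proof. by move=> h; apply: le_normr_Rintegral => //; exact: contin_integrable. Qed.
Lemma I_chain a b c u : a <= b -> b <= c -> contin a c u -> I a c u = I a b u + I b c u.
Proof.
move=> ab bc h; have ih := contin_integrable h.
have E : I a c u - I a b u = \int[mu]_(t in `]b, c]) u t.
  by rewrite /I (Rintegral_itvB ih)// bnd_simp.
rewrite -(subrK (I a b u) (I a c u)) E addrC; congr (_ + _).
rewrite /I -Rintegral_itv_obnd_cbnd//.
apply: integrableS ih => //; apply: subset_itvr => //.
Qed.
Lemma I_FTC a b u v : a <= b -> contin a b u ->
  (forall t, a <= t -> t <= b -> is_derive t 1 v (u t)) -> I a b u = v b - v a.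
Proof.
rewrite le_eqVlt => /predU1P[->|ab] cu dv.
  by rewrite /I set_itv1 Rintegral_set1 subrr.
rewrite /I /Rintegral (@continuous_FTC2 _ u v a b)//.
- exact: contin_within.
- have cv t : a <= t -> t <= b -> {for t, continuous v}.
    move=> at_ tb; have [? _] := dv t at_ tb.
    by apply: differentiable_continuous; exact: (derivable1_diffP _ _).1.
  split.
  + move=> t; rewrite in_itv/= => /andP[at_ tb].
    by have [] := dv t (ltW at_) (ltW tb).
  + by apply: cvg_at_right_filter; apply: cv => //; exact: ltW.
  + by apply: cvg_at_left_filter; apply: cv => //; exact: ltW.
- move=> t; rewrite in_itv/= => /andP[at_ tb].
  by rewrite derive1E; have [_] := dv t (ltW at_) (ltW tb).
Qed.

Lemma cI_Re a b F : cRe (cI a b F) = I a b (cRe \o F). Proof. by []. Qed.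
Lemma cI_Im a b F : cIm (cI a b F) = I a b (cIm \o F). Proof. by []. Qed.

Lemma cI_ext a b F G : (forall t, a <= t -> t <= b -> F t = G t) -> cI a b F = cI a b G.
Proof. by move=> h; apply: ceqP; apply: I_ext => t ? ? /=; rewrite h. Qed.
Lemma cI_D a b F G : contin a b F -> contin a b G ->
  cI a b (fun t => F t + G t) = cI a b F + cI a b G.
Proof.
move=> h k; apply: ceqP; rewrite ?cReE ?cImE ?cI_Re ?cI_Im -I_D; try by
  [exact: contin_Re|exact: contin_Im|apply: I_ext => t _ _ /=; rewrite ?cReE ?cImE].
Qed.
Lemma cI_Z a b z F : contin a b F -> cI a b (fun t => z * F t) = z * cI a b F.
Proof.
move=> h; have hr := contin_Re h; have hi := contin_Im h.
have hz k u : contin a b u -> contin a b (fun t => k * u t).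
  by move=> hu; apply: contin_Mu => //; exact: contin_cst.
apply: ceqP; rewrite ?cReE ?cImE ?cI_Re ?cI_Im -?I_Z//.
  rewrite -I_N -?I_D; first by apply: I_ext => t _ _ /=; rewrite ?cReE.
  - exact: hz.
  - by move=> t ? ?; apply: continuousN; apply: hz.
  - exact: hz.
rewrite -I_D; first by apply: I_ext => t _ _ /=; rewrite ?cImE.
- exact: hz.
- exact: hz.
Qed.
Lemma cI_chain a b c F : a <= b -> b <= c -> contin a c F -> cI a c F = cI a b F + cI b c F.
Proof.
move=> ab bc h; apply: ceqP; rewrite ?cReE ?cImE ?cI_Re ?cI_Im; apply: I_chain => //.
  exact: contin_Re.
exact: contin_Im.
Qed.
Lemma cI_FTC a b F G : a <= b -> contin a b F ->
  (forall t, a <= t -> t <= b -> pder G t (F t)) -> cI a b F = G b - G a.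
Proof.
move=> ab h d; apply: ceqP; rewrite ?cReE ?cImE ?cI_Re ?cI_Im.
  apply: (I_FTC (v := cRe \o G)) => //; first exact: contin_Re.
  by move=> t ? ?; have [] := d t.
apply: (I_FTC (v := cIm \o G)) => //; first exact: contin_Im.
by move=> t ? ?; have [] := d t.
Qed.
(* The crude factor 2 avoids rotating the integral; only finiteness matters. *)
Lemma cI_abs a b F u : contin a b F -> contin a b u ->
  (forall t, a <= t -> t <= b -> cabs (F t) <= u t) -> cabs (cI a b F) <= 2 * I a b u.
Proof.
move=> h cu Fu; apply: (le_trans (cabs_le_ReIm _)); rewrite cI_Re cI_Im mulrDl !mul1r.
have A (v : R -> R) : contin a b v -> contin a b (fun t => `|v t|).
  by move=> cv t ? ?; apply: continuous_comp; [exact: cv|exact: norm_continuous].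
have B (v : R -> R) : contin a b v -> (forall t, `|v t| <= cabs (F t)) ->
    `|I a b v| <= I a b u.
  move=> cv vF; apply: (le_trans (I_abs cv)); apply: I_le => // [|t t1 t2].
    exact: A.
  exact: le_trans (vF t) (Fu t t1 t2).
rewrite lerD// B//.
- exact: contin_Re.
- by move=> t; exact: Re_le.
- exact: contin_Im.
- by move=> t; exact: Im_le.
Qed.
Lemma cI_bound a b F M : a <= b -> contin a b F ->
  (forall t, a <= t -> t <= b -> cabs (F t) <= M) -> cabs (cI a b F) <= 2 * M * (b - a).
Proof.
move=> ab h k; rewrite -mulrA -I_cst//; apply: cI_abs => //; exact: contin_cst.
Qed.

End Integrals.

(** * Rules of complex differentiation *)

Section ComplexDerivatives.
Context {R : realType}.
Local Notation C := (CC R).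
Implicit Types (g h : C -> C) (z l m : C).

Lemma cder_cst (a z : C) : is_derive z 1 (fun=> a) 0.
Proof. exact: is_derive_cst. Qed.
Lemma cder_id z : is_derive z (1 : C) (fun w => w) 1.
Proof. exact: is_derive_id. Qed.
Lemma cder_D g h z l m : is_derive z 1 g l -> is_derive z 1 h m ->
  is_derive z 1 (fun w => g w + h w) (l + m).
Proof. by move=> d1 d2; exact: is_deriveD. Qed.
Lemma cder_N g z l : is_derive z 1 g l -> is_derive z 1 (fun w => - g w) (- l).
Proof. by move=> d1; exact: is_deriveN. Qed.
Lemma cder_B g h z l m : is_derive z 1 g l -> is_derive z 1 h m ->
  is_derive z 1 (fun w => g w - h w) (l - m).
Proof. by move=> d1 d2; exact: is_deriveB. Qed.
Lemma cder_M g h z l m : is_derive z 1 g l -> is_derive z 1 h m ->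
  is_derive z 1 (fun w => g w * h w) (l * h z + g z * m).
Proof.
move=> d1 d2; apply: (is_derive_eq (is_deriveM d1 d2)).
by rewrite /GRing.scale/= addrC (mulrC l).
Qed.
Lemma cder_Z (a : C) g z l : is_derive z 1 g l -> is_derive z 1 (fun w => a * g w) (a * l).
Proof.
by move=> d; apply: (is_derive_eq (cder_M (cder_cst a z) d)); rewrite mul0r add0r.
Qed.
Lemma cder_V g z l : is_derive z 1 g l -> g z != 0 ->
  is_derive z 1 (fun w => (g w)^-1) (- (l / g z ^+ 2)).
Proof.
move=> [d1 d2] g0; apply: DeriveDef; first exact: derivableV.
rewrite [LHS](deriveV g0 d1) d2 /GRing.scale/= mulNr.
by rewrite [l / _]mulrC.
Qed.
Lemma cder_X g n z l : is_derive z 1 g l ->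
  is_derive z 1 (fun w => g w ^+ n) (n%:R * g z ^+ n.-1 * l).
Proof.
move=> d; elim: n => [|n IH].
  by apply: (is_derive_eq (cder_cst 1 z)); rewrite !mul0r.
under eq_fun do rewrite exprS; apply: (is_derive_eq (cder_M d IH)).
case: n {IH} => [|n] /=; first by rewrite expr0; ring.
by rewrite -[n.+2%:R]natr1 exprS; ring.
Qed.
Lemma cder_near g h z l : (\forall w \near z, g w = h w) -> is_derive z 1 g l ->
  is_derive z 1 h l.
Proof.
move=> gh /cderP d; apply/cderP => e /d[d1 d10 hd].
have /near_cabs[d2 d20 hd2] := gh.
exists (Num.min d1 d2); first by rewrite lt_min d10.
move=> k; rewrite lt_min => /andP[k1 k2].
rewrite -!hd2 ?subrr ?cabs0//; first exact: hd.
by rewrite addrC addKr.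
Qed.
Lemma cder_comp g h z l m : is_derive (h z) 1 g l -> is_derive z 1 h m ->
  is_derive z 1 (fun w => g (h w)) (l * m).
Proof.
move=> /cderP dg dh; have /ccontP ch := is_derive_ccont dh.
apply/cderP => e e0.
have M0 : 0 < cabs m + 1 by rewrite ltr_pwDr// cabs_ge0.
have L0 : 0 < cabs l + 1 by rewrite ltr_pwDr// cabs_ge0.
have [d d0 hd] := dg (e / 2 / (cabs m + 1)) ltac:(by rewrite !divr_gt0).
have [d1 d10 hd1] := ch _ d0.
have [d2 d20 hd2] := (cderP _ _ _).1 dh (e / 2 / (cabs l + 1)) ltac:(by rewrite !divr_gt0).
have [d3 d30 hd3] := (cderP _ _ _).1 dh 1 ltr01.
exists (Num.min d1 (Num.min d2 d3)); first by rewrite !lt_min d10 d20.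
move=> k; rewrite !lt_min => /and3P[k1 k2 k3].
set j := h (z + k) - h z.
have jd : cabs j < d by apply: hd1; rewrite addrC addKr.
have jk : cabs (j - k * m) <= e / 2 / (cabs l + 1) * cabs k by exact: hd2.
have jM : cabs j <= (cabs m + 1) * cabs k.
  rewrite -(subrK (k * m) j) (le_trans (cabsD _ _))// mulrDl addrC lerD//.
    by rewrite cabsM mulrC.
  exact: hd3.
have -> : g (h (z + k)) - g (h z) - k * (l * m) =
  (g (h z + j) - g (h z) - j * l) + l * (j - k * m).
  by rewrite /j (addrC (h z)) subrK; ring.
apply: (le_trans (cabsD _ _)).
have -> : e * cabs k = e / 2 * cabs k + e / 2 * cabs k by field.
apply: lerD.
  rewrite (le_trans (hd _ jd))// -mulrA ler_wpM2l// ?ler_pdivrMl//; first lra.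
rewrite cabsM (le_trans (ler_wpM2l (cabs_ge0 _) jk))// mulrA ler_wpM2r ?cabs_ge0//.
by rewrite mulrCA ger_pMr ?divr_gt0// ler_pdivrMr// mul1r lerDl.
Qed.
Lemma cderV (g : C -> C) z l : is_derive z 1 g l -> derivable g z 1.
Proof. by case. Qed.
Lemma cderE (g : C -> C) z l : is_derive z 1 g l -> derive1 g z = l.
Proof. by move=> [_ <-]; rewrite derive1E. Qed.

End ComplexDerivatives.

(** * Goursat's theorem by bisection *)

Section Goursat.
Context {R : realType}.
Local Notation C := (CC R).
Implicit Types (z w : C) (r s t x y : R).

(* A property of dyadic subrectangles, inherited upwards from the four children
   and true for all small rectangles around each point, holds globally. *)
Lemma bisect2 (ok : nat -> R -> R -> Prop) (s0 t0 a b : R) : 0 <= a -> 0 <= b ->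
  (forall n s t, s0 <= s -> t0 <= t -> s + a / 2 ^+ n <= s0 + a -> t + b / 2 ^+ n <= t0 + b ->
    ok n.+1 s t -> ok n.+1 (s + a / 2 ^+ n.+1) t ->
    ok n.+1 s (t + b / 2 ^+ n.+1) -> ok n.+1 (s + a / 2 ^+ n.+1) (t + b / 2 ^+ n.+1) ->
    ok n s t) ->
  (forall x y, s0 <= x <= s0 + a -> t0 <= y <= t0 + b ->
    exists N : nat, forall n s t, (N <= n)%N -> s0 <= s -> t0 <= t ->
      s + a / 2 ^+ n <= s0 + a -> t + b / 2 ^+ n <= t0 + b ->
      s <= x <= s + a / 2 ^+ n -> t <= y <= t + b / 2 ^+ n -> ok n s t) ->
  ok 0%N s0 t0.
Proof.
move=> a0 b0 sub loc; apply: contrapT => ng0.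
pose inr n (p : R * R) := [/\ s0 <= p.1, t0 <= p.2, p.1 + a / 2 ^+ n <= s0 + a &
  p.2 + b / 2 ^+ n <= t0 + b].
have p2 n : 0 <= a / 2 ^+ n by rewrite divr_ge0// exprn_ge0.
have q2 n : 0 <= b / 2 ^+ n by rewrite divr_ge0// exprn_ge0.
have half (c : R) n : c / 2 ^+ n = c / 2 ^+ n.+1 + c / 2 ^+ n.+1.
  rewrite exprSr; field.
  by rewrite expf_neq0.
pose child n (p q : R * R) := [/\ p.1 <= q.1, p.2 <= q.2,
  q.1 + a / 2 ^+ n.+1 <= p.1 + a / 2 ^+ n & q.2 + b / 2 ^+ n.+1 <= p.2 + b / 2 ^+ n].
have step n (p : R * R) : inr n p -> ~ ok n p.1 p.2 ->
    exists q : R * R, child n p q /\ ~ ok n.+1 q.1 q.2.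
  case: p => s t; rewrite /inr /= => -[h1 h2 h3 h4] ng.
  apply: contrapT => nq; apply: ng; apply: sub => //;
  apply: contrapT => ng; apply: nq.
  - by exists (s, t); split => //; split => //=; rewrite lerD2l [leRHS]half lerDl.
  - exists (s + a / 2 ^+ n.+1, t); split => //; split => //=.
    + by rewrite lerDl.
    + by rewrite -addrA -half.
    + by rewrite lerD2l [leRHS]half lerDl.
  - exists (s, t + b / 2 ^+ n.+1); split => //; split => //=.
    + by rewrite lerDl.
    + by rewrite lerD2l [leRHS]half lerDl.
    + by rewrite -addrA -half.
  - exists (s + a / 2 ^+ n.+1, t + b / 2 ^+ n.+1); split => //; split => //=.
    + by rewrite lerDl.
    + by rewrite lerDl.
    + by rewrite -addrA -half.
    + by rewrite -addrA -half.
(* A failing rectangle has a failing child; selecting one at each stage yields a nested sequence of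
   failing rectangles. *)
pose f := fix f n : R * R := if n is m.+1 then
  xget (f m) [set q | child m (f m) q /\ ~ ok m.+1 q.1 q.2] else (s0, t0).
have fP n : inr n (f n) /\ ~ ok n (f n).1 (f n).2.
  elim: n => [|n [i g]]; first by split => //; rewrite /inr /= expr0 !divr1.
  have [q0 hq0] := step _ _ i g.
  have /= := @xgetPex _ (f n) [set q | child n (f n) q /\ ~ ok n.+1 q.1 q.2] (ex_intro _ _ hq0).
  rewrite -/f; move=> [[c1 c2 c3 c4] g']; split => //; case: i => i1 i2 i3 i4; split.
  - exact: le_trans c1.
  - exact: le_trans c2.
  - exact: le_trans i3.
  - exact: le_trans i4.
have fC n : child n (f n) (f n.+1).
  have [i g] := fP n; have [q0 hq0] := step _ _ i g.
  by have /= [] := @xgetPex _ (f n) [set q | child n (f n) q /\ ~ ok n.+1 q.1 q.2] (ex_intro _ _ hq0).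
have fm n k : (f n).1 <= (f (n + k)%N).1 /\ (f n).2 <= (f (n + k)%N).2 /\
    (f (n + k)%N).1 + a / 2 ^+ (n + k) <= (f n).1 + a / 2 ^+ n /\
    (f (n + k)%N).2 + b / 2 ^+ (n + k) <= (f n).2 + b / 2 ^+ n.
  elim: k => [|k [h1 [h2 [h3 h4]]]]; first by rewrite addn0.
  have [c1 c2 c3 c4] := fC (n + k)%N; rewrite addnS.
  by split; [exact: le_trans c1|split; [exact: le_trans c2|split;
    [exact: le_trans h3|exact: le_trans h4]]].
have fle n m : (f n).1 <= (f m).1 + a / 2 ^+ m /\ (f n).2 <= (f m).2 + b / 2 ^+ m.
  have [nm|/ltnW mn] := leqP n m.
    have := fm n (m - n)%N; rewrite subnKC// => -[h1 [h2 _]].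
    by split; [apply: le_trans h1 _|apply: le_trans h2 _]; rewrite lerDl.
  have := fm m (n - m)%N; rewrite subnKC// => -[_ [_ [h1 h2]]].
  by split; [apply: le_trans h1|apply: le_trans h2]; rewrite lerDl.
(* Lower left corners increase in both coordinates and stay below every upper right corner, so their
   suprema give a point of all the rectangles. The local hypothesis at this point contradicts the
   failure. *)
pose X := sup [set (f n).1 | n in setT]; pose Y := sup [set (f n).2 | n in setT].
have XP m : (f m).1 <= X <= (f m).1 + a / 2 ^+ m.
  apply/andP; split.
    apply: ub_le_sup; last by exists m.
    by exists ((f 0%N).1 + a / 2 ^+ 0) => _ [k _ <-]; have [] := fle k 0%N.
  apply: ge_sup; first by exists (f 0%N).1; exists 0%N.
  by move=> _ [k _ <-]; have [] := fle k m.
have YP m : (f m).2 <= Y <= (f m).2 + b / 2 ^+ m.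
  apply/andP; split.
    apply: ub_le_sup; last by exists m.
    by exists ((f 0%N).2 + b / 2 ^+ 0) => _ [k _ <-]; have [] := fle k 0%N.
  apply: ge_sup; first by exists (f 0%N).2; exists 0%N.
  by move=> _ [k _ <-]; have [] := fle k m.
have [||N hN] := loc X Y.
- by have := XP 0%N; rewrite expr0 divr1.
- by have := YP 0%N; rewrite expr0 divr1.
have [[h1 h2 h3 h4] ng] := fP N.
by apply: ng; apply: (hN N).
Qed.

(* The quadratic polynomial A w + B (w - v)^2 / 2 is a primitive of the affine
   approximation A + B (w - v) of h at v. *)
Lemma edge_bound (h : C -> C) (P P' : R -> C) (A B v : C) (a b M K : R) :
  let Q w := A * w + B / 2 * (w - v) ^+ 2 in a <= b -> contin a b P' -> contin a b (fun t => h (P t)) -> (forall t, a <= t -> t <= b -> pder P t (P' t)) ->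
  (forall t, a <= t -> t <= b -> cabs (P' t) <= K) ->
  (forall t, a <= t -> t <= b -> cabs (h (P t) - A - B * (P t - v)) <= M) ->
  cabs (cI a b (fun t => h (P t) * P' t) - (Q (P b) - Q (P a))) <= 2 * (M * K) * (b - a).
Proof.
move=> Q ab cP' ch dP P'K hM.
have cP : contin a b P by move=> t t1 t2; exact: pder_cont (dP t t1 t2).
have cL : contin a b (fun t => A + B * (P t - v)).
  apply: contin_D; first exact: (@contin_cst _ _ _ _ A).
  apply: contin_M; first exact: (@contin_cst _ _ _ _ B).
  exact: (contin_D cP (@contin_cst _ _ _ _ (- v))).
have cLP : contin a b (fun t => (A + B * (P t - v)) * P' t) by apply: contin_M.
have <- : cI a b (fun t => (A + B * (P t - v)) * P' t) = Q (P b) - Q (P a).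
  apply: (cI_FTC (G := Q \o P)) => // t t1 t2.
  have D := cder_B (cder_id (P t)) (cder_cst v (P t)).
  have DQ : is_derive (P t) 1 Q (A + B * (P t - v)).
    apply: (is_derive_eq (cder_D (cder_Z A (cder_id (P t))) (cder_Z (B / 2) (cder_X 2 D)))).
    by field.
  exact: pder_comp DQ (dP t t1 t2).
have cN : contin a b (fun t => -1 * ((A + B * (P t - v)) * P' t)).
  exact: (contin_M (@contin_cst R C a b (-1)) cLP).
have ch' := contin_M ch cP'.
rewrite -mulN1r -(cI_Z _ cLP) -(cI_D ch' cN).
apply: (cI_bound ab (contin_D ch' cN)) => t t1 t2.
have -> : h (P t) * P' t + -1 * ((A + B * (P t - v)) * P' t) = (h (P t) - A - B * (P t - v)) * P' t by ring.
by rewrite cabsM ler_pM ?cabs_ge0// ?hM ?P'K.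
Qed.

Section rect.
Variables (h : C -> C) (Phi Ps Pt : R -> R -> C) (K s0 s1 t0 t1 : R).
Hypotheses (s01 : s0 <= s1) (t01 : t0 <= t1).
Let In s t := (s0 <= s <= s1) /\ (t0 <= t <= t1).
Hypothesis dPs : forall s t, In s t -> pder (Phi ^~ t) s (Ps s t).
Hypothesis dPt : forall s t, In s t -> pder (Phi s) t (Pt s t).
Hypothesis cPs : forall s t, In s t -> {for s, continuous (Ps ^~ t)}.
Hypothesis cPt : forall s t, In s t -> {for t, continuous (Pt s)}.
Hypothesis bPs : forall s t, In s t -> cabs (Ps s t) <= K.
Hypothesis bPt : forall s t, In s t -> cabs (Pt s t) <= K.
Hypothesis lip : forall s t s' t', In s t -> In s' t' ->
  cabs (Phi s t - Phi s' t') <= K * (`|s - s'| + `|t - t'|).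
Hypothesis dh : forall s t, In s t -> derivable h (Phi s t) 1.

Let H t s s' := cI s s' (fun x => h (Phi x t) * Ps x t).
Let V s t t' := cI t t' (fun y => h (Phi s y) * Pt s y).
(** The integral of [h] along the image under [Phi] of the boundary of a parameter rectangle. A
    general Lipschitz [Phi] lets one theorem serve both for families of circles and for triangles, a
    triangle being a square with one side collapsed. *)
Let E s s' t t' := V s t t' + H t' s s' - V s' t t' - H t s s'.

Let cH t s s' : s0 <= s -> s' <= s1 -> t0 <= t -> t <= t1 ->
  contin s s' (fun x => h (Phi x t) * Ps x t).
Proof.
move=> h1 h2 h3 h4; have J x : s <= x -> x <= s' -> In x t.
  by move=> x1 x2; split; apply/andP; split => //; [exact: le_trans x1|exact: le_trans h2].
apply: contin_M => x x1 x2; last by apply: cPs; exact: J.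
apply: (@continuous_comp _ _ _ (Phi ^~ t) h); first by apply: pder_cont; apply: dPs; exact: J.
by apply: derivable_ccont; apply: dh; exact: J.
Qed.

Let cV s t t' : t0 <= t -> t' <= t1 -> s0 <= s -> s <= s1 ->
  contin t t' (fun y => h (Phi s y) * Pt s y).
Proof.
move=> h1 h2 h3 h4; have J x : t <= x -> x <= t' -> In s x.
  by move=> x1 x2; split; apply/andP; split => //; [exact: le_trans x1|exact: le_trans h2].
apply: contin_M => x x1 x2; last by apply: cPt; exact: J.
apply: (@continuous_comp _ _ _ (Phi s) h); first by apply: pder_cont; apply: dPt; exact: J.
by apply: derivable_ccont; apply: dh; exact: J.
Qed.

Let E_split s s' s'' t t' t'' : s0 <= s -> s <= s' -> s' <= s'' -> s'' <= s1 ->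
  t0 <= t -> t <= t' -> t' <= t'' -> t'' <= t1 ->
  E s s'' t t'' = E s s' t t' + E s' s'' t t' + E s s' t' t'' + E s' s'' t' t''.
Proof.
move=> a1 a2 a3 a4 b1 b2 b3 b4.
have b5 := le_trans b1 b2; have b6 := le_trans b5 b3.
have a5 := le_trans a1 a2; have a6 := le_trans a5 a3.
have b7 := le_trans b3 b4; have a7 := le_trans a3 a4.
have b8 := le_trans b2 b7; have a8 := le_trans a2 a7.
rewrite /E; have -> : V s t t'' = V s t t' + V s t' t'' by apply: cI_chain => //; apply: cV.
have -> : V s'' t t'' = V s'' t t' + V s'' t' t'' by apply: cI_chain => //; apply: cV.
have -> : H t s s'' = H t s s' + H t s' s'' by apply: cI_chain => //; apply: cH.
have -> : H t'' s s'' = H t'' s s' + H t'' s' s'' by apply: cI_chain => //; apply: cH.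
by ring.
Qed.

Let half_small (c d : R) : 0 < d -> exists N : nat, forall n, (N <= n)%N -> c / 2 ^+ n < d.
Proof.
move=> d0; exists (Num.bound (`|c| / d)) => n Nn.
rewrite ltr_pdivrMr ?exprn_gt0// mulrC -ltr_pdivrMr// (le_lt_trans (y := `|c| / d))//.
  by rewrite ler_pM2r ?invr_gt0// ler_norm.
rewrite (lt_le_trans (archi_boundP _))// ?divr_ge0//; first exact: ltW.
rewrite (le_trans (y := n%:R))// ?ler_nat// -natrX ler_nat ltnW//.
exact: ltn_expl.
Qed.

Let a := s1 - s0.
Let b := t1 - t0.

(** Near [v] the function [h] is affine up to [e] times the distance, and affine functions have
    primitives. In generation [n] the distance is at most K (a + b) / 2 ^ n; with the factor 2 of
    the edge estimate, the speed bound [K] and a perimeter of 2 (a + b) / 2 ^ n, this gives the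
    constant 4 K ^ 2 (a + b) ^ 2 over 4 ^ n. *)
Let E_local e : 0 < e -> forall x y, s0 <= x <= s0 + a -> t0 <= y <= t0 + b ->
    exists N : nat, forall n s t, (N <= n)%N -> s0 <= s -> t0 <= t ->
      s + a / 2 ^+ n <= s0 + a -> t + b / 2 ^+ n <= t0 + b ->
      s <= x <= s + a / 2 ^+ n -> t <= y <= t + b / 2 ^+ n ->
  cabs (E s (s + a / 2 ^+ n) t (t + b / 2 ^+ n)) <= e * (4 * K ^+ 2 * (a + b) ^+ 2) / 4 ^+ n.
Proof.
move=> e0 x y xa yb.
have sa : s0 + a = s1 by rewrite /a; ring.
have tb : t0 + b = t1 by rewrite /b; ring.
have Ixy : In x y by rewrite /In -sa -tb.
have [a0 b0] : 0 <= a /\ 0 <= b by rewrite /a /b !subr_ge0.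
have K0 : 0 <= K by apply: le_trans (bPs Ixy); exact: cabs_ge0.
set v := Phi x y; have dv := dh Ixy; set l := 'D_1 h v.
have [d d0 hd] := (cderP h v l).1 (derivableP dv) e e0.
have [N hN] := half_small (K * (a + b)) d0.
exists N => n s t Nn s0s t0t; rewrite sa tb => sa1 tb1 /andP[sx xs] /andP[ty yt].
set s' := s + _ in sa1 xs *; set t' := t + _ in tb1 yt *.
have an0 : 0 <= a / 2 ^+ n by rewrite divr_ge0// exprn_ge0.
have bn0 : 0 <= b / 2 ^+ n by rewrite divr_ge0// exprn_ge0.
have ss' : s <= s' by rewrite lerDl.
have tt' : t <= t' by rewrite lerDl.
have InR p q : s <= p -> p <= s' -> t <= q -> q <= t' -> In p q.
  move=> p1 p2 q1 q2; split; apply/andP; split.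
  - exact: le_trans p1.
  - exact: le_trans sa1.
  - exact: le_trans q1.
  - exact: le_trans tb1.
pose M := e * (K * (a + b) / 2 ^+ n).
have err p q : s <= p -> p <= s' -> t <= q -> q <= t' ->
    cabs (h (Phi p q) - h v - l * (Phi p q - v)) <= M.
  move=> p1 p2 q1 q2; have Ipq := InR p q p1 p2 q1 q2.
  have kb : cabs (Phi p q - v) <= K * (a + b) / 2 ^+ n.
    apply: (le_trans (lip Ipq Ixy)); rewrite -mulrA ler_wpM2l// mulrDl lerD//.
      by rewrite ler_norml; apply/andP; split; rewrite /s' in xs p2; lra.
    by rewrite ler_norml; apply/andP; split; rewrite /t' in yt q2; lra.
  have := hd (Phi p q - v); rewrite [v + _]addrC subrK (mulrC _ l) => /(_ (le_lt_trans kb (hN n Nn))).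
  by move=> /le_trans; apply; rewrite ler_wpM2l// ltW.
have InH p q : s <= p -> p <= s' -> t <= q -> q <= t' ->
  {for p, continuous (fun s => h (Phi s q))} /\ {for q, continuous (fun t => h (Phi p t))}.
  move=> p1 p2 q1 q2; have Ipq := InR p q p1 p2 q1 q2.
  split.
    apply: (@continuous_comp _ _ _ (Phi ^~ q) h); first by apply: pder_cont (dPs Ipq).
    by apply: derivable_ccont; exact: dh.
  apply: (@continuous_comp _ _ _ (Phi p) h); first by apply: pder_cont (dPt Ipq).
  by apply: derivable_ccont; exact: dh.
pose Q w := h v * w + l / 2 * (w - v) ^+ 2.
have eV p : s <= p -> p <= s' ->
    cabs (V p t t' - (Q (Phi p t') - Q (Phi p t))) <= 2 * (M * K) * (t' - t).
  move=> p1 p2; apply: (edge_bound (v := v) tt').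
  - by move=> q q1 q2; apply: cPt; exact: InR.
  - by move=> q q1 q2; exact: (InH p q p1 p2 q1 q2).2.
  - by move=> q q1 q2; apply: dPt; exact: InR.
  - by move=> q q1 q2; apply: bPt; exact: InR.
  - by move=> q q1 q2; apply: err.
have eH q : t <= q -> q <= t' ->
    cabs (H q s s' - (Q (Phi s' q) - Q (Phi s q))) <= 2 * (M * K) * (s' - s).
  move=> q1 q2; apply: (@edge_bound h (Phi ^~ q) (Ps ^~ q) _ _ v _ _ M K ss').
  - by move=> p p1 p2; apply: cPs; exact: InR.
  - by move=> p p1 p2; exact: (InH p q p1 p2 q1 q2).1.
  - by move=> p p1 p2; apply: dPs; exact: InR.
  - by move=> p p1 p2; apply: bPs; exact: InR.
  - by move=> p p1 p2; apply: err.
(* The increments of the primitive [Q] telescope around the boundary, so they can be subtracted edge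
   by edge. *)
have -> : E s s' t t' = (V s t t' - (Q (Phi s t') - Q (Phi s t))) +
   (H t' s s' - (Q (Phi s' t') - Q (Phi s t'))) -
   (V s' t t' - (Q (Phi s' t') - Q (Phi s' t))) -
   (H t s s' - (Q (Phi s' t) - Q (Phi s t))) by rewrite /E; ring.
apply: (le_trans (cabsBD _ _)).
apply: (le_trans (lerD (cabsBD _ _) (lexx _))).
apply: (le_trans (lerD (lerD (cabsD _ _) (lexx _)) (lexx _))).
apply: (le_trans (lerD (lerD (lerD (eV s (lexx _) ss') (eH t' tt' (lexx _)))
  (eV s' ss' (lexx _))) (eH t (lexx _) tt'))).
rewrite le_eqVlt; apply/orP; left; apply/eqP.
have -> : (4 : R) ^+ n = 2 ^+ n * 2 ^+ n by rewrite -exprMn; congr (_ ^+ _); ring.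
rewrite /s' /t' /M; field.
by rewrite expf_neq0.
Qed.

(** The bound e D / 4 ^ n passes from four children to their parent, so bisection brings the local
    estimate to generation 0, for every [e]. *)
Lemma goursat : E s0 s1 t0 t1 = 0.
Proof.
have [a0 b0] : 0 <= a /\ 0 <= b by rewrite /a /b !subr_ge0.
have sa : s0 + a = s1 by rewrite /a; ring.
have tb : t0 + b = t1 by rewrite /b; ring.
set D := 4 * K ^+ 2 * (a + b) ^+ 2.
have D0 : 0 <= D by rewrite /D mulr_ge0 ?sqr_ge0// mulr_ge0 ?sqr_ge0.
suff W e : 0 < e -> cabs (E s0 s1 t0 t1) <= e * D.
  apply/eqP; rewrite -cabs_eq0 eq_le cabs_ge0 andbT leNgt; apply/negP => X0.
  have := W (cabs (E s0 s1 t0 t1) / (2 * (D + 1))) ltac:(by rewrite divr_gt0// mulr_gt0// ltr_pwDr).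
  rewrite mulrAC ler_pdivlMr ?mulr_gt0// ?ltr_pwDr//.
  by rewrite leNgt ltr_pM2l// => /negP; apply; lra.
move=> e0.
have := @bisect2 (fun n s t => cabs (E s (s + a / 2 ^+ n) t (t + b / 2 ^+ n)) <= e * D / 4 ^+ n)
  s0 t0 a b a0 b0.
rewrite !expr0 !divr1 sa tb; apply; last first.
  by move=> x y; have := @E_local e e0 x y; rewrite sa tb; exact.
move=> n s t h1 h2 h3 h4.
have half (c : R) : c / 2 ^+ n = c / 2 ^+ n.+1 + c / 2 ^+ n.+1.
  by rewrite exprSr; field; rewrite expf_neq0.
have an0 : 0 <= a / 2 ^+ n.+1 by rewrite divr_ge0// exprn_ge0.
have bn0 : 0 <= b / 2 ^+ n.+1 by rewrite divr_ge0// exprn_ge0.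
rewrite (half a) (half b) !addrA in h3 h4 *.
set s' := s + a / 2 ^+ n.+1; set t' := t + b / 2 ^+ n.+1 => g1 g2 g3 g4.
rewrite (@E_split s s' _ t t') ?lerDl//.
have -> : e * D / 4 ^+ n = e * D / 4 ^+ n.+1 + e * D / 4 ^+ n.+1 + e * D / 4 ^+ n.+1 + e * D / 4 ^+ n.+1.
  by rewrite exprSr; field; rewrite expf_neq0.
apply: (le_trans (cabsD _ _)); rewrite lerD//.
apply: (le_trans (cabsD _ _)); rewrite lerD//.
by apply: (le_trans (cabsD _ _)); rewrite lerD.
Qed.
End rect.
End Goursat.

(** * Deformation of circles and Cauchy's formula *)

Section Cauchy.
Context {R : realType}.
Local Notation C := (CC R).
Implicit Types (z w : C) (r s t x y : R).

Definition mean (u : R -> R) : R := (2 * pi)^-1 * I 0 (2 * pi) u.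
Definition cmean (F : R -> C) : C := rc ((2 * pi)^-1) * cI 0 (2 * pi) F.

Lemma tpi_gt0 : 0 < 2 * pi :> R. Proof. by rewrite mulr_gt0// pi_gt0. Qed.
Let tp0 := tpi_gt0.
Let tpn0 : (2 * pi : R) != 0. Proof. exact: lt0r_neq0. Qed.

Lemma eit_lip t t' : cabs (eit t - eit t') <= 2 * `|t - t'|.
Proof.
wlog tt' : t t' / t' <= t.
  move=> H; have [/H//|/ltW/H] := leP t' t.
  by rewrite cabsB distrC.
rewrite -(cI_FTC (F := fun t => Complex 0 1 * eit t) tt').
- rewrite ger0_norm ?subr_ge0//.
  have := @cI_bound R t' t (fun t => Complex 0 1 * eit t) 1 tt'; rewrite mulr1; apply.
    by move=> x _ _; apply: pder_cont; apply: pder_M; [exact: pder_cst|exact: pder_eit].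
  move=> x _ _; rewrite cabsM cabs_eit mulr1 cabsE /cRe /cIm /=.
  by rewrite expr0n expr1n add0r sqrtr1.
- by move=> x _ _; apply: pder_cont; apply: pder_M; [exact: pder_cst|exact: pder_eit].
- by move=> x _ _; exact: pder_eit.
Qed.

Lemma cabs_i : cabs (Complex 0 1 : C) = 1.
Proof. by rewrite cabsE /cRe /cIm /= expr0n expr1n add0r sqrtr1. Qed.

(** Goursat's theorem for circles whose centre and radius depend affinely on [s]. The sides t = 0
    and t = 2 pi of the parameter rectangle have the same image and cancel, which leaves the circles
    at [s0] and at 1. *)
Lemma deform (h : C -> C) (a0 a1 b0 b1 : C) (s0 : R) : 0 <= s0 -> s0 <= 1 ->
  (forall s t, s0 <= s -> s <= 1 ->
     derivable h (a0 + rc s * a1 + (b0 + rc s * b1) * eit t) 1) ->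
  let F s t := h (a0 + rc s * a1 + (b0 + rc s * b1) * eit t) *
     ((b0 + rc s * b1) * (Complex 0 1 * eit t)) in
  cI 0 (2 * pi) (F s0) = cI 0 (2 * pi) (F 1).
Proof.
move=> s00 s01 dh F.
pose Phi s t := a0 + rc s * a1 + (b0 + rc s * b1) * eit t.
pose Ps (s : R) t := a1 + b1 * eit t.
pose Pt s t := (b0 + rc s * b1) * (Complex 0 1 * eit t).
pose K := 2 * (cabs a1 + cabs b1 + cabs b0).
have Bb s : s0 <= s -> s <= 1 -> cabs (b0 + rc s * b1) <= cabs b0 + cabs b1.
  move=> h1 h2; apply: (le_trans (cabsD _ _)); rewrite lerD2l cabsM cabs_rc.
  by rewrite ger0_norm ?ler_piMl ?cabs_ge0//; exact: le_trans h1.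
have := @goursat R h Phi Ps Pt K s0 1 0 (2 * pi) s01 (ltW tp0).
have side : (fun x => h (Phi x (2 * pi)) * Ps x (2 * pi)) = (fun x => h (Phi x 0) * Ps x 0).
  by apply/funext => x; rewrite /Phi /Ps eit_2pi.
rewrite side => G.
have {}G : cI 0 (2 * pi) (fun y => h (Phi s0 y) * Pt s0 y) -
   cI 0 (2 * pi) (fun y => h (Phi 1 y) * Pt 1 y) = 0.
  rewrite -[RHS]G; first by ring.
  - move=> s t _; have d c := pder_M (pder_rc s) (pder_cst c s).
    have := pder_D (pder_D (pder_cst a0 s) (d a1))
      (pder_M (pder_D (pder_cst b0 s) (d b1)) (pder_cst (eit t) s)).
    by congr pder; rewrite /Ps; ring.
  - move=> s t _; have := pder_D (pder_cst (a0 + rc s * a1) t)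
      (pder_M (pder_cst (b0 + rc s * b1) t) (pder_eit t)).
    by congr pder; rewrite /Pt; ring.
  - move=> s t _; exact: cst_continuous.
  - move=> s t _; apply: pder_cont; apply: pder_M; first exact: pder_cst.
    by apply: pder_M; [exact: pder_cst|exact: pder_eit].
  - move=> s t _; apply: (le_trans (cabsD _ _)).
    rewrite cabsM cabs_eit mulr1 /K; have := cabs_ge0 a1; have := cabs_ge0 b1.
    have := cabs_ge0 b0; lra.
  - move=> s t [/andP[h1 h2] _]; rewrite /Pt !cabsM cabs_eit cabs_i !mulr1.
    apply: (le_trans (Bb s h1 h2)); rewrite /K; have := cabs_ge0 a1; have := cabs_ge0 b1.
    have := cabs_ge0 b0; lra.
  - move=> s t s' t' _ [/andP[h1 h2] _].
    have -> : Phi s t - Phi s' t' = rc (s - s') * (a1 + b1 * eit t) +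
       (b0 + rc s' * b1) * (eit t - eit t') by rewrite /Phi rcB; ring.
    apply: (le_trans (cabsD _ _)); rewrite [K * _]mulrDr lerD// cabsM.
      rewrite cabs_rc mulrC ler_wpM2r// (le_trans (cabsD _ _))//.
      rewrite cabsM cabs_eit mulr1 /K; have := cabs_ge0 a1; have := cabs_ge0 b1.
      have := cabs_ge0 b0; lra.
    apply: (le_trans (ler_pM _ _ (Bb s' h1 h2) (eit_lip t t'))); rewrite ?cabs_ge0//.
    rewrite mulrA ler_wpM2r// /K; have := cabs_ge0 a1; lra.
  - by move=> s t [/andP[h1 h2] _]; exact: dh.
by apply/eqP; rewrite -subr_eq0; apply/eqP.
Qed.

Lemma contin_circle (T : topologicalType) (G : C -> T) rho :
  (forall t, {for rc rho * eit t, continuous G}) ->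
  contin 0 (2 * pi) (fun t => G (rc rho * eit t)).
Proof.
move=> h t _ _; apply: (@continuous_comp _ _ _ (fun t => rc rho * eit t) G); last exact: h.
exact: pder_cont (pder_M (pder_cst (rc rho) t) (pder_eit t)).
Qed.

Lemma contin_eit rho : contin 0 (2 * pi) (fun t => rc rho * eit t).
Proof. by move=> t _ _; exact: pder_cont (pder_M (pder_cst (rc rho) t) (pder_eit t)). Qed.

Lemma cmean_ext (F G : R -> C) : (forall t, F t = G t) -> cmean F = cmean G.
Proof. by move=> h; rewrite /cmean; congr (_ * _); apply: cI_ext => t _ _. Qed.
Lemma cmeanD (F G : R -> C) : contin 0 (2 * pi) F -> contin 0 (2 * pi) G ->
  cmean (fun t => F t + G t) = cmean F + cmean G.
Proof. by move=> h k; rewrite /cmean (cI_D h k) mulrDr. Qed.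
Lemma cmeanZ (F : R -> C) z : contin 0 (2 * pi) F -> cmean (fun t => z * F t) = z * cmean F.
Proof. by move=> h; rewrite /cmean (cI_Z _ h) mulrCA. Qed.
Lemma cmean_cst z : cmean (fun=> z) = z.
Proof.
rewrite /cmean; have -> : cI 0 (2 * pi) (fun=> z) = rc (2 * pi) * z.
  apply: ceqP; rewrite ?cReE ?cImE ?cI_Re ?cI_Im !(I_cst _ (ltW tp0)) ?subr0.
    by rewrite mul0r subr0 mulrC.
  by rewrite mul0r addr0 mulrC.
by rewrite mulrA -rcM mulVf// mul1r.
Qed.
Lemma cmean_Re F : cRe (cmean F) = mean (cRe \o F).
Proof. by rewrite /cmean ?cReE cI_Re cIm_rc mul0r subr0. Qed.
Lemma cmean_bound (F : R -> C) M : contin 0 (2 * pi) F ->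
  (forall t, cabs (F t) <= M) -> cabs (cmean F) <= 2 * M.
Proof.
move=> h k; rewrite /cmean cabsM cabs_rc.
rewrite ger0_norm ?invr_ge0 ?(ltW tp0)// (ler_pdivrMl _ _ tp0).
rewrite [leRHS]mulrC; have := @cI_bound R 0 (2 * pi) F M (ltW tp0) h.
by rewrite subr0; apply => t _ _; exact: k.
Qed.

Let circ_ne rho z t : cabs z < rho -> rc rho * eit t - z != 0.
Proof.
move=> zr; rewrite subr_eq0; apply: contraTneq zr => <-.
by rewrite cabsM cabs_eit cabs_rc mulr1 -leNgt ler_norm.
Qed.

(** The function 1 / w is integrated along a circle of radius [rho] whose centre moves from 0 to -
    z. The origin stays inside throughout, and at the start the integrand is constant. *)
Lemma mean_kernel rho z : cabs z < rho ->
  cmean (fun t => rc rho * eit t / (rc rho * eit t - z)) = 1.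
Proof.
move=> zr; have r0 : 0 < rho by apply: le_lt_trans zr; exact: cabs_ge0.
have zs s : 0 <= s -> s <= 1 -> cabs (rc s * z) < rho.
  move=> s0 s1; rewrite cabsM cabs_rc ger0_norm//; apply: le_lt_trans zr.
  by rewrite ler_piMl ?cabs_ge0.
have ne s t : 0 <= s -> s <= 1 -> 0 + rc s * (- z) + (rc rho + rc s * 0) * eit t != 0.
  move=> s0 s1; have := circ_ne t (zs s s0 s1); congr (_ != _).
  by ring.
have E := @deform (fun w => w^-1) 0 (- z) (rc rho) 0 0 (lexx 0) ler01
  (fun s t h1 h2 => cderV (cder_V (cder_id _) (ne s t h1 h2))).
have cK : contin 0 (2 * pi) (fun t => rc rho * eit t / (rc rho * eit t - z)).
  apply: (contin_circle (G := fun w => w / (w - z))) => t.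
  apply: is_derive_ccont (cder_M (cder_id _) (cder_V (cder_B (cder_id _) (cder_cst z _)) _)).
  exact: circ_ne.
have i0 : Complex 0 1 != 0 :> C by rewrite -cabs_gt0 cabs_i.
apply: (mulfI i0); rewrite -(cmeanZ _ cK) mulr1.
transitivity (cmean (fun=> Complex 0 1)); last exact: cmean_cst.
rewrite /cmean; congr (_ * _); transitivity (cI 0 (2 * pi) (fun t : R =>
   (0 + rc 1 * - z + (rc rho + rc 1 * 0) * eit t)^-1 *
   ((rc rho + rc 1 * 0) * (Complex 0 1 * eit t)))).
  apply: cI_ext => t _ _; rewrite rc1.
  have -> : 0 + 1 * - z + (rc rho + 1 * 0) * eit t = rc rho * eit t - z by ring.
  by field; exact: circ_ne.
rewrite -E; apply: cI_ext => t _ _; rewrite rc0.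
have -> : 0 + 0 * - z + (rc rho + 0 * 0) * eit t = rc rho * eit t by ring.
have ne0 : rc rho * eit t != 0.
  by rewrite -cabs_gt0 cabsM cabs_eit mulr1 cabs_rc normr_gt0 lt0r_neq0.
have -> : rc rho + 0 * 0 = rc rho by ring.
by field; move: ne0; rewrite mulf_eq0 negb_or => /andP[-> ->].
Qed.

(** The circle is contracted towards [z] through its homothetic images [W s]. The mean is the same
    for all s > 0, and as s tends to 0 it approaches [g z] times the mean of the kernel, which is
    1. *)
Lemma cauchy_formula (g : C -> C) rho z : (forall w, cabs w <= rho -> derivable g w 1) ->
  cabs z < rho ->
  g z = cmean (fun t => g (rc rho * eit t) * (rc rho * eit t / (rc rho * eit t - z))).
Proof.
move=> dg zr; have r0 : 0 < rho by apply: le_lt_trans zr; exact: cabs_ge0.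
have rr t : cabs (rc rho * eit t) = rho.
  by rewrite cabsM cabs_eit mulr1 cabs_rc gtr0_norm.
pose W s t := z + rc s * (rc rho * eit t - z).
have Wr s t : 0 <= s -> s <= 1 -> cabs (W s t) <= rho.
  move=> s0 s1; have -> : W s t = rc (1 - s) * z + rc s * (rc rho * eit t).
    by rewrite /W rcB rc1; ring.
  apply: (le_trans (cabsD _ _)); rewrite [cabs (rc s * _)]cabsM rr cabsM !cabs_rc.
  rewrite (ger0_norm s0) (ger0_norm (_ : 0 <= 1 - s)) ?subr_ge0//.
  have : (1 - s) * cabs z <= (1 - s) * rho by rewrite ler_wpM2l ?subr_ge0// ltW.
  by lra.
pose k t := rc rho * eit t / (rc rho * eit t - z).
have ck : contin 0 (2 * pi) k.
  apply: (contin_circle (G := fun w => w / (w - z))) => t.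
  apply: is_derive_ccont (cder_M (cder_id _) (cder_V (cder_B (cder_id _) (cder_cst z _)) _)).
  exact: circ_ne.
have cW s : contin 0 (2 * pi) (W s).
  move=> t _ _; exact: pder_cont (pder_D (pder_cst z t) (pder_M (pder_cst (rc s) t)
    (pder_D (pder_M (pder_cst (rc rho) t) (pder_eit t)) (pder_cst (- z) t)))).
have cgW s : 0 <= s -> s <= 1 -> contin 0 (2 * pi) (fun t => g (W s t)).
  move=> s0 s1; apply: (contin_comp (cW s)) => t _ _.
  by apply: derivable_ccont; apply: dg; exact: Wr.
have cgk s : 0 <= s -> s <= 1 -> contin 0 (2 * pi) (fun t => g (W s t) * k t).
  by move=> s0 s1; exact: contin_M (cgW s s0 s1) ck.
have E s : 0 < s -> s <= 1 ->
    cmean (fun t => g (W s t) * k t) = cmean (fun t => g (W 1 t) * k t).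
  move=> s0 s1.
  have We u t : z + rc u * - z + (0 + rc u * rc rho) * eit t = W u t by rewrite /W; ring.
  have dq u t : s <= u -> u <= 1 -> derivable (fun w => g w / (w - z))
      (z + rc u * - z + (0 + rc u * rc rho) * eit t) 1.
    move=> su u1; rewrite We; have u0 := lt_le_trans s0 su.
    apply: cderV (cder_M (derivableP (dg _ (Wr u t (ltW u0) u1))) (cder_V (cder_B (cder_id _) (cder_cst z _)) _)).
    by rewrite /W [z + _]addrC addrK mulf_neq0 ?circ_ne// rc_eq0 lt0r_neq0.
  have i0 : Complex 0 1 != 0 :> C by rewrite -cabs_gt0 cabs_i.
  have Eu u : 0 < u -> u <= 1 -> cI 0 (2 * pi) (fun t : R =>
     g (z + rc u * - z + (0 + rc u * rc rho) * eit t) / (z + rc u * - z + (0 + rc u * rc rho) * eit t - z) *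
      ((0 + rc u * rc rho) * (Complex 0 1 * eit t))) = Complex 0 1 * cI 0 (2 * pi) (fun t => g (W u t) * k t).
    move=> u0 u1; rewrite -(cI_Z _ (cgk u (ltW u0) u1)); apply: cI_ext => t _ _.
    rewrite We /k; have -> : W u t - z = rc u * (rc rho * eit t - z) by rewrite /W; ring.
    by field; rewrite circ_ne// rc_eq0 lt0r_neq0.
  have := @deform (fun w => g w / (w - z)) z (- z) 0 (rc rho) s (ltW s0) s1 dq.
  by rewrite /= (Eu s s0 s1) (Eu 1 ltr01 (lexx 1)) => /(mulfI i0); rewrite /cmean => ->.
have -> : cmean (fun t => g (rc rho * eit t) * (rc rho * eit t / (rc rho * eit t - z))) =
    cmean (fun t => g (W 1 t) * k t).
  apply: cmean_ext => t; rewrite /W rc1; congr (g _ * _).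
  by ring.
apply/eqP; rewrite -subr_eq0 -cabs_eq0 eq_le cabs_ge0 andbT.
have kb t : cabs (k t) <= rho / (rho - cabs z).
  rewrite /k cabs_div rr ler_pM2l// lef_pV2 ?posrE ?subr_gt0//.
    by rewrite -{1}(rr t) cabs_sub.
  by rewrite cabs_gt0 circ_ne.
set B := rho / (rho - cabs z) in kb.
have B0 : 0 < B by rewrite divr_gt0// subr_gt0.
apply/ler_addgt0Pr => e e0; rewrite add0r.
have /ccontP/(_ (e / 2 / B)) [|d d0 hd] := derivable_ccont (dg z (ltW zr)).
  by apply: divr_gt0 B0; apply: divr_gt0.
have D0 : 0 < 2 * (rho + cabs z) by rewrite mulr_gt0// ltr_pwDl// cabs_ge0.
(* Since |W s t - z| <= s (rho + |z|), this [s] keeps [W s t] within d / 2 of [z]. *)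
pose s := Num.min 1 (d / (2 * (rho + cabs z))).
have s0 : 0 < s by rewrite lt_min ltr01 divr_gt0.
have s1 : s <= 1 by rewrite ge_min lexx.
rewrite -(E s s0 s1).
have -> : g z = cmean (fun t => g z * k t).
  by rewrite (cmeanZ _ ck) mean_kernel// mulr1.
rewrite cabsB.
have cgz : contin 0 (2 * pi) (fun t => g z * k t) by exact: contin_M (@contin_cst R C _ _ (g z)) ck.
rewrite -[X in cabs (_ - X)]mul1r -mulNr -(cmeanZ _ cgz) -cmeanD; last 2 first.
- exact: cgk (ltW s0) s1.
- exact: contin_M (@contin_cst R C _ _ (-1)) cgz.
have -> : e = 2 * (e / 2 / B * B) by field; exact: lt0r_neq0.
apply: cmean_bound => [|t].
  exact: contin_D (cgk s (ltW s0) s1) (contin_M (@contin_cst R C _ _ (-1)) cgz).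
have -> : g (W s t) * k t + -1 * (g z * k t) = (g (W s t) - g z) * k t by ring.
rewrite cabsM ler_pM ?cabs_ge0// ltW// hd// /W [z + _]addrC addrK cabsM cabs_rc gtr0_norm//.
have : cabs (rc rho * eit t - z) <= rho + cabs z by rewrite (le_trans (cabsBD _ _))// rr.
move=> /(ler_wpM2l (ltW s0)) /le_lt_trans; apply.
have : s <= d / (2 * (rho + cabs z)) by rewrite ge_min lexx orbT.
by rewrite ler_pdivlMr//; lra.
Qed.
End Cauchy.

(** * Cauchy transforms and Liouville's theorem *)

Section CauchyTransform.
Context {R : realType}.
Local Notation C := (CC R).
Local Notation tp := (2 * pi : R).
Implicit Types (z w : C) (r s t x y : R).

Lemma contin_bounded a b (F : R -> C) : a <= b -> contin a b F ->
  exists2 M : R, 0 < M & forall t, a <= t -> t <= b -> cabs (F t) <= M.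
Proof.
move=> ab cF.
have [c _ hc] := @EVT_max R (fun t => cabs (F t)) a b ab (contin_within (contin_abs cF)).
exists (cabs (F c) + 1); first by rewrite ltr_wpDl ?cabs_ge0.
move=> t t1 t2; apply: (le_trans (hc t _)); first by rewrite in_itv/= t1.
by rewrite lerDl.
Qed.

Lemma cmean_bd (F : R -> C) M : contin 0 tp F ->
  (forall t, 0 <= t -> t <= tp -> cabs (F t) <= M) -> cabs (cmean F) <= 2 * M.
Proof.
move=> h k; have tp0 := @tpi_gt0 R.
rewrite /cmean cabsM cabs_rc ger0_norm ?invr_ge0 ?(ltW tp0)// (ler_pdivrMl _ _ tp0).
by rewrite [leRHS]mulrC; have := @cI_bound R 0 tp F M (ltW tp0) h; rewrite subr0; apply.
Qed.

Lemma cmeanB (F G : R -> C) : contin 0 tp F -> contin 0 tp G ->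
  cmean (fun t => F t - G t) = cmean F - cmean G.
Proof.
move=> cF cG; have cN := contin_M (@contin_cst R C 0 tp (-1)) cG.
rewrite -[X in _ - X]mul1r -mulNr -(cmeanZ _ cG) -(cmeanD cF cN).
by apply: cmean_ext => t; rewrite mulN1r.
Qed.

Lemma conB a b (F G : R -> C) : contin a b F -> contin a b G -> contin a b (fun t => F t - G t).
Proof.
by move=> cF cG t t1 t2; apply: (@continuousB _ _ _ F G); [exact: cF|exact: cG].
Qed.

(** Differentiation under the integral sign. A remainder quadratic in [h], uniformly in [t],
    suffices for the kernels in question, whose remainders are explicit rational functions. *)
Lemma cmean_der (phi : R -> C) (k k' : C -> R -> C) z B d : 0 < d -> contin 0 tp phi ->
  (forall h, cabs h < d -> contin 0 tp (k (z + h))) -> contin 0 tp (k' z) ->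
  (forall h t, cabs h < d -> cabs (k (z + h) t - k z t - h * k' z t) <= B * cabs h ^+ 2) ->
  is_derive z 1 (fun z => cmean (fun t => phi t * k z t)) (cmean (fun t => phi t * k' z t)).
Proof.
move=> d0 cphi ck ck' kB; have tp0 := @tpi_gt0 R.
have [M M0 hM] := contin_bounded (ltW tp0) cphi.
have ckz : contin 0 tp (k z) by rewrite -[z]addr0; apply: ck; rewrite cabs0.
have B0 : 0 <= `|B| by [].
apply/cderP => e e0.
pose D := 2 * M * (`|B| + 1).
have D0 : 0 < D by rewrite /D !mulr_gt0// ltr_wpDl.
exists (Num.min d (e / D)); first by rewrite lt_min d0 divr_gt0.
move=> h; rewrite lt_min => /andP[hd he].
have c1 := contin_M cphi (ck _ hd); have c2 := contin_M cphi ckz; have c3 := contin_M cphi ck'.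
have c4 := contin_M (@contin_cst R C 0 tp h) c3.
rewrite -(cmeanZ _ c3) -(cmeanB c1 c2) -(cmeanB (conB c1 c2) c4).
have -> : e * cabs h = 2 * (e * cabs h / 2) by field.
apply: cmean_bd (conB (conB c1 c2) c4) _ => t t1 t2.
have -> : phi t * k (z + h) t - phi t * k z t - h * (phi t * k' z t) =
  phi t * (k (z + h) t - k z t - h * k' z t) by ring.
rewrite cabsM; apply: (le_trans (ler_pM (cabs_ge0 _) (cabs_ge0 _) (hM t t1 t2) (kB h t hd))).
have : M * (B * cabs h ^+ 2) <= M * ((`|B| + 1) * cabs h ^+ 2).
  rewrite ler_pM2l// ler_wpM2r ?sqr_ge0// (le_trans (ler_norm B))//; lra.
move=> /le_trans; apply.
rewrite -[e * _]mulrC; have -> : M * ((`|B| + 1) * cabs h ^+ 2) = cabs h * (D * cabs h) / 2.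
  by rewrite /D; field.
rewrite ler_pM2r// ler_wpM2l ?cabs_ge0//.
by rewrite mulrC -ler_pdivlMr// ltW.
Qed.

Section CT.
Variables (rho : R) (phi : R -> C).
Hypothesis cphi : contin 0 tp phi.
Let w t : C := rc rho * eit t.

Lemma circ_sub z t : cabs z < rho -> rho - cabs z <= cabs (w t - z).
Proof.
move=> zr; have r0 : 0 < rho by apply: le_lt_trans zr; exact: cabs_ge0.
by apply: le_trans (cabs_sub _ _); rewrite /w cabsM cabs_eit cabs_rc mulr1 gtr0_norm.
Qed.
Lemma circ_neq z t : cabs z < rho -> w t - z != 0.
Proof.
move=> zr; rewrite -cabs_gt0; apply: lt_le_trans (circ_sub t zr).
by rewrite subr_gt0.
Qed.
Lemma contin_kernel n z : cabs z < rho -> contin 0 tp (fun t => (w t - z) ^- n).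
Proof.
move=> zr; apply: (contin_circle (G := fun w => (w - z) ^- n)) => t.
apply: is_derive_ccont (cder_V (cder_X n (cder_B (cder_id _) (cder_cst z _))) _).
by rewrite expf_neq0// circ_neq.
Qed.
Let near_disc z h : cabs z < rho -> cabs h < (rho - cabs z) / 2 -> cabs (z + h) < rho.
Proof. by move=> zr hh; apply: (le_lt_trans (cabsD _ _)); lra. Qed.

(** The remainder of the kernel is exactly h ^ 2 / ((w - z - h) (w - z) ^ 2), and for |h| < d both
    [z] and [z + h] keep distance [d] from the circle. *)
Lemma cauchy_transf1_der z : cabs z < rho ->
  is_derive z 1 (fun z => cmean (fun t => phi t * (w t - z) ^- 1))
    (cmean (fun t => phi t * (w t - z) ^- 2)).
Proof.
move=> zr; set d := (rho - cabs z) / 2.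
have d0 : 0 < d by rewrite divr_gt0// subr_gt0.
apply: (@cmean_der phi (fun z t => (w t - z) ^- 1) (fun z t => (w t - z) ^- 2) z (d ^- 3) d d0 cphi).
- by move=> h hd; apply: contin_kernel; exact: near_disc.
- exact: contin_kernel.
move=> h t hd; have zh := near_disc zr hd.
have n1 := circ_neq t zr; have n2 := circ_neq t zh.
have -> : (w t - (z + h)) ^- 1 - (w t - z) ^- 1 - h * (w t - z) ^- 2 =
  (w t - (z + h))^-1 * (w t - z) ^- 2 * h ^+ 2 by rewrite !expr1; field; rewrite n1.
rewrite !cabsM !cabsV !cabsX ler_wpM2r ?sqr_ge0//.
have -> : d ^- 3 = d^-1 * d ^- 2 by field; rewrite lt0r_neq0.
have e1 : d <= cabs (w t - z) by apply: le_trans (circ_sub t zr); rewrite /d; lra.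
have e2 : d <= cabs (w t - (z + h)).
  apply: le_trans (circ_sub t zh); have := cabsD z h; rewrite /d in hd *; lra.
apply: ler_pM; rewrite ?invr_ge0 ?exprn_ge0 ?cabs_ge0//.
  by rewrite lef_pV2 ?posrE// (lt_le_trans d0).
by rewrite lef_pV2 ?posrE ?exprn_gt0// ?(lt_le_trans d0 e1)// lerXn2r// nnegrE ?cabs_ge0// ltW.
Qed.

Lemma cauchy_transf2_der z : cabs z < rho ->
  is_derive z 1 (fun z => cmean (fun t => phi t * (w t - z) ^- 2))
    (cmean (fun t => phi t * (2 * (w t - z) ^- 3))).
Proof.
move=> zr; set d := (rho - cabs z) / 2.
have d0 : 0 < d by rewrite divr_gt0// subr_gt0.
apply: (@cmean_der phi (fun z t => (w t - z) ^- 2) (fun z t => 2 * (w t - z) ^- 3) z (5 * d ^- 4) d d0 cphi).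
- by move=> h hd; apply: contin_kernel; exact: near_disc.
- exact: contin_M (@contin_cst R C 0 tp 2) (contin_kernel (n := 3) zr).
move=> h t hd; have zh := near_disc zr hd.
have n1 := circ_neq t zr; have n2 := circ_neq t zh.
have -> : (w t - (z + h)) ^- 2 - (w t - z) ^- 2 - h * (2 * (w t - z) ^- 3) =
  ((w t - z) ^- 2 * (w t - (z + h)) ^- 2 + 2 * ((w t - z) ^- 3 * (w t - (z + h))^-1)) * h ^+ 2.
  by field; rewrite ?n1 ?n2.
rewrite cabsM cabsX ler_wpM2r ?sqr_ge0//.
have e1 : d <= cabs (w t - z) by apply: le_trans (circ_sub t zr); rewrite /d; lra.
have e2 : d <= cabs (w t - (z + h)).
  apply: le_trans (circ_sub t zh); have := cabsD z h; rewrite /d in hd *; lra.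
have V (x : C) n : d <= cabs x -> cabs (x ^- n) <= d ^- n.
  move=> dx; rewrite cabsV cabsX lef_pV2 ?posrE ?exprn_gt0// ?(lt_le_trans d0 dx)//.
  by rewrite lerXn2r// nnegrE ?cabs_ge0// ltW.
apply: (le_trans (cabsD _ _)); rewrite !cabsM.
have a2 : cabs (2 : C) = 2 by rewrite -rc_nat cabs_rc ger0_norm.
have V1 := V _ 1%N e2; rewrite !expr1 in V1.
have := ler_pM (cabs_ge0 _) (cabs_ge0 _) (V _ 2%N e1) (V _ 2%N e2).
have := ler_pM (cabs_ge0 _) (cabs_ge0 _) (V _ 3%N e1) V1.
have -> : d ^- 3 * d^-1 = d ^- 4 by field; rewrite lt0r_neq0.
have -> : d ^- 2 * d ^- 2 = d ^- 4 by field; rewrite lt0r_neq0.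
have : 0 <= d ^- 4 by rewrite invr_ge0 exprn_ge0// ltW.
by rewrite a2; lra.
Qed.
End CT.
Arguments contin_kernel {rho} n {z} _.

Section Disc.
Variables (rho : R) (g : C -> C).
Hypotheses (r0 : 0 < rho) (dg : forall w, cabs w <= rho -> derivable g w 1).
Let w t : C := rc rho * eit t.
Let wr t : cabs (w t) = rho.
Proof. by rewrite cabsM cabs_eit mulr1 cabs_rc gtr0_norm. Qed.

Lemma contin_hol_circle : contin 0 tp (fun t => g (w t)).
Proof. by apply: contin_circle => t; apply: derivable_ccont; apply: dg; rewrite wr. Qed.

Lemma disc_near z : cabs z < rho -> \forall u \near z, cabs u < rho.
Proof.
move=> zr; apply/near_cabs; exists (rho - cabs z); first by rewrite subr_gt0.
by move=> u uz; rewrite -(subrK z u) (le_lt_trans (cabsD _ _))//; lra.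
Qed.

Let phi t := g (w t) * w t.
Let cphi : contin 0 tp phi.
Proof. exact: (contin_M contin_hol_circle (@contin_eit R rho)). Qed.

Lemma cauchy_CT z : cabs z < rho -> g z = cmean (fun t => phi t * (w t - z) ^- 1).
Proof.
by move=> zr; rewrite (cauchy_formula dg zr); apply: cmean_ext => t; rewrite mulrA.
Qed.

Lemma hol_derive z : cabs z < rho ->
  is_derive z 1 g (cmean (fun t => phi t * (w t - z) ^- 2)).
Proof.
move=> zr; apply: cder_near (cauchy_transf1_der cphi zr).
have /near_cabs[d d0 hd] := disc_near zr.
by apply/near_cabs; exists d => // u /hd ur; rewrite -cauchy_CT.
Qed.

Lemma hol_derive2 z : cabs z < rho -> derivable (derive1 g) z 1.
Proof.
move=> zr; apply: cderV; apply: cder_near (cauchy_transf2_der cphi zr).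
have /near_cabs[d d0 hd] := disc_near zr.
by apply/near_cabs; exists d => // u /hd ur; rewrite (cderE (hol_derive ur)).
Qed.

(** Used to divide out zeros and to peel off Taylor coefficients at 0, one at a time. *)
Definition dslope z := if z == 0 then derive1 g 0 else (g z - g 0) / z.

Lemma dslopeE z : g z = g 0 + z * dslope z.
Proof.
rewrite /dslope; case: eqVneq => [->|z0]; first by rewrite mul0r addr0.
by rewrite mulrC divfK// addrC subrK.
Qed.

(** Near 0, and at 0 itself, the difference quotient coincides with the Cauchy transform of the
    boundary values of [g], which is differentiable. *)
Lemma dslope_der z : cabs z <= rho -> derivable dslope z 1.
Proof.
move=> zr; have [->|z0] := eqVneq z 0; last first.
  have D := cder_M (cder_B (derivableP (dg zr)) (cder_cst (g 0) z)) (cder_V (cder_id z) z0).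
  apply: (cderV (cder_near _ D)).
  apply/near_cabs; exists (cabs z); first by rewrite cabs_gt0.
  move=> u uz; rewrite /dslope; case: eqVneq => // u0.
  by move: uz; rewrite u0 sub0r cabsN ltxx.
have z0r : cabs (0 : C) < rho by rewrite cabs0.
have D := cauchy_transf1_der contin_hol_circle z0r.
apply: (cderV (cder_near _ D)).
have /near_cabs[d d0 hd] := disc_near z0r.
apply/near_cabs; exists d => // u /hd ur; rewrite /dslope.
have E v : cabs v < rho -> v * cmean (fun t => g (w t) * (w t - v) ^- 1) = g v - g 0.
  move=> vr; rewrite (cauchy_CT vr) (cauchy_CT z0r).
  have c1 := contin_M contin_hol_circle (contin_kernel 1 vr).
  have c2 := contin_M cphi (contin_kernel 1 vr); have c3 := contin_M cphi (contin_kernel 1 z0r).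
  rewrite -(cmeanZ _ c1) -(cmeanB c2 c3); apply: cmean_ext => t.
  have := circ_neq t vr; have := circ_neq t z0r; rewrite /phi -/(w t) !expr1 subr0 => n1 n2.
  by field; rewrite n1.
case: eqVneq => [->|u0]; last by rewrite -E// mulrAC divff// mul1r.
rewrite (cderE (hol_derive z0r)); apply: cmean_ext => t.
have := circ_neq t z0r; rewrite /phi -/(w t) !expr1 subr0 => n1.
by field.
Qed.

(** The leading 2 comes from integrating real and imaginary parts separately; it is harmless, as the
    bound is only applied in limits. *)
Lemma cauchy_bound z M : cabs z < rho ->
  (forall t, 0 <= t -> t <= tp -> cabs (g (w t)) <= M) ->
  cabs (g z) <= 2 * (M * (rho / (rho - cabs z))).
Proof.
move=> zr hM; rewrite (cauchy_CT zr); apply: cmean_bd => [|t t1 t2].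
  exact: contin_M cphi (contin_kernel 1 zr).
rewrite /phi -mulrA cabsM ler_pM ?cabs_ge0 ?hM// expr1 cabs_div wr ler_pM2l//.
rewrite lef_pV2 ?posrE ?subr_gt0 ?circ_sub// cabs_gt0; exact: circ_neq.
Qed.
End Disc.
End CauchyTransform.
Arguments contin_kernel {R rho} n {z} _.

(** * Zeros of holomorphic functions, entire functions of polynomial growth *)

Section Local.
Context {R : realType}.
Local Notation C := (CC R).
Local Notation tp := (2 * pi : R).
Implicit Types (z w : C) (r s t x y : R).

Lemma pow_small (q e : R) : 0 <= q -> q < 1 -> 0 < e -> exists n : nat, q ^+ n < e.
Proof.
move=> q0 q1 e0.
have /cvgrPdist_lt/(_ e e0) : q ^+ n @[n --> \oo] --> 0.
  by apply: cvg_expr; rewrite ger0_norm.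
move=> [N _ /(_ N (leqnn N))] /=; rewrite sub0r normrN ger0_norm ?exprn_ge0//.
by exists N.
Qed.

(** If zeros can be divided out for ever, then g = w ^ n h_n for all n, and Cauchy's bound for h_n
    gives |g z| <= C (|z| / rho) ^ n, which tends to 0. *)
Lemma hol_dich0 (g : C -> C) rho : 0 < rho ->
  (forall w, cabs w <= rho -> derivable g w 1) ->
  (forall w, cabs w < rho -> g w = 0) \/
  exists (m : nat) (h : C -> C), [/\ forall w, cabs w <= rho -> derivable h w 1,
    h 0 != 0 & forall w, g w = w ^+ m * h w].
Proof.
move=> rho0 dg; have [|nex] := pselect (exists (m : nat) (h : C -> C),
  [/\ forall w, cabs w <= rho -> derivable h w 1, h 0 != 0 & forall w, g w = w ^+ m * h w]).
  by right.
left=> z zr.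
have H n : exists h : C -> C, (forall w, cabs w <= rho -> derivable h w 1) /\
    forall w, g w = w ^+ n * h w.
  elim: n => [|n [h [dh gh]]]; first by exists g; split => // w; rewrite mul1r.
  have [h0|h0] := eqVneq (h 0) 0; last by exfalso; apply: nex; exists n, h.
  exists (dslope h); split; first exact: dslope_der.
  by move=> w; rewrite gh (dslopeE h w) h0 add0r exprSr mulrA.
have [M M0 hM] := contin_bounded (ltW (@tpi_gt0 R)) (contin_hol_circle rho0 dg).
set B := rho / (rho - cabs z); have B0 : 0 < B by rewrite divr_gt0// subr_gt0.
apply/eqP; rewrite -cabs_eq0 eq_le cabs_ge0 andbT; apply/ler_addgt0Pr => e e0; rewrite add0r.
have q1 : cabs z / rho < 1 by rewrite ltr_pdivrMr// mul1r.
have q0 : 0 <= cabs z / rho by rewrite divr_ge0 ?cabs_ge0 ?ltW.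
have D0 : 0 < 2 * M * B by apply: mulr_gt0 B0; exact: mulr_gt0.
have [n hn] := pow_small q0 q1 (divr_gt0 e0 D0).
have [h [dh gh]] := H n.
have hb := @cauchy_bound R rho h rho0 dh z (M / rho ^+ n) zr.
have rn0 : 0 < rho ^+ n by rewrite exprn_gt0.
have {}hb : cabs (h z) <= 2 * (M / rho ^+ n * B).
  apply: hb => t t1 t2; rewrite ler_pdivlMr//.
  have := hM t t1 t2; rewrite gh cabsM cabsX mulrC.
  by rewrite cabsM cabs_eit mulr1 cabs_rc gtr0_norm.
rewrite gh cabsM cabsX; apply: (le_trans (ler_wpM2l _ hb)); first by rewrite exprn_ge0// cabs_ge0.
have -> : cabs z ^+ n * (2 * (M / rho ^+ n * B)) = (cabs z / rho) ^+ n * (2 * M * B).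
  by rewrite expr_div_n; ring.
by rewrite -ler_pdivlMr// ltW.
Qed.

Lemma shift_der (g : C -> C) z w : derivable g (z + w) 1 -> derivable (fun u => g (z + u)) w 1.
Proof.
move=> d; apply: cderV (@cder_comp R g (fun u => z + u) w _ _ (derivableP d) _).
Qed.
Lemma shift_der' (g : C -> C) z w : derivable g (w - z) 1 -> derivable (fun u => g (u - z)) w 1.
Proof.
move=> d; apply: cderV (@cder_comp R g (fun u => u - z) w _ _ (derivableP d) _).
Qed.

Lemma hol_disc (g : C -> C) z : holomorphic_at g z -> exists2 rho : R, 0 < rho &
  forall w, cabs w <= rho -> derivable (fun u => g (z + u)) w 1.
Proof.
move=> /near_cabs[d d0 hd]; exists (d / 2); first by rewrite divr_gt0.
move=> w wd; apply: shift_der; apply: hd; rewrite addrC addKr.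
by apply: (le_lt_trans wd); lra.
Qed.

Lemma hol_dich (g : C -> C) z : holomorphic_at g z ->
  (\forall w \near z, g w = 0) \/
  exists (m : nat) (h : C -> C), [/\ holomorphic_at h z, h z != 0 &
    forall w, g w = (w - z) ^+ m * h w].
Proof.
move=> /hol_disc[rho r0 dg]; have [H|[m [h [dh h0 gh]]]] := hol_dich0 r0 dg; [left|right].
  apply/near_cabs; exists rho => // w wz.
  by have := H _ wz; rewrite addrC subrK.
exists m, (fun u => h (u - z)); split; last first.
- by move=> w; rewrite -gh addrC subrK.
- by rewrite subrr.
apply/near_cabs; exists rho => // w wz.
by apply: shift_der'; apply: dh; exact: ltW.
Qed.

Lemma hol_at_derive (g : C -> C) z : holomorphic_at g z -> holomorphic_at (derive1 g) z.
Proof.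
move=> /near_cabs[d d0 hd]; apply/near_cabs; exists d; [exact: d0|move=> w wd].
pose rho := (d + cabs (w - z)) / 2.
have rd : rho < d by rewrite /rho; lra.
have wr : cabs (w - z) < rho by rewrite /rho; lra.
have r0 : 0 < rho by apply: le_lt_trans wr; exact: cabs_ge0.
have dg u : cabs u <= rho -> derivable (fun u => g (z + u)) u 1.
  move=> ur; apply: shift_der; apply: hd; rewrite addrC addKr; exact: le_lt_trans rd.
suff -> : derive1 g = (fun u => derive1 (fun v => g (z + v)) (u - z)).
  exact: (shift_der' (hol_derive2 r0 dg wr)).
apply/funext => u; rewrite /derive1.
suff -> : (fun h : C => h^-1 *: (g (z + (h + (u - z))) - g (z + (u - z)))) =
    (fun h => h^-1 *: (g (h + u) - g u)) by [].
apply/funext => h; have -> : z + (u - z) = u by ring.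
by have -> : z + (h + (u - z)) = h + u by ring.
Qed.

Lemma horner_bound (p : {poly C}) (K : nat) : (size p <= K.+1)%N -> exists2 A : R, 0 <= A &
  forall w, 1 <= cabs w -> cabs p.[w] <= A * cabs w ^+ K.
Proof.
move=> sp; exists (\sum_(i < size p) cabs p`_i).
  by apply: sumr_ge0 => i _; exact: cabs_ge0.
move=> w w1; rewrite horner_coef (le_trans (cabs_sum _ _))// mulr_suml ler_sum// => i _.
rewrite cabsM cabsX ler_wpM2l ?cabs_ge0// ler_weXn2l//.
by rewrite -ltnS (leq_trans (ltn_ord i)).
Qed.

(** Once the Taylor polynomial of degree at most [K] is removed, the cofactor of the power [K.+1] is
    O(1 / rho) on the given circles, hence zero by Cauchy's bound. A sequence of radii is enough,
    which is what slow growth of the characteristic along a sequence will provide. *)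
Lemma liouville_poly (g : C -> C) (K : nat) : (forall w, derivable g w 1) ->
  (forall X : R, exists2 rho, X <= rho & forall t, cabs (g (rc rho * eit t)) <= rho ^+ K) ->
  exists p : {poly C}, forall w, g w = p.[w].
Proof.
move=> dg hg.
have H n : exists (p : {poly C}) (h : C -> C), [/\ (size p <= n)%N, forall w, derivable h w 1 &
    forall w, g w = p.[w] + w ^+ n * h w].
  elim: n => [|n [p [h [sp dh gh]]]].
    by exists 0, g; split; rewrite ?size_poly0// => w; rewrite horner0 add0r mul1r.
  exists (p + (h 0)%:P * 'X^n), (dslope h); split.
  - rewrite (leq_trans (size_polyD _ _))// geq_max (leq_trans sp)//=.
    have [->|h0] := eqVneq (h 0) 0; first by rewrite polyC0 mul0r size_poly0.
    by rewrite size_Cmul// size_polyXn.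
  - move=> w; apply: (@dslope_der R (cabs w + 1)) => //; last by rewrite lerDl.
    by rewrite ltr_wpDl ?cabs_ge0.
  - by move=> w; rewrite gh hornerE hornerCM hornerXn (dslopeE h w) exprSr; ring.
have [p [h [sp dh gh]]] := H K.+1; exists p => z; rewrite gh.
suff -> : h z = 0 by rewrite mulr0 addr0.
have [A A0 pA] := horner_bound sp.
apply/eqP; rewrite -cabs_eq0 eq_le cabs_ge0 andbT; apply/ler_addgt0Pr => e e0; rewrite add0r.
have [rho Xr hr] := hg (1 + cabs z + 2 * (A + 1) / e).
have z0 := cabs_ge0 z; have E0 : 0 < 2 * (A + 1) / e by rewrite divr_gt0// mulr_gt0// ltr_wpDl.
have r1 : 1 <= rho by lra.
have r0 : 0 < rho by lra.
have zr : cabs z < rho by lra.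
have rn : rho ^+ K != 0 by rewrite expf_neq0// lt0r_neq0.
have hb t : 0 <= t -> t <= tp -> cabs (h (rc rho * eit t)) <= (A + 1) / rho.
  move=> _ _.
  have wr : cabs (rc rho * eit t) = rho by rewrite cabsM cabs_eit mulr1 cabs_rc gtr0_norm.
  have E : (rc rho * eit t) ^+ K.+1 * h (rc rho * eit t) = g (rc rho * eit t) - p.[rc rho * eit t].
    by rewrite gh addrAC subrr add0r.
  have := congr1 (@cabs R) E; rewrite cabsM cabsX wr => E'.
  rewrite -(ler_pM2l (exprn_gt0 K.+1 r0)) E'.
  have -> : rho ^+ K.+1 * ((A + 1) / rho) = rho ^+ K + A * rho ^+ K.
    by rewrite exprS; field; exact: lt0r_neq0.
  apply: (le_trans (cabsBD _ _)); rewrite lerD//.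
  by have := pA (rc rho * eit t); rewrite wr; exact.
apply: (le_trans (@cauchy_bound R rho h r0 (fun w _ => dh w) z _ zr hb)).
have -> : 2 * ((A + 1) / rho * (rho / (rho - cabs z))) = 2 * (A + 1) / (rho - cabs z).
  by field; rewrite subr_eq0 (gt_eqF zr) lt0r_neq0.
rewrite ler_pdivrMr ?subr_gt0// [leRHS]mulrC -ler_pdivrMr//; lra.
Qed.

End Local.

(** * Circle means and conjugation *)

Section Means.
Context {R : realType}.
Local Notation C := (CC R).
Local Notation tp := (2 * pi : R).
Implicit Types (z w : C) (r s t x y : R) (u v : R -> R).

Lemma mean_ext u v : (forall t, u t = v t) -> mean u = mean v.
Proof. by move=> h; rewrite /mean; congr (_ * _); apply: I_ext => t _ _. Qed.
Lemma meanD u v : contin 0 tp u -> contin 0 tp v -> mean (fun t => u t + v t) = mean u + mean v.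
Proof. by move=> h k; rewrite /mean (I_D h k) mulrDr. Qed.
Lemma meanZ k u : contin 0 tp u -> mean (fun t => k * u t) = k * mean u.
Proof. by move=> h; rewrite /mean (I_Z _ h) mulrCA. Qed.
Lemma mean_cst (k : R) : mean (fun _ : R => k) = k.
Proof.
by rewrite /mean (I_cst _ (ltW (@tpi_gt0 R))) subr0 mulrCA mulVf ?mulr1// lt0r_neq0// tpi_gt0.
Qed.
Lemma mean_le u v : contin 0 tp u -> contin 0 tp v -> (forall t, u t <= v t) -> mean u <= mean v.
Proof.
move=> h k uv; rewrite /mean ler_wpM2l ?invr_ge0 ?(ltW (@tpi_gt0 R))//.
by apply: I_le => // t _ _; exact: uv.
Qed.
Lemma conNu a b u : contin a b u -> contin a b (fun t => - u t).
Proof. by move=> h t t1 t2; apply: (@continuousN _ _ _ u); exact: h. Qed.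
Lemma meanN u : contin 0 tp u -> mean (fun t => - u t) = - mean u.
Proof. by move=> h; rewrite /mean (I_N h) mulrN. Qed.
Lemma contin_sum (J : Type) (s : seq J) a b (F : J -> R -> R) :
  (forall j, contin a b (F j)) -> contin a b (fun t => \sum_(j <- s) F j t).
Proof.
move=> h; elim: s => [|j s IH].
  have -> : (fun t => \sum_(j <- [::]) F j t) = fun=> 0 by apply/funext => t; rewrite big_nil.
  exact: contin_cst.
have -> : (fun t => \sum_(i <- j :: s) F i t) = fun t => F j t + \sum_(i <- s) F i t.
  by apply/funext => t; rewrite big_cons.
exact: contin_Du (h j) IH.
Qed.
Lemma mean_sum (J : Type) (s : seq J) (F : J -> R -> R) : (forall j, contin 0 tp (F j)) ->
  mean (fun t => \sum_(j <- s) F j t) = \sum_(j <- s) mean (F j).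
Proof.
move=> h; elim: s => [|j s IH].
  rewrite big_nil; transitivity (mean (fun _ : R => 0 : R)); last exact: mean_cst.
  by apply: mean_ext => t; rewrite big_nil.
rewrite big_cons -IH -(meanD (h j) (contin_sum h)); apply: mean_ext => t.
by rewrite big_cons.
Qed.

Lemma cI_B a b (F G : R -> C) : contin a b F -> contin a b G ->
  cI a b (fun t => F t - G t) = cI a b F - cI a b G.
Proof.
move=> cF cG; have cN := contin_M (@contin_cst R C a b (-1)) cG.
rewrite -[cI a b G]mul1r -mulNr -(cI_Z _ cG) -(cI_D cF cN).
by apply: cI_ext => t; rewrite mulN1r.
Qed.

Definition cconj z : C := Complex (cRe z) (- cIm z).
Lemma cconjM z w : cconj (z * w) = cconj z * cconj w.
Proof. by apply: ceqP; rewrite /cconj ?cReE ?cImE /cRe /cIm /=; ring. Qed.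
Lemma cconjD z w : cconj (z + w) = cconj z + cconj w.
Proof. by apply: ceqP; rewrite /cconj ?cReE ?cImE /cRe /cIm /=; ring. Qed.
Lemma cconjN z : cconj (- z) = - cconj z.
Proof. by apply: ceqP; rewrite /cconj ?cReE ?cImE /cRe /cIm /=. Qed.
Lemma cconjK z : cconj (cconj z) = z.
Proof. by apply: ceqP; rewrite /cconj /cRe /cIm /= ?opprK. Qed.
Lemma cRe_conj z : cRe (cconj z) = cRe z. Proof. by []. Qed.
Lemma cIm_conj z : cIm (cconj z) = - cIm z. Proof. by []. Qed.
Lemma mul_cconj z : z * cconj z = rc (cabs z ^+ 2).
Proof. by rewrite cabs_sqr; apply: ceqP; rewrite /cconj ?cReE ?cImE /cRe /cIm /=; ring. Qed.
Lemma cabs_conj z : cabs (cconj z) = cabs z.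
Proof. by rewrite !cabsE /cconj /cRe /cIm /= sqrrN. Qed.
Lemma cconj_eq0 z : (cconj z == 0) = (z == 0).
Proof. by rewrite -cabs_eq0 cabs_conj cabs_eq0. Qed.
Lemma cconjV z : cconj z^-1 = (cconj z)^-1.
Proof.
have [->|z0] := eqVneq z 0.
  rewrite invr0; have -> : cconj 0 = 0 by apply: ceqP; rewrite /cconj /cRe /cIm /= ?oppr0.
  by rewrite invr0.
have c0 : cconj z != 0 by rewrite cconj_eq0.
apply: (mulfI c0); rewrite -cconjM !divff//.
by apply: ceqP; rewrite /cconj /cRe /cIm /= ?oppr0.
Qed.
Lemma cconj_add z : z + cconj z = rc (2 * cRe z).
Proof. by apply: ceqP; rewrite /cconj ?cReE ?cImE /cRe /cIm /=; ring. Qed.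
Lemma cconj_rc r : cconj (rc r) = rc r.
Proof. by apply: ceqP; rewrite /cconj /cRe /cIm /= ?oppr0. Qed.
Lemma cconj_cont : continuous cconj.
Proof.
move=> z; apply/ccontP => e e0; exists e => // w wz.
by rewrite -cconjN -cconjD cabs_conj.
Qed.
Lemma cmean_conj (F : R -> C) : contin 0 tp F -> cmean (fun t => cconj (F t)) = cconj (cmean F).
Proof.
move=> cF; rewrite /cmean cconjM cconj_rc; congr (_ * _).
apply: ceqP; rewrite /cconj ?cI_Re ?cI_Im.
  by apply: I_ext.
rewrite /cIm /= -(I_N (contin_Im cF)); exact: I_ext.
Qed.
End Means.

(** * The Schwarz and Poisson formulas *)

Section Log.
Context {R : realType}.
Local Notation C := (CC R).
Local Notation tp := (2 * pi : R).
Implicit Types (z w u : C) (r s t x y : R).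

(** Via ln |Q| = ln (|Q| ^ 2) / 2, where the square of the modulus is polynomial in the
    components. *)
Lemma ln_cabs_der (Q : R -> C) t q : pder Q t q -> Q t != 0 ->
  is_derive t 1 (fun s => ln (cabs (Q s))) (cRe (q / Q t)).
Proof.
move=> [d1 d2] Q0.
have P0 : 0 < cRe (Q t) ^+ 2 + cIm (Q t) ^+ 2 by rewrite -cabs_sqr exprn_gt0// cabs_gt0.
have -> : (fun s => ln (cabs (Q s))) = (fun s => 2^-1 * ln (cRe (Q s) * cRe (Q s) + cIm (Q s) * cIm (Q s))).
  apply/funext => s; rewrite -!expr2 -cabs_sqr.
  have [->|Qs] := eqVneq (Q s) 0; first by rewrite cabs0 expr0n/= ln0// mulr0.
  by rewrite lnXn ?cabs_gt0// mulr2n; field.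
have D : is_derive t 1 (fun s => cRe (Q s) * cRe (Q s) + cIm (Q s) * cIm (Q s))
   (2 * (cRe (Q t) * cRe q + cIm (Q t) * cIm q)).
  apply: (is_derive_eq (is_deriveD (is_deriveM d1 d1) (is_deriveM d2 d2))).
  by rewrite /GRing.scale/=; ring.
have L : is_derive (cRe (Q t) * cRe (Q t) + cIm (Q t) * cIm (Q t)) 1 (@ln R)
  (cRe (Q t) * cRe (Q t) + cIm (Q t) * cIm (Q t))^-1.
  by apply: is_derive1_ln; rewrite -!expr2.
have LD := @is_derive1_comp R (@ln R) (fun s => cRe (Q s) * cRe (Q s) + cIm (Q s) * cIm (Q s)) t _ _ L D.
apply: (is_derive_eq (is_deriveZ (2^-1) LD)).
rewrite /GRing.scale/= ?cReE.
have -> : (Q t)^-1 = rc ((cabs (Q t) ^+ 2)^-1) * cconj (Q t).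
  by rewrite rcV -mul_cconj; field; rewrite cconj_eq0 Q0.
rewrite cabs_sqr ?cReE ?cImE cRe_conj cIm_conj ?cRe_rc -!expr2; field; exact: lt0r_neq0.
Qed.

Section prim.
Variables (rho : R) (h : C -> C).
Hypothesis dh : forall w, cabs w < rho -> derivable h w 1.

Definition cprim z := cI 0 1 (fun t => h (rc t * z) * z).

(** Goursat's theorem for the triangle with vertices 0, [z], [z + k], parametrised as the square t
    (z + s k), whose side t = 0 collapses to the origin. *)
Lemma cprim_der z : cabs z < rho -> is_derive z 1 cprim (h z).
Proof.
move=> zr; apply/cderP => e e0.
have /ccontP/(_ (e / 2) ltac:(by rewrite divr_gt0))[d d0 hd] := derivable_ccont (dh zr).
exists (Num.min d (rho - cabs z)); first by rewrite lt_min d0 subr_gt0.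
move=> k; rewrite lt_min => /andP[kd kr].
pose Phi s t := rc t * (z + rc s * k).
pose Ps (s : R) t := rc t * k.
pose Pt s (t : R) := z + rc s * k.
have zk s : 0 <= s -> s <= 1 -> cabs (z + rc s * k) <= cabs z + cabs k.
  move=> s1 s2; apply: (le_trans (cabsD _ _)); rewrite lerD2l cabsM cabs_rc ger0_norm//.
  by rewrite ler_piMl ?cabs_ge0.
have G := @goursat R h Phi Ps Pt (cabs z + cabs k) 0 1 0 1 ler01 ler01.
have dPs s t : pder (Phi ^~ t) s (Ps s t).
  have := pder_M (pder_cst (rc t) s) (pder_D (pder_cst z s) (pder_M (pder_rc s) (pder_cst k s))).
  by congr pder; rewrite /Ps; ring.
have dPt s t : pder (Phi s) t (Pt s t).
  have := pder_M (pder_rc t) (pder_cst (z + rc s * k) t).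
  by congr pder; rewrite /Pt; ring.
have inr s t : (0 <= s <= 1) /\ (0 <= t <= 1) -> cabs (Phi s t) < rho.
  move=> [/andP[s1 s2] /andP[t1 t2]]; rewrite cabsM cabs_rc ger0_norm//.
  apply: (@le_lt_trans _ _ (cabs (z + rc s * k))); first by rewrite ler_piMl ?cabs_ge0.
  by apply: (le_lt_trans (zk s s1 s2)); lra.
have {}G := G (fun s t _ => dPs s t) (fun s t _ => dPt s t).
have {}G : cI 0 1 (fun y => h (Phi 0 y) * Pt 0 y) + cI 0 1 (fun x => h (Phi x 1) * Ps x 1) -
    cI 0 1 (fun y => h (Phi 1 y) * Pt 1 y) - cI 0 1 (fun x => h (Phi x 0) * Ps x 0) = 0.
  apply: G.
  - by move=> s t _; exact: cst_continuous.
  - by move=> s t _; exact: cst_continuous.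
  - move=> s t [_ /andP[t1 t2]]; rewrite /Ps cabsM cabs_rc ger0_norm//.
    apply: (@le_trans _ _ (cabs k)); first by rewrite ler_piMl ?cabs_ge0.
    by rewrite lerDr cabs_ge0.
  - by move=> s t [/andP[s1 s2] _]; exact: zk.
  - move=> s t s' t' [/andP[s1 s2] /andP[t1 t2]] [/andP[s1' s2'] /andP[t1' t2']].
    have -> : Phi s t - Phi s' t' = rc t * (rc (s - s') * k) + rc (t - t') * (z + rc s' * k).
      by rewrite /Phi !rcB; ring.
    apply: (le_trans (cabsD _ _)); rewrite !cabsM !cabs_rc [leRHS]mulrDr lerD//.
      rewrite (ger0_norm t1); apply: (@le_trans _ _ (`|s - s'| * cabs k)).
        by rewrite ler_piMl// mulr_ge0 ?cabs_ge0.
      by rewrite [leRHS]mulrC ler_wpM2l// lerDr cabs_ge0.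
    by rewrite [leRHS]mulrC ler_wpM2l// zk.
  - by move=> s t /inr/dh.
have E0 : cI 0 1 (fun x => h (Phi x 0) * Ps x 0) = 0.
  rewrite -[RHS](mul0r (cI 0 1 (fun _ : R => 0 : C))) -(cI_Z _ (@contin_cst R C 0 1 0)).
  by apply: cI_ext => t _ _; rewrite /Ps rc0 !mul0r mulr0.
have ch1 : contin 0 1 (fun s => h (Phi s 1) * Ps s 1).
  apply: contin_M; last exact: contin_cst.
  move=> s s1 s2; apply: (@continuous_comp _ _ _ (Phi ^~ 1) h); first exact: pder_cont (dPs s 1).
  by apply: derivable_ccont; apply: dh; apply: inr; rewrite s1 s2 ler01 lexx.
have cz := @contin_cst R C 0 1 (h z * k).
have E1 : cprim (z + k) - cprim z - k * h z = cI 0 1 (fun s => h (Phi s 1) * Ps s 1 - h z * k).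
  rewrite (_ : cI 0 1 (fun s => h (Phi s 1) * Ps s 1 - h z * k) =
     cI 0 1 (fun s => h (Phi s 1) * Ps s 1) - k * h z).
    congr (_ - _); rewrite E0 subr0 in G; move/eqP: G; rewrite subr_eq0 => /eqP G.
    rewrite /cprim; have -> : cI 0 1 (fun t => h (rc t * (z + k)) * (z + k)) =
       cI 0 1 (fun y : R => h (Phi 1 y) * Pt 1 y).
      by apply: cI_ext => t _ _; rewrite /Phi /Pt rc1 mul1r.
    rewrite -G; have -> : cI 0 1 (fun t => h (rc t * z) * z) = cI 0 1 (fun y : R => h (Phi 0 y) * Pt 0 y).
      by apply: cI_ext => t _ _; rewrite /Phi /Pt rc0 mul0r addr0.
    by rewrite addrAC subrr add0r.
  have -> : k * h z = cI 0 1 (fun=> h z * k).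
    by apply: ceqP; rewrite ?cI_Re ?cI_Im I_cst// subr0 mulr1 mulrC.
  exact: cI_B.
rewrite E1; have -> : e * cabs k = 2 * (e / 2 * cabs k) * (1 - 0) by field.
apply: (cI_bound ler01 (conB ch1 cz)) => s s1 s2.
have -> : h (Phi s 1) * Ps s 1 - h z * k = (h (z + rc s * k) - h z) * k.
  by rewrite /Phi /Ps rc1 !mul1r; ring.
rewrite cabsM ler_wpM2r ?cabs_ge0// ltW// hd// addrC addKr cabsM cabs_rc ger0_norm//.
by apply: le_lt_trans kd; rewrite ler_piMl ?cabs_ge0.
Qed.
End prim.

Section zerofree.
Variables (rho' : R) (g : C -> C).
Hypothesis dg : forall w, cabs w < rho' -> derivable g w 1.
Hypothesis g0 : forall w, cabs w < rho' -> g w != 0.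

Let h w := derive1 g w / g w.
Let dh w : cabs w < rho' -> derivable h w 1.
Proof.
move=> wr; pose rho := (cabs w + rho') / 2.
have w1 : cabs w < rho by rewrite /rho; lra.
have r0 : 0 < rho by apply: le_lt_trans w1; exact: cabs_ge0.
have dg' u : cabs u <= rho -> derivable g u 1.
  by move=> ur; apply: dg; apply: (le_lt_trans ur); rewrite /rho; lra.
exact: cderV (cder_M (derivableP (hol_derive2 r0 dg' w1)) (cder_V (derivableP (dg wr)) (g0 wr))).
Qed.

(** A branch of the logarithm of [g] up to an imaginary constant, chosen so that its value at 0 is
    real. *)
Definition clog z := cprim h z + rc (ln (cabs (g 0))).

Lemma clog_der z : cabs z < rho' -> is_derive z 1 clog (derive1 g z / g z).
Proof.
move=> zr; rewrite -[X in is_derive _ _ _ X]addr0.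
exact: cder_D (cprim_der dh zr) (cder_cst _ z).
Qed.

Lemma clog_Re z : cabs z < rho' -> cRe (clog z) = ln (cabs (g z)).
Proof.
move=> zr; rewrite cRe_D cRe_rc cI_Re.
have tz t : 0 <= t -> t <= 1 -> cabs (rc t * z) < rho'.
  move=> t0 t1; rewrite cabsM cabs_rc ger0_norm//; apply: le_lt_trans zr.
  by rewrite ler_piMl ?cabs_ge0.
have dt t := pder_M (pder_rc t) (pder_cst z t).
have D t : 0 <= t -> t <= 1 -> is_derive t 1 (fun t => ln (cabs (g (rc t * z))))
    ((@cRe R \o (fun t => h (rc t * z) * z)) t).
  move=> t0 t1; have tr := tz t t0 t1.
  have E := pder_comp (derivableP (dg tr)) (dt t).
  apply: (is_derive_eq (ln_cabs_der E (g0 tr))).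
  by rewrite /comp /h derive1E; congr cRe; ring.
have c1 : contin 0 1 (@cRe R \o (fun t => h (rc t * z) * z)).
  apply: contin_Re; apply: contin_M; last exact: contin_cst.
  move=> t t0 t1; apply: (@continuous_comp _ _ _ (fun t => rc t * z) h).
    exact: pder_cont (dt t).
  by apply: derivable_ccont; apply: dh; exact: tz.
by rewrite (I_FTC ler01 c1 D) rc1 rc0 mul1r mul0r subrK.
Qed.

Variable rho : R.
Hypotheses (r0 : 0 < rho) (rr : rho < rho').
Let w t : C := rc rho * eit t.
Let wr t : cabs (w t) = rho.
Proof. by rewrite cabsM cabs_eit mulr1 cabs_rc gtr0_norm. Qed.
Let dL u : cabs u <= rho -> derivable clog u 1.
Proof. by move=> ur; apply: cderV (clog_der _); exact: le_lt_trans rr. Qed.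
Let lg t := ln (cabs (g (w t))).

Lemma contin_lg : contin 0 tp lg.
Proof.
move=> t t0 t1; apply: (@continuous_comp _ _ _ (fun t => cabs (g (w t))) (@ln R)).
  apply: continuous_comp; last exact: cabs_cont.
  by apply: (contin_circle (G := g)) => // s; apply: derivable_ccont; apply: dg; rewrite wr.
by apply: continuous_ln; rewrite cabs_gt0 g0// wr.
Qed.

(** On the circle 2 ln |g| = L + conj L, where L is [clog]. Cauchy's formula reproduces L. For conj
    L, note that conj w = rho ^ 2 / w on the circle, so the kernel w / (w - z) is the conjugate of
    rho ^ 2 / (rho ^ 2 - conj z w). This is holomorphic in the disc, and the mean is the conjugate
    of a value at 0. *)
Lemma schwarz z : cabs z < rho ->
  clog z + cconj (clog 0) = cmean (fun t => rc (2 * lg t) * w t * (w t - z) ^- 1).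
Proof.
move=> zr.
have z0 : cabs (0 : C) < rho by rewrite cabs0.
have cL := contin_hol_circle r0 dL.
have ck := contin_kernel 1 zr.
have c1 := contin_M (contin_M cL (@contin_eit R rho)) ck.
have c2 : contin 0 tp (fun t => cconj (clog (w t)) * w t * (w t - z) ^- 1).
  apply: contin_M ck; apply: contin_M (@contin_eit R rho).
  by apply: (contin_comp cL) => t _ _; exact: cconj_cont.
have -> : cmean (fun t => rc (2 * lg t) * w t * (w t - z) ^- 1) =
   cmean (fun t => clog (w t) * w t * (w t - z) ^- 1) + cmean (fun t => cconj (clog (w t)) * w t * (w t - z) ^- 1).
  rewrite -(cmeanD c1 c2); apply: cmean_ext => t.
  have -> : rc (2 * lg t) = clog (w t) + cconj (clog (w t)).
    by rewrite cconj_add clog_Re// wr.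
  by rewrite !mulrDl.
congr (_ + _); first exact: cauchy_CT.
pose F u := clog u * (rc (rho ^+ 2) / (rc (rho ^+ 2) - cconj z * u)).
have Fn u : cabs u <= rho -> rc (rho ^+ 2) - cconj z * u != 0.
  move=> ur; rewrite subr_eq0; apply: contraTneq zr => E; rewrite -leNgt.
  have := congr1 (@cabs R) E; rewrite cabs_rc ger0_norm ?sqr_ge0// cabsM cabs_conj expr2 => E'.
  by rewrite -(ler_pM2r r0) E' ler_wpM2l ?cabs_ge0.
have dF u : cabs u <= rho -> derivable F u 1.
  move=> ur; apply: cderV (cder_M (derivableP (dL ur)) (cder_Z (rc (rho ^+ 2)) (cder_V
    (cder_B (cder_cst (rc (rho ^+ 2)) u) (cder_Z (cconj z) (cder_id u))) (Fn u ur)))).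
have := cauchy_formula dF z0; rewrite {1}/F mulr0 subr0 divff; last first.
  by rewrite rc_eq0 expf_neq0// lt0r_neq0.
rewrite mulr1 => ->.
have cF := contin_M (contin_hol_circle r0 dF) (contin_M (@contin_eit R rho) (contin_kernel 1 z0)).
rewrite -(cmean_conj cF); apply: cmean_ext => t.
rewrite -/(w t) subr0 expr1 divff ?mulr1; last by rewrite -cabs_gt0 wr.
rewrite /F !cconjM -mulrA; congr (_ * _); rewrite cconjV cconj_rc cconjD cconjN cconjM cconjK cconj_rc.
have E : rc (rho ^+ 2) = w t * cconj (w t) by rewrite mul_cconj wr.
have cw : cconj (w t) != 0 by rewrite cconj_eq0 -cabs_gt0 wr.
have wz := circ_neq t zr.
have -> : rc (rho ^+ 2) - z * cconj (w t) = cconj (w t) * (w t - z) by rewrite E; ring.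
by rewrite -/(w t) in wz; rewrite E; field; rewrite cw wz.
Qed.

(** Schwarz's formula differentiated under the integral; the constant conj L(0) drops out. *)
Lemma log_derivative z : cabs z < rho ->
  derive1 g z / g z = cmean (fun t => rc (2 * lg t) * w t * (w t - z) ^- 2).
Proof.
move=> zr; have cphi : contin 0 tp (fun t => rc (2 * lg t) * w t).
  apply: contin_M (@contin_eit R rho); apply: (contin_rc (u := fun t => 2 * lg t)).
  exact: contin_Mu (@contin_cst R R 0 tp 2) contin_lg.
have D := cder_B (cauchy_transf1_der cphi zr) (cder_cst (cconj (clog 0)) z).
rewrite subr0 in D; rewrite -(cderE D).
apply: esym; apply: cderE; apply: cder_near (clog_der (lt_trans zr rr)).
have /near_cabs[d d0 hd] := disc_near zr.
apply/near_cabs; exists d; first exact: d0.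
by move=> u /hd ur; rewrite -(schwarz ur) addrK.
Qed.
End zerofree.
End Log.

(** * The Poisson kernel *)

Section Poisson.
Context {R : realType}.
Local Notation C := (CC R).
Local Notation tp := (2 * pi : R).
Implicit Types (z w : C) (r s t x y : R) (v : R -> R).

(** Written through the real part of the kernel of Schwarz's formula; [PKE] identifies it with the
    classical (rho ^ 2 - |z| ^ 2) / |w - z| ^ 2. *)
Definition poisson_ker rho z t : R := 2 * cRe (rc rho * eit t * (rc rho * eit t - z) ^- 1) - 1.

Lemma contin_circ_kernel rho z n : cabs z < rho ->
  contin 0 tp (fun t => rc rho * eit t * (rc rho * eit t - z) ^- n).
Proof. by move=> zr; exact: contin_M (@contin_eit R rho) (contin_kernel n zr). Qed.

Arguments contin_circ_kernel {rho z} n _.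

Lemma contin_PK rho z : cabs z < rho -> contin 0 tp (poisson_ker rho z).
Proof.
move=> zr; have c1 := contin_Re (contin_circ_kernel 1 zr).
exact: contin_Du (contin_Mu (@contin_cst R R 0 tp 2) c1) (@contin_cst R R 0 tp (-1)).
Qed.

Lemma PKE rho z t : cabs z < rho ->
  poisson_ker rho z t = (rho ^+ 2 - cabs z ^+ 2) / cabs (rc rho * eit t - z) ^+ 2.
Proof.
move=> zr; have wz := circ_neq t zr; rewrite /poisson_ker; set w := rc rho * eit t in wz *.
have wr : cabs w ^+ 2 = rho ^+ 2.
  by rewrite cabsM cabs_eit mulr1 cabs_rc real_normK ?num_real.
have d0 : cabs (w - z) ^+ 2 != 0 by rewrite expf_neq0// cabs_eq0.
have -> : w * (w - z) ^- 1 = rc ((cabs (w - z) ^+ 2)^-1) * (w * cconj (w - z)).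
  by rewrite rcV -mul_cconj expr1; field; rewrite cconj_eq0 wz.
have -> : cRe (rc ((cabs (w - z) ^+ 2)^-1) * (w * cconj (w - z))) =
    (cabs (w - z) ^+ 2)^-1 * cRe (w * cconj (w - z)).
  by rewrite cRe_M cRe_rc cIm_rc mul0r subr0.
have -> : cRe (w * cconj (w - z)) = (cabs w ^+ 2 - cabs z ^+ 2 + cabs (w - z) ^+ 2) / 2.
  rewrite !cabs_sqr cRe_M cRe_conj cIm_conj !cRe_D !cIm_D !cRe_N !cIm_N.
  by field.
by rewrite -wr; field; rewrite cabs_eq0.
Qed.

Lemma poisson_ker_ge0 rho z t : cabs z < rho -> 0 <= poisson_ker rho z t.
Proof.
move=> zr; rewrite PKE// divr_ge0 ?sqr_ge0// subr_ge0 lerXn2r ?nnegrE ?cabs_ge0 ?(ltW zr)//.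
by apply: le_trans (ltW zr); exact: cabs_ge0.
Qed.

Lemma poisson_ker_le rho z t : cabs z < rho -> poisson_ker rho z t <= (rho + cabs z) / (rho - cabs z).
Proof.
move=> zr; have z0 := cabs_ge0 z; have ws := circ_sub t zr.
have p0 : 0 < rho - cabs z by rewrite subr_gt0.
rewrite PKE// ler_pdivrMr ?exprn_gt0 ?(lt_le_trans p0 ws)//.
have -> : rho ^+ 2 - cabs z ^+ 2 = (rho + cabs z) / (rho - cabs z) * (rho - cabs z) ^+ 2.
  by field; exact: lt0r_neq0.
rewrite ler_wpM2l ?divr_ge0//; first by rewrite addr_ge0// (le_trans z0)// ltW.
  exact: ltW.
by rewrite lerXn2r ?nnegrE ?cabs_ge0// ltW.
Qed.

Lemma poisson_ker_decomp rho z v : cabs z < rho -> contin 0 tp v ->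
  mean (fun t => v t * poisson_ker rho z t) =
  cRe (cmean (fun t => rc (2 * v t) * (rc rho * eit t) * (rc rho * eit t - z) ^- 1)) - mean v.
Proof.
move=> zr cv; have ck := contin_circ_kernel 1 zr.
have c2 : contin 0 tp (fun t => v t * (2 * cRe (rc rho * eit t * (rc rho * eit t - z) ^- 1))).
  exact: contin_Mu cv (contin_Mu (@contin_cst R R 0 tp 2) (contin_Re ck)).
have -> : mean (fun t => v t * poisson_ker rho z t) =
   mean (fun t => v t * (2 * cRe (rc rho * eit t * (rc rho * eit t - z) ^- 1)) + - v t).
  by apply: mean_ext => t; rewrite /poisson_ker; ring.
rewrite (meanD c2 (conNu cv)) (meanN cv); congr (_ - _).
rewrite cmean_Re; apply: mean_ext => t.
have E A : cRe (rc (2 * v t) * A) = 2 * v t * cRe A.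
  by rewrite cRe_M cRe_rc cIm_rc mul0r subr0.
by rewrite /comp -[in RHS]mulrA E; ring.
Qed.

Lemma contin_2v (rho : R) v : contin 0 tp v -> contin 0 tp (fun t => rc (2 * v t) * (rc rho * eit t)).
Proof.
move=> cv; apply: contin_M (@contin_eit R rho); apply: (contin_rc (u := fun t => 2 * v t)).
exact: contin_Mu (@contin_cst R R 0 tp 2) cv.
Qed.

(* The Schwarz integral of v is holomorphic with real part the Poisson integral,
   so the mean of the latter over any inner circle is its value at 0. *)
Lemma poisson_mean rho r v : 0 < r -> r < rho -> contin 0 tp v ->
  contin 0 tp (fun s => mean (fun t => v t * poisson_ker rho (rc r * eit s) t)) /\
  mean (fun s => mean (fun t => v t * poisson_ker rho (rc r * eit s) t)) = mean v.
Proof.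
move=> r0 rr cv; set phi := fun t => rc (2 * v t) * (rc rho * eit t).
pose H z := cmean (fun t => phi t * (rc rho * eit t - z) ^- 1).
have dH z : cabs z < rho -> derivable H z 1.
  by move=> zr; exact: cderV (cauchy_transf1_der (contin_2v (rho := rho) cv) zr).
have sr s : cabs (rc r * eit s) < rho by rewrite cabsM cabs_eit mulr1 cabs_rc gtr0_norm.
have dHr z : cabs z <= r -> derivable H z 1 by move=> zr; apply: dH; exact: le_lt_trans rr.
have cH := contin_hol_circle r0 dHr.
have E s : mean (fun t => v t * poisson_ker rho (rc r * eit s) t) = cRe (H (rc r * eit s)) + (- mean v).
  by rewrite poisson_ker_decomp.
have cm := @contin_cst R R 0 tp (- mean v); have cRH := contin_Re cH.
have E' : (fun s => mean (fun t => v t * poisson_ker rho (rc r * eit s) t)) = fun s => cRe (H (rc r * eit s)) + (- mean v).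
  by apply/funext => s; exact: E.
rewrite E'; split; first exact: contin_Du cRH cm.
rewrite (meanD cRH cm) mean_cst.
have z0 : cabs (0 : C) < r by rewrite cabs0.
have := cauchy_formula dHr z0.
have -> : cmean (fun t : R => H (rc r * eit t) * (rc r * eit t / (rc r * eit t - 0))) =
   cmean (fun t => H (rc r * eit t)).
  apply: cmean_ext => t; rewrite subr0 divff ?mulr1//.
  by rewrite -cabs_gt0 cabsM cabs_eit mulr1 cabs_rc gtr0_norm.
move=> /(congr1 (@cRe R)); rewrite cmean_Re => <-.
have -> : H 0 = cmean (fun t => rc (2 * v t)).
  apply: cmean_ext => t; rewrite /phi subr0 expr1 -mulrA divff ?mulr1//.
  by rewrite -cabs_gt0 cabsM cabs_eit mulr1 cabs_rc gtr0_norm ?(lt_trans r0).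
rewrite cmean_Re (_ : mean (@cRe R \o _) = mean (fun t => 2 * v t)).
  by rewrite (meanZ _ cv); ring.
by apply: mean_ext.
Qed.

Section zerofree.
Variables (rho' : R) (g : C -> C).
Hypothesis dg : forall w, cabs w < rho' -> derivable g w 1.
Hypothesis g0 : forall w, cabs w < rho' -> g w != 0.
Variable rho : R.
Hypotheses (r0 : 0 < rho) (rr : rho < rho').
Let w t : C := rc rho * eit t.

(** Real parts in Schwarz's formula leave the extra term ln |g 0| minus the circle mean of ln |g|.
    It vanishes, as the case of the centre shows, where the kernel is 1. *)
Lemma log_poisson z : cabs z < rho ->
  ln (cabs (g z)) = mean (fun t => ln (cabs (g (w t))) * poisson_ker rho z t).
Proof.
move=> zr; have cl := contin_lg dg g0 r0 rr.
have z0 : cabs (0 : C) < rho by rewrite cabs0.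
have E u : cabs u < rho -> mean (fun t => ln (cabs (g (w t))) * poisson_ker rho u t) =
    ln (cabs (g u)) + ln (cabs (g 0)) - mean (fun t => ln (cabs (g (w t)))).
  move=> ur; rewrite (poisson_ker_decomp ur cl) -(schwarz dg g0 r0 rr ur) cRe_D cRe_conj.
  by rewrite !(clog_Re dg g0)//; exact: (lt_trans _ rr).
have := E 0 z0.
have -> : mean (fun t => ln (cabs (g (w t))) * poisson_ker rho 0 t) = mean (fun t => ln (cabs (g (w t)))).
  apply: mean_ext => t; rewrite /poisson_ker subr0 expr1 divff ?cRe_1; first by ring.
  by rewrite -cabs_gt0 cabsM cabs_eit mulr1 cabs_rc gtr0_norm.
by move=> E0; rewrite (E z zr); lra.
Qed.

Lemma log_mean : ln (cabs (g 0)) = mean (fun t => ln (cabs (g (w t)))).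
Proof.
rewrite log_poisson ?cabs0//; apply: mean_ext => t.
rewrite /poisson_ker subr0 expr1 divff ?cRe_1; first by ring.
by rewrite -cabs_gt0 cabsM cabs_eit mulr1 cabs_rc gtr0_norm.
Qed.
End zerofree.
End Poisson.

(** * Local orders of meromorphic functions *)

Section LocalOrders.
Context {R : realType}.
Local Notation C := (CC R).
Implicit Types (z w : C) (f g h : C -> C) (m n : int).

Lemma hol_der g z : holomorphic_at g z -> derivable g z 1.
Proof. by move=> /near_cabs[d d0 hd]; apply: hd; rewrite subrr cabs0. Qed.
Lemma hol_cont g z : holomorphic_at g z -> {for z, continuous g}.
Proof. by move=> /hol_der; exact: derivable_ccont. Qed.
Lemma hol_near g z : holomorphic_at g z -> \forall w \near z, holomorphic_at g w.
Proof. exact: cnear_near. Qed.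
Lemma near2 (P Q T : C -> Prop) z : (\forall w \near z, P w) -> (\forall w \near z, Q w) ->
  (forall w, P w -> Q w -> T w) -> \forall w \near z, T w.
Proof. by move=> h k pq; near=> w; apply: pq; near: w. Unshelve. all: by end_near. Qed.
Lemma near1 (P T : C -> Prop) z : (\forall w \near z, P w) ->
  (forall w, P w -> T w) -> \forall w \near z, T w.
Proof. by move=> h pq; near=> w; apply: pq; near: w. Unshelve. all: by end_near. Qed.
Lemma pnear2 (P Q T : C -> Prop) z : (\forall w \near z^', P w) -> (\forall w \near z^', Q w) ->
  (forall w, w != z -> P w -> Q w -> T w) -> \forall w \near z^', T w.
Proof.
move=> /near_pcabs[d d0 h] /near_pcabs[e e0 k] pq; apply/near_pcabs.
exists (Num.min d e); first by rewrite lt_min d0.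
by move=> w; rewrite lt_min => /andP[wd we] wz; apply: pq; [|exact: h|exact: k].
Qed.
Lemma pnear1 (P T : C -> Prop) z : (\forall w \near z^', P w) ->
  (forall w, w != z -> P w -> T w) -> \forall w \near z^', T w.
Proof. by move=> h pt; apply: (pnear2 h h) => w ? ? _; exact: pt. Qed.
Lemma pnear0 (T : C -> Prop) z : (forall w, w != z -> T w) -> \forall w \near z^', T w.
Proof. by move=> h; apply/near_pcabs; exists 1 => // w _; exact: h. Qed.

Lemma hol_cst (c z : C) : holomorphic_at (fun=> c) z.
Proof. by apply/near_cabs; exists 1 => // w _; exact: cderV (cder_cst c w). Qed.
Lemma hol_sub z0 z : holomorphic_at (fun w => w - z0) z.
Proof. by apply/near_cabs; exists 1 => // w _; exact: cderV (cder_B (cder_id w) (cder_cst z0 w)). Qed.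
Lemma hol_D g h z : holomorphic_at g z -> holomorphic_at h z ->
  holomorphic_at (fun w => g w + h w) z.
Proof. by move=> hg hh; apply: (near2 hg hh) => w a b; exact: cderV (cder_D (derivableP a) (derivableP b)). Qed.
Lemma hol_M g h z : holomorphic_at g z -> holomorphic_at h z ->
  holomorphic_at (fun w => g w * h w) z.
Proof. by move=> hg hh; apply: (near2 hg hh) => w a b; exact: cderV (cder_M (derivableP a) (derivableP b)). Qed.
Lemma hol_X g k z : holomorphic_at g z -> holomorphic_at (fun w => g w ^+ k) z.
Proof. by move=> hg; apply: (near1 hg) => w a; exact: cderV (cder_X k (derivableP a)). Qed.
Lemma hol_ne0 g z : holomorphic_at g z -> g z != 0 -> \forall w \near z, g w != 0.
Proof. by move=> hg; apply: ccont_near_ne0; exact: hol_cont. Qed.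
Lemma hol_V g z : holomorphic_at g z -> g z != 0 -> holomorphic_at (fun w => (g w)^-1) z.
Proof.
by move=> hg g0; apply: (near2 hg (hol_ne0 hg g0)) => w a b; exact: cderV (cder_V (derivableP a) b).
Qed.
Lemma hol_eq g h z : (\forall w \near z, g w = h w) -> holomorphic_at g z -> holomorphic_at h z.
Proof.
move=> /cnear_near gh hg; apply: (near2 gh hg) => w a b.
exact: cderV (cder_near a (derivableP b)).
Qed.

Definition removable f z := exists2 g : C -> C, holomorphic_at g z & \forall w \near z^', f w = g w.
Definition mero_at f z := exists (k : nat) (g : C -> C), holomorphic_at g z /\
  \forall w \near z^', f w = g w / (w - z) ^+ k.

Lemma removable_M f g z : removable f z -> removable g z -> removable (fun w => f w * g w) z.
Proof.
move=> [f1 h1 e1] [g1 h2 e2]; exists (fun w => f1 w * g1 w); first exact: hol_M.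
by apply: (pnear2 e1 e2) => w _ -> ->.
Qed.
Lemma pnear_derive f g z : (\forall w \near z^', f w = g w) ->
  \forall w \near z^', derive1 f w = derive1 g w.
Proof.
move=> /pnear_near_all fg; apply: (pnear1 fg) => w _ {}fg; rewrite !derive1E.
exact: near_eq_derive.
Qed.
Lemma removable_derive f z : removable f z -> removable (derive1 f) z.
Proof.
move=> [g hg fg]; exists (derive1 g); first exact: hol_at_derive.
exact: pnear_derive.
Qed.

Lemma exprz_der z w m : w != z ->
  is_derive w 1 (fun u : C => (u - z) ^ m) (m%:~R * (w - z) ^ (m - 1)).
Proof.
move=> wz; have x0 : w - z != 0 by rewrite subr_eq0.
have D := cder_B (cder_id w) (cder_cst z w); rewrite subr0 in D.
case: m => [[|k]|k].
- by rewrite mul0r; exact: cder_cst.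
- apply: (is_derive_eq (cder_X k.+1 D)); rewrite mulr1 /=.
  by have -> : Posz k.+1 - 1 = Posz k by lia.
- have xk : (w - z) ^+ k.+1 != 0 by rewrite expf_neq0.
  apply: (is_derive_eq (cder_V (cder_X k.+1 D) xk)); rewrite mulr1 /=.
  have -> : Negz k - 1 = Negz k.+1 by lia.
  by rewrite NegzE mulrNz /exprz !exprS; field; rewrite x0 expf_neq0.
Qed.

Lemma has_order_eq f g z m : (\forall w \near z^', f w = g w) -> has_order f z m -> has_order g z m.
Proof.
move=> fg [h [hh h0 e]]; exists h; split => //.
by apply: (pnear2 fg e) => w _ <- ->.
Qed.
(** If m < n, the cofactor belonging to [m] equals a positive power of w - z times the other one
    near z, so it would vanish at z. *)
Lemma order_uniq f z m n : has_order f z m -> has_order f z n -> m = n.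
Proof.
wlog mn : m n / (m < n)%R.
  move=> H h1 h2; have [/H|/H|//] := ltgtP m n; first by apply.
  by move=> /(_ h2 h1).
move=> [g [hg g0 e1]] [h [hh h0 e2]]; exfalso.
have : g z = (z - z) ^+ `|n - m|%N * h z.
  apply: (ccont_eq (hol_cont hg) (hol_cont (hol_M (hol_X `|n - m|%N (hol_sub z z)) hh))).
  apply: (pnear2 e1 e2) => w wz -> E; have x0 : w - z != 0 by rewrite subr_eq0.
  have xm : (w - z) ^ m != 0 by rewrite expfz_neq0.
  apply: (mulfI xm); rewrite E mulrA exprnP -expfzDr//.
  by have -> : m + `|n - m|%N = n by lia.
rewrite subrr expr0n; have -> : (`|n - m|%N == 0)%N = false by lia.
by rewrite mul0r => /eqP; rewrite (negPf g0).
Qed.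
Lemma mero_orderE f z m : has_order f z m -> mero_order f z = m.
Proof.
move=> h; rewrite /mero_order.
by have /= := @xgetPex _ 0 [set m | has_order f z m] (ex_intro _ m h); move/order_uniq; apply.
Qed.
Lemma order_M f g z m n : has_order f z m -> has_order g z n ->
  has_order (fun w => f w * g w) z (m + n).
Proof.
move=> [f1 [h1 n1 e1]] [g1 [h2 n2 e2]]; exists (fun w => f1 w * g1 w); split.
- exact: hol_M.
- by rewrite mulf_neq0.
- apply: (pnear2 e1 e2) => w wz -> ->; rewrite expfzDr ?subr_eq0//.
  by ring.
Qed.
Lemma order_V f z m : has_order f z m -> has_order (fun w => (f w)^-1) z (- m).
Proof.
move=> [f1 [h1 n1 e1]]; exists (fun w => (f1 w)^-1); split.
- exact: hol_V.
- by rewrite invr_eq0.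
- by apply: (pnear1 e1) => w wz ->; rewrite invfM invr_expz.
Qed.
Lemma order_cst (c z : C) : c != 0 -> has_order (fun=> c) z 0.
Proof.
move=> c0; exists (fun=> c); split => //; first exact: hol_cst.
by apply: pnear0 => w _; rewrite expr0z mul1r.
Qed.
Lemma order_X f z m k : has_order f z m -> has_order (fun w => f w ^+ k) z (m *+ k).
Proof.
move=> h; elim: k => [|k IH].
  by apply: has_order_eq (order_cst z (oner_neq0 _)); apply: pnear0 => w _; rewrite expr0.
rewrite mulrS; apply: has_order_eq (order_M h IH).
by apply: pnear0 => w _; rewrite exprS.
Qed.
Lemma order_sub a z : has_order (fun w => w - a) z (if z == a then 1 else 0).
Proof.
case: eqVneq => [->|za].
  exists (fun=> 1); split; [exact: hol_cst|exact: oner_neq0|].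
  by apply: pnear0 => w _; rewrite mulr1 expr1z.
exists (fun w => w - a); split; [exact: hol_sub|by rewrite subr_eq0|].
by apply: pnear0 => w _; rewrite expr0z mul1r.
Qed.
Lemma order_expz f z m n : has_order f z m -> has_order (fun w => f w ^ n) z (m * n).
Proof.
move=> h; case: n => k.
  have -> : m * Posz k = m *+ k by rewrite -[RHS]mulr_natr natz.
  by apply: (has_order_eq _ (order_X k h)); exact: pnear0.
rewrite NegzE mulrN; have -> : m * Posz k.+1 = m *+ k.+1 by rewrite -[RHS]mulr_natr natz.
by apply: has_order_eq (order_V (order_X k.+1 h)); apply: pnear0 => w _; rewrite exprnN.
Qed.
Lemma order_ge0 f z m : has_order f z m -> removable f z <-> 0 <= m.
Proof.
move=> H; split; last first.
  case: m H => // k [g [hg g0 e]] _; exists (fun w => (w - z) ^+ k * g w).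
    exact: hol_M (hol_X k (hol_sub z z)) hg.
  exact: e.
move=> [g hg fg]; have [g0|[k [h [hh h0 gh]]]] := hol_dich hg.
  case: H => h [hh h0 e]; exfalso.
  have /pnear_ex[w] : \forall w \near z^', False; last by [].
  have := pnear2 fg (pnear_near g0) (T := fun w => f w = 0).
  move=> /(_ (fun w _ a b => etrans a b)) f0.
  have hn := pnear_near (hol_ne0 hh h0).
  have fz := pnear2 f0 e (T := fun w => (w - z) ^ m * h w = 0) (fun w _ a b => etrans (esym b) a).
  apply: (pnear2 fz hn) => w wz /eqP; rewrite mulf_eq0 expfz_eq0 subr_eq0 (negPf wz) andbF /=.
  by move=> /eqP -> /eqP.
suff : has_order f z (Posz k) by move/(order_uniq H) => ->.
by exists h; split => //; apply: (pnear1 fg) => w _ ->; rewrite gh.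
Qed.
Lemma order_eq0 f z : holomorphic_at f z -> f z != 0 -> has_order f z 0.
Proof.
move=> h f0; exists f; split => //.
by apply: pnear0 => w _; rewrite expr0z mul1r.
Qed.
Lemma order_derive f z m : has_order f z m -> m != 0 -> has_order (derive1 f) z (m - 1).
Proof.
move=> [g [hg g0 e]] m0; exists (fun w => m%:~R * g w + (w - z) * derive1 g w); split.
- apply: hol_D; first exact: hol_M (hol_cst _ _) hg.
  exact: hol_M (hol_sub z z) (hol_at_derive hg).
- rewrite subrr mul0r addr0 mulf_neq0// intr_eq0//.
- apply: (pnear2 (pnear_derive e) (pnear_near hg)) => w wz -> dg.
  rewrite (cderE (cder_M (exprz_der m wz) (derivableP dg))) -derive1E.
  have x0 : w - z != 0 by rewrite subr_eq0.
  have -> : (w - z) ^ m = (w - z) ^ (m - 1) * (w - z).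
    by rewrite -[X in _ = _ * X]expr1z -expfzDr// subrK.
  by ring.
Qed.

Lemma mero_at_order f z m : has_order f z m -> mero_at f z.
Proof.
case: m => k [g [hg g0 e]].
  exists 0%N, (fun w => (w - z) ^+ k * g w); split.
    exact: hol_M (hol_X k (hol_sub z z)) hg.
  by apply: (pnear1 e) => w _ ->; rewrite expr0 divr1.
exists k.+1, g; split => //; apply: (pnear1 e) => w _ ->.
by rewrite NegzE -exprnN mulrC.
Qed.
Lemma mero_at_0 f z : (\forall w \near z^', f w = 0) -> mero_at f z.
Proof.
move=> f0; exists 0%N, (fun=> 0); split; first exact: hol_cst.
by apply: (pnear1 f0) => w _ ->; rewrite mul0r.
Qed.
Lemma mero_at_dich f z : mero_at f z -> (\forall w \near z^', f w = 0) \/ exists m, has_order f z m.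
Proof.
move=> [k [g [hg e]]]; have [g0|[j [h [hh h0 gh]]]] := hol_dich hg; [left|right].
  by apply: (pnear2 e (pnear_near g0)) => w _ -> ->; rewrite mul0r.
exists (Posz j - Posz k); exists h; split => //.
apply: (pnear1 e) => w wz ->; rewrite gh expfzDr ?subr_eq0// -exprnN -exprnP.
by rewrite mulrAC.
Qed.
Lemma mero_at_D f g z : mero_at f z -> mero_at g z -> mero_at (fun w => f w + g w) z.
Proof.
move=> [j [f1 [h1 e1]]] [k [g1 [h2 e2]]].
exists (j + k)%N, (fun w => f1 w * (w - z) ^+ k + g1 w * (w - z) ^+ j); split.
  exact: hol_D (hol_M h1 (hol_X k (hol_sub z z))) (hol_M h2 (hol_X j (hol_sub z z))).
apply: (pnear2 e1 e2) => w wz -> ->; have x0 : w - z != 0 by rewrite subr_eq0.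
by rewrite exprD; field; rewrite !expf_neq0.
Qed.
Lemma mero_at_cst (c z : C) : mero_at (fun=> c) z.
Proof.
exists 0%N, (fun=> c); split; first exact: hol_cst.
by apply: pnear0 => w _; rewrite expr0 divr1.
Qed.
Lemma mero_at_derive f z : mero_at f z -> mero_at (derive1 f) z.
Proof.
move=> /mero_at_dich[f0|[m H]].
  apply: mero_at_0; apply: (pnear1 (pnear_derive f0)) => w _ ->.
  exact: cderE (cder_cst 0 w).
have [m0|m0] := eqVneq m 0; last exact: mero_at_order (order_derive H m0).
have [|g hg e] := @removable_derive f z; first by apply/(order_ge0 H); rewrite m0.
exists 0%N, g; split => //; apply: (pnear1 e) => w _ ->.
by rewrite expr0 divr1.
Qed.
Lemma meroP f : meromorphic f <-> forall z, mero_at f z.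
Proof.
split=> H z; first by have [k [g hg e]] := H z; exists k, g.
by have [k [g [hg e]]] := H z; exists k, g.
Qed.
Lemma hol_lmero f z : holomorphic_at f z -> mero_at f z.
Proof.
by exists 0%N, f; split => //; apply: pnear0 => w _; rewrite expr0 divr1.
Qed.

End LocalOrders.

(** * Meromorphic functions in the plane: identity theorem, isolated zeros and poles *)

Section Global.
Context {R : realType}.
Local Notation C := (CC R).
Implicit Types (z w : C) (f g h : C -> C) (m n : int).

(** Having an order at every point; by the identity theorem [mero_dich], this amounts to being
    meromorphic and not identically zero. *)
Definition mero_nz f := forall z, exists m, has_order f z m.
Definition regular_nz f z := holomorphic_at f z /\ f z != 0.
(** The circle avoids not only zeros and poles but also the isolated points where the representative
    takes a meaningless value. Along it integrands are continuous and pointwise identities can be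
    used. *)
Definition generic f (r : R) := forall z, cabs z = r -> regular_nz f z.

Lemma ordP f z : mero_nz f -> has_order f z (mero_order f z).
Proof. by move=> /(_ z)[m h]; rewrite (mero_orderE h). Qed.
Lemma order_not0 f z m : has_order f z m -> ~ \forall w \near z^', f w = 0.
Proof.
move=> [h [hh h0 e]] f0.
have /pnear_ex[w] : \forall w \near z^', False; last by [].
have fz := pnear2 f0 e (T := fun w => (w - z) ^ m * h w = 0) (fun w _ a b => etrans (esym b) a).
apply: (pnear2 fz (pnear_near (hol_ne0 hh h0))) => w wz /eqP.
by rewrite mulf_eq0 expfz_eq0 subr_eq0 (negPf wz) andbF /= => /eqP -> /eqP.
Qed.
Lemma order_good f z m : has_order f z m -> \forall w \near z^', regular_nz f w.
Proof.
move=> [g [hg g0 e]].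
have H := pnear2 (pnear_near_all e) (pnear_near (hol_near hg)).
apply: (pnear2 (pnear_near (hol_ne0 hg g0)) (H _ (fun w _ a b => conj a b))) => w wz gw [ew hgw].
have x0 : w - z != 0 by rewrite subr_eq0.
have hw : holomorphic_at (fun u => (u - z) ^ m) w.
  have : \forall u \near w, u != z.
    apply/near_cabs; exists (cabs (w - z)); first by rewrite cabs_gt0.
    by move=> u; apply: contraTneq => ->; rewrite cabsB ltxx.
  by move=> /near1; apply => u uz; exact: cderV (exprz_der m uz).
split.
  apply: (hol_eq _ (hol_M hw hgw)).
  by apply: (near1 ew) => u ->.
have /near_cabs[d d0 hd] := ew.
by rewrite hd ?subrr ?cabs0// mulf_neq0// expfz_neq0.
Qed.
Lemma regular_nz_order f z : regular_nz f z -> has_order f z 0.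
Proof. by move=> [a b]; exact: order_eq0. Qed.

(** The identity theorem. The set of points near which [f] vanishes is open, and so is its
    complement; by bisection of the segment from [z0] to [z1], membership is constant along it. *)
Lemma mero_dich f : meromorphic f -> mero_eq f (fun=> 0) \/ mero_nz f.
Proof.
move=> /meroP mf; pose Z z := \forall w \near z^', f w = 0.
have D z : Z z \/ exists m, has_order f z m by exact: mero_at_dich.
have [[z0 hz0]|nex] := pselect (exists z, Z z); last first.
  by right=> z; have [/(ex_intro Z z)/nex|] := D z.
left=> z1; rewrite -/(Z z1).
have loc z : exists2 d : R, 0 < d & forall w, cabs (w - z) < d -> Z w <-> Z z.
  have [Zz|[m hm]] := D z.
    have /near_pcabs[d d0 hd] := pnear_near_all Zz.
    exists d; [exact: d0|move=> w wz; split=> _; [exact: Zz|]].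
    have [->|wnz] := eqVneq w z; [exact: Zz|exact: pnear_near (hd w wz wnz)].
  have nZ := order_not0 hm; have /near_pcabs[d d0 hd] := order_good hm.
  exists d; [exact: d0|move=> w wz; split=> [Zw|Zz]; exfalso; last exact: nZ Zz].
  have [wE|wnz] := eqVneq w z; first by rewrite wE in Zw; exact: nZ Zw.
  exact: (order_not0 (regular_nz_order (hd w wz wnz))) Zw.
clearbody Z; clear D mf.
pose ga (t : R) := z0 + rc t * (z1 - z0).
pose same (n : nat) (s t : R) := forall x y, s <= x <= s + 1 / 2 ^+ n -> s <= y <= s + 1 / 2 ^+ n ->
  Z (ga x) <-> Z (ga y).
have : same 0%N 0 0; last first.
  move=> /(_ 0 1); rewrite expr0 divr1 add0r !lexx ler01 => /(_ isT isT).
  by rewrite /ga rc0 rc1 mul0r addr0 mul1r [z0 + _]addrC subrK => -[/(_ hz0)].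
(* A segment is treated as a rectangle of height 0, with only the first coordinate in use. *)
apply: (@bisect2 R same 0 0 1 0 ler01 (lexx 0)).
  move=> n s t _ _ _ _ h1 h2 _ _ x y xs ys.
  have half : 1 / 2 ^+ n = 1 / 2 ^+ n.+1 + 1 / 2 ^+ n.+1 :> R.
    by rewrite exprSr; field; rewrite expf_neq0.
  rewrite half addrA in xs ys; set s' := s + _ in h2 xs ys.
  have p0 : 0 <= 1 / 2 ^+ n.+1 :> R by rewrite divr_ge0// exprn_ge0.
  have ss : s <= s' by rewrite lerDl.
  have S x' : s <= x' <= s' + 1 / 2 ^+ n.+1 -> Z (ga x') <-> Z (ga s').
    move=> /andP[x1 x2]; have [xs'|/ltW xs'] := leP x' s'.
      by apply: h1; rewrite ?x1 ?xs' ?ss ?lexx.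
    by apply: h2; rewrite ?xs' ?x2 ?lexx ?lerDl.
  by rewrite (S x xs) (S y ys).
move=> x y _ _; have [d d0 hd] := loc (ga x).
have k0 : 0 < cabs (z1 - z0) + 1 by rewrite ltr_wpDl ?cabs_ge0.
have [N hN] := pow_small (q := 2^-1) (ltac:(lra)) (ltac:(lra)) (divr_gt0 d0 k0).
exists N => n s t Nn _ _ _ _ /andP[sx xs] _ u v us vs.
have near_x u' : s <= u' <= s + 1 / 2 ^+ n -> Z (ga u') <-> Z (ga x).
  move=> /andP[u1 u2]; apply: hd.
  have -> : ga u' - ga x = rc (u' - x) * (z1 - z0) by rewrite /ga rcB; ring.
  have ux : `|u' - x| <= 2^-1 ^+ N.
    have q : (1 / 2 ^+ n : R) <= 2^-1 ^+ N.
      rewrite div1r -exprVn; apply: ler_wiXn2l => //; lra.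
    by rewrite ler_norml; apply/andP; split; lra.
  rewrite cabsM cabs_rc; apply: le_lt_trans (_ : _ <= 2^-1 ^+ N * (cabs (z1 - z0) + 1)) _.
    by rewrite ler_pM ?cabs_ge0// lerDl.
  by rewrite -ltr_pdivlMr.
by rewrite (near_x u us) (near_x v vs).
Qed.

Lemma mero_nz_mero f : mero_nz f -> meromorphic f.
Proof. by move=> h; apply/meroP => z; have [m hm] := h z; exact: mero_at_order hm. Qed.
Lemma mero_nz_neq0 f : mero_nz f -> ~ mero_eq f (fun=> 0).
Proof. by move=> h /(_ 0) f0; have [m hm] := h 0; exact: order_not0 hm f0. Qed.
Lemma mero_nz_of f : meromorphic f -> ~ mero_eq f (fun=> 0) -> mero_nz f.
Proof. by move=> /mero_dich[]. Qed.
Lemma mero_nz_M f g : mero_nz f -> mero_nz g -> mero_nz (fun w => f w * g w).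
Proof. by move=> h k z; have [m hm] := h z; have [n hn] := k z; exists (m + n); exact: order_M. Qed.
Lemma mero_nz_V f : mero_nz f -> mero_nz (fun w => (f w)^-1).
Proof. by move=> h z; have [m hm] := h z; exists (- m); exact: order_V. Qed.
Lemma mero_nz_eq f g : mero_eq f g -> mero_nz f -> mero_nz g.
Proof. by move=> fg h z; have [m hm] := h z; exists m; exact: has_order_eq (fg z) hm. Qed.
Lemma mero_derive f : meromorphic f -> meromorphic (derive1 f).
Proof. by move=> /meroP h; apply/meroP => z; exact: mero_at_derive. Qed.
Lemma mero_D f g : meromorphic f -> meromorphic g -> meromorphic (fun w => f w + g w).
Proof. by move=> /meroP h /meroP k; apply/meroP => z; exact: mero_at_D. Qed.
Lemma mero_cst (c : C) : meromorphic (fun=> c).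
Proof. by apply/meroP => z; exact: mero_at_cst. Qed.

(** Take c to be the value at a point [z] where [f] is regular. If f - c were not zero, it would
    have a positive finite order at [z], and its derivative a finite order as well, contrary to f' =
    0. *)
Lemma derive0_const f : meromorphic f -> mero_eq (derive1 f) (fun=> 0) ->
  exists c : C, mero_eq f (fun=> c).
Proof.
move=> mf f'0; have [f0|MZf] := mero_dich mf; first by exists 0.
have [m hm] := MZf 0; have /pnear_ex[z [hz _]] := order_good hm.
exists (f z); have mg := mero_D mf (mero_cst (- f z)).
have hg := hol_D hz (hol_cst (- f z) z).
have dg w : derivable f w 1 -> derive1 (fun w => f w + - f z) w = derive1 f w.
  move=> df; rewrite (cderE (cder_D (derivableP df) (cder_cst (- f z) w))) addr0.
  by rewrite derive1E.
have [g0|[k [h [hh h0 gh]]]] := hol_dich hg.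
  have [g00|MZg] := mero_dich mg; last first.
    by have [m' hm'] := MZg z; have := order_not0 hm' (pnear_near g0).
  by move=> w; apply: (pnear1 (g00 w)) => u _ /eqP; rewrite subr_eq0 => /eqP.
have k0 : (k != 0)%N.
  apply: contraNneq h0 => k0; have := gh z.
  by rewrite k0 expr0 mul1r subrr => <-.
have og : has_order (fun w => f w + - f z) z k.
  by exists h; split => //; apply: pnear0 => w _; rewrite gh.
exfalso; apply: (order_not0 (order_derive og _)); first by lia.
apply: (pnear2 (f'0 z) (pnear_near hz)) => w _ fw df.
by rewrite dg.
Qed.

(** Compactness by bisection: each point has a neighbourhood in which no other point satisfies [P],
    so small squares contain at most one. *)
Lemma finite_disc (P : C -> Prop) (r : R) : (forall z, \forall w \near z^', ~ P w) ->
  finite_set [set z | cabs z <= r /\ P z].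
Proof.
move=> dP; have [r0|r0] := ltP r 0.
  apply: (@sub_finite_set _ _ set0) => // z [zr _].
  by have := le_lt_trans zr r0; rewrite ltNge cabs_ge0.
pose fin (n : nat) (s t : R) := finite_set [set z : C | [/\ s <= cRe z <= s + (2 * r) / 2 ^+ n,
  t <= cIm z <= t + (2 * r) / 2 ^+ n & P z]].
have r2 : 0 <= 2 * r by rewrite mulr_ge0.
suff : fin 0%N (- r) (- r).
  apply: sub_finite_set => z [zr Pz]; split => //; rewrite expr0 divr1.
    by have := le_trans (Re_le z) zr; rewrite ler_norml => /andP[? ?]; apply/andP; split; lra.
  by have := le_trans (Im_le z) zr; rewrite ler_norml => /andP[? ?]; apply/andP; split; lra.
apply: (@bisect2 R fin (- r) (- r) (2 * r) (2 * r) r2 r2).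
  move=> n s t _ _ _ _ h1 h2 h3 h4; rewrite /fin.
  have half : (2 * r) / 2 ^+ n = (2 * r) / 2 ^+ n.+1 + (2 * r) / 2 ^+ n.+1 :> R.
    by rewrite exprSr; field; rewrite expf_neq0.
  rewrite half !addrA; set s' := s + _ in h2 h4 *; set t' := t + _ in h3 h4 *.
  apply: (@sub_finite_set _ _ (_ `|` _ `|` (_ `|` _))); last first.
    by rewrite !finite_setU; split; split; [exact: h1|exact: h2|exact: h3|exact: h4].
  move=> z [/andP[s1 s2] /andP[t1 t2] Pz].
  have [zs|/ltW zs] := leP (cRe z) s'; have [zt|/ltW zt] := leP (cIm z) t'.
  - by left; left; rewrite /= -/s' -/t' s1 zs t1 zt.
  - by right; left; rewrite /= -/s' -/t' s1 zs t2 zt.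
  - by left; right; rewrite /= -/s' -/t' s2 zs t1 zt.
  - by right; right; rewrite /= -/s' -/t' s2 zs t2 zt.
move=> x y _ _; have /near_pcabs[d d0 hd] := dP (Complex x y).
have k0 : 0 < 4 * r + 1 by lra.
have [N hN] := pow_small (q := 2^-1) (ltac:(lra)) (ltac:(lra)) (divr_gt0 d0 k0).
exists N => n s t Nn _ _ _ _ /andP[sx xs] /andP[ty yt].
apply: (@sub_finite_set _ _ [set (Complex x y : C)]) => // z [/andP[s1 s2] /andP[t1 t2] Pz].
apply/eqP/negPn/negP => zn; apply: (hd z _ zn Pz).
have q : (2 * r / 2 ^+ n : R) <= 2 * r * 2^-1 ^+ N.
  rewrite ler_wpM2l// -exprVn; apply: ler_wiXn2l => //; lra.
apply: (le_lt_trans (cabs_le_ReIm _)); rewrite cRe_D cIm_D cRe_N cIm_N.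
have -> : cRe (Complex x y : C) = x by []. have -> : cIm (Complex x y : C) = y by [].
have e1 : `|cRe z - x| <= 2 * r * 2^-1 ^+ N by rewrite ler_norml; apply/andP; split; lra.
have e2 : `|cIm z - y| <= 2 * r * 2^-1 ^+ N by rewrite ler_norml; apply/andP; split; lra.
have e3 : 2^-1 ^+ N * (4 * r + 1) < d by rewrite -ltr_pdivlMr.
have e4 : 0 <= 2^-1 ^+ N :> R by rewrite exprn_ge0//; lra.
lra.
Qed.

Lemma bad_finite f r : mero_nz f -> finite_set [set z | cabs z <= r /\ ~ regular_nz f z].
Proof.
move=> h; apply: finite_disc => z; have [m hm] := h z.
by apply: (pnear1 (order_good hm)) => w _ gw; exact.
Qed.

(** The excluded radii are the moduli of the irregular points, finitely many in each disc and hence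
    countably many. *)
Lemma generic_ae f : mero_nz f -> exists E : set R, [/\ measurable E, lebesgue_measure E = 0%E &
  forall r, ~ E r -> generic f r].
Proof.
move=> h; pose E := \bigcup_n (@cabs R @` [set z | cabs z <= n%:R /\ ~ regular_nz f z]).
have cE : countable E.
  apply: bigcup_countable => // n _; apply: finite_set_countable.
  by apply: finite_image; exact: bad_finite.
exists E; split; [exact: countable_measurable|exact: countable_lebesgue_measure0|].
move=> r nE z zr; apply: contrapT => nb; apply: nE.
exists (Num.bound r) => //; exists z => //; split => //.
by rewrite zr ltW// archi_boundP// -zr cabs_ge0.
Qed.
End Global.

(** * Logarithmic derivatives and orders of products *)

Section LogDeriv.
Context {R : realType}.
Local Notation C := (CC R).
Implicit Types (z w a l : C) (f g h : C -> C) (m n : int).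

(** The relation g' = g l with g nonzero, instead of a quotient: products, inverses and powers then
    act linearly on [l]. *)
Definition logder g z l := g z != 0 /\ is_derive z 1 g (g z * l).

Lemma logder_M g h z l l' : logder g z l -> logder h z l' -> logder (fun w => g w * h w) z (l + l').
Proof.
move=> [g0 dg] [h0 dh]; split; first by rewrite mulf_neq0.
by apply: (is_derive_eq (cder_M dg dh)); ring.
Qed.
Lemma logder_V g z l : logder g z l -> logder (fun w => (g w)^-1) z (- l).
Proof.
move=> [g0 dg]; split; first by rewrite invr_eq0.
by apply: (is_derive_eq (cder_V dg g0)); field.
Qed.
Lemma logder_1 z : logder (fun=> 1 : C) z 0.
Proof. by split; [exact: oner_neq0|apply: (is_derive_eq (cder_cst 1 z)); rewrite mulr0]. Qed.
Lemma logder_eq g h z l : (\forall w \near z, g w = h w) -> logder g z l -> logder h z l.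
Proof.
move=> gh [g0 dg]; have /near_cabs[d d0 hd] := gh.
have E : g z = h z by apply: hd; rewrite subrr cabs0.
split; first by rewrite -E.
by rewrite -E; exact: cder_near gh dg.
Qed.
Lemma near_all (P : C -> Prop) z : (forall w, P w) -> \forall w \near z, P w.
Proof. by move=> h; apply/near_cabs; exists 1 => // w _. Qed.
Lemma logder_expz g z l m : logder g z l -> logder (fun w => g w ^ m) z (m%:~R * l).
Proof.
move=> dg; have X k : logder (fun w => g w ^+ k) z (k%:R * l).
  elim: k => [|k IH].
    rewrite mul0r; apply: logder_eq (logder_1 z); apply: near_all => w.
    by rewrite expr0.
  have -> : k.+1%:R * l = l + k%:R * l by rewrite -natr1; ring.
  by apply: logder_eq (logder_M dg IH); apply: near_all => w; rewrite exprS.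
case: m => k; first by apply: logder_eq (X k); apply: near_all.
rewrite NegzE mulrNz mulNr; apply: logder_eq (logder_V (X k.+1)).
by apply: near_all => w; rewrite exprnN.
Qed.
Lemma logder_prod (I : eqType) (s : seq I) (F : I -> C -> C) z (L : I -> C) :
  (forall i, i \in s -> logder (F i) z (L i)) ->
  logder (fun w => \prod_(i <- s) F i w) z (\sum_(i <- s) L i).
Proof.
elim: s => [|i s IH] h.
  by rewrite big_nil; apply: logder_eq (logder_1 z); apply: near_all => w; rewrite big_nil.
rewrite big_cons; apply: logder_eq (logder_M (h i (mem_head _ _)) (IH _)).
  by apply: near_all => w; rewrite big_cons.
by move=> j js; apply: h; rewrite in_cons js orbT.
Qed.
Lemma dlE g z l : logder g z l -> derive1 g z / g z = l.
Proof. by move=> [g0 dg]; rewrite (cderE dg) mulrC mulKf. Qed.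
Lemma dlP g z : derivable g z 1 -> g z != 0 -> logder g z (derive1 g z / g z).
Proof.
move=> d g0; split => //; apply: (is_derive_eq (derivableP d)).
by rewrite derive1E; field.
Qed.

Lemma order_prod (I : eqType) (s : seq I) (F : I -> C -> C) z (L : I -> int) :
  (forall i, i \in s -> has_order (F i) z (L i)) ->
  has_order (fun w => \prod_(i <- s) F i w) z (\sum_(i <- s) L i).
Proof.
elim: s => [|i s IH] h.
  rewrite big_nil; apply: has_order_eq (order_cst z (oner_neq0 _)).
  by apply: pnear0 => w _; rewrite big_nil.
rewrite big_cons; apply: has_order_eq (order_M (h i (mem_head _ _)) (IH _)).
  by apply: pnear0 => w _; rewrite big_cons.
by move=> j js; apply: h; rewrite in_cons js orbT.
Qed.

Lemma pnear_notin (s : seq C) z : \forall w \near z^', w \notin s.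
Proof.
elim: s => [|a s IH]; first by apply: pnear0.
have ha : \forall w \near z^', w != a.
  have [->|az] := eqVneq z a; first by apply: pnear0.
  apply/near_pcabs; exists (cabs (z - a)); first by rewrite cabs_gt0 subr_eq0.
  by move=> w wz _; apply: contraTneq wz => ->; rewrite cabsB ltxx.
by apply: (pnear2 ha IH) => w _ wa ws; rewrite in_cons negb_or wa ws.
Qed.
Lemma near_notin (s : seq C) z : z \notin s -> \forall w \near z, w \notin s.
Proof.
move=> zs; have /near_pcabs[d d0 hd] := pnear_notin s z.
apply/near_cabs; exists d; first exact: d0.
by move=> w wd; have [->//|wz] := eqVneq w z; exact: hd.
Qed.

Lemma min_seq (s : seq C) (F : C -> R) (x y0 : R) : x < y0 -> (forall a, a \in s -> x < F a) ->
  exists y, [/\ x < y, y <= y0 & forall a, a \in s -> y <= F a].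
Proof.
move=> xy0; elim: s => [|a s IH] h; first by exists y0.
have [|y [xy yy0 hy]] := IH; first by move=> b bs; apply: h; rewrite in_cons bs orbT.
exists (Num.min y (F a)); split.
- by rewrite lt_min xy h// mem_head.
- by rewrite ge_min yy0.
- move=> b; rewrite in_cons => /predU1P[->|bs]; rewrite ge_min ?lexx ?orbT//.
  by rewrite hy.
Qed.

Lemma finite_list (A : set C) : finite_set A -> exists2 s : seq C, uniq s & forall z, A z <-> z \in s.
Proof.
move=> /finite_seqP[s ->]; exists (undup s); first exact: undup_uniq.
by move=> z; rewrite mem_undup.
Qed.
End LogDeriv.

(** * The Poisson-Jensen formula *)

Section Blaschke.
Context {R : realType}.
Local Notation C := (CC R).
Local Notation tp := (2 * pi : R).
Implicit Types (z w a : C) (f g h : C -> C) (m n : int).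

Definition blaschke (rho : R) a z : C := rc rho * (z - a) / (rc (rho ^+ 2) - cconj a * z).

Lemma blaschke_den (rho : R) a z : cabs a * cabs z < rho ^+ 2 -> rc (rho ^+ 2) - cconj a * z != 0.
Proof.
move=> h; rewrite subr_eq0; apply: contraTneq h => /(congr1 (@cabs R)).
by rewrite cabs_rc ger0_norm ?sqr_ge0// cabsM cabs_conj => <-; rewrite ltxx.
Qed.
Lemma den_hol (rho : R) a z : holomorphic_at (fun z => rc (rho ^+ 2) - cconj a * z) z.
Proof.
apply/near_cabs; exists 1; first exact: ltr01.
move=> w _; exact: cderV (cder_B (cder_cst _ w) (cder_Z (cconj a) (cder_id w))).
Qed.
Lemma blaschke_order (rho : R) a z : 0 < rho -> cabs a * cabs z < rho ^+ 2 ->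
  has_order (blaschke rho a) z (if z == a then 1 else 0).
Proof.
move=> r0 h; have rn : rc rho != 0 by rewrite rc_eq0 lt0r_neq0.
have := order_M (order_M (order_cst z rn) (order_sub a z))
  (order_V (order_eq0 (den_hol rho a z) (blaschke_den h))).
by rewrite add0r oppr0 addr0.
Qed.
Lemma blaschke_dl (rho : R) a z : 0 < rho -> cabs a * cabs z < rho ^+ 2 -> z != a ->
  logder (blaschke rho a) z ((z - a)^-1 + cconj a / (rc (rho ^+ 2) - cconj a * z)).
Proof.
move=> r0 h za; have rn : rc rho != 0 by rewrite rc_eq0 lt0r_neq0.
have x0 : z - a != 0 by rewrite subr_eq0.
have dn := blaschke_den h; have D1 := cder_B (cder_id z) (cder_cst a z).
have D2 := cder_B (cder_cst (rc (rho ^+ 2)) z) (cder_Z (cconj a) (cder_id z)).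
split; first by rewrite !mulf_neq0// invr_eq0.
apply: (is_derive_eq (cder_M (cder_Z (rc rho) D1) (cder_V D2 dn))).
by rewrite /blaschke; field; rewrite x0 dn.
Qed.
Lemma blaschke_circle (rho : R) a z : 0 < rho -> cabs a < rho -> cabs z = rho -> cabs (blaschke rho a z) = 1.
Proof.
move=> r0 ar zr; have z0 : z != 0 by rewrite -cabs_gt0 zr.
rewrite /blaschke; have -> : rc (rho ^+ 2) - cconj a * z = z * cconj (z - a).
  by rewrite -zr -mul_cconj cconjD cconjN; ring.
rewrite cabs_div !cabsM cabs_conj cabs_rc gtr0_norm// zr divff// mulf_neq0 ?lt0r_neq0//.
by rewrite cabs_gt0 subr_eq0; apply: contraTneq ar => <-; rewrite zr ltxx.
Qed.
Lemma cabs_exprz z m : cabs (z ^ m) = cabs z ^ m.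
Proof. by case: m => k; rewrite ?NegzE -?exprnN ?cabsV ?cabsX// -exprnP cabsX. Qed.
Lemma ln_prod_exprz (s : seq C) (F : C -> C) (m : C -> int) : (forall a, a \in s -> F a != 0) ->
  ln (cabs (\prod_(a <- s) F a ^ m a)) = \sum_(a <- s) (m a)%:~R * ln (cabs (F a)).
Proof.
elim: s => [|a s IH] h; first by rewrite !big_nil cabs1 ln1.
have a0 : 0 < cabs (F a) by rewrite cabs_gt0 h// mem_head.
have hs b : b \in s -> F b != 0 by move=> bs; apply: h; rewrite in_cons bs orbT.
rewrite !big_cons cabsM lnM ?posrE; last 2 first.
- by rewrite cabs_exprz exprz_gt0.
- by rewrite cabs_gt0 prodf_seq_neq0; apply/allP => b /hs /= b0; rewrite expfz_neq0.
rewrite IH//; congr (_ + _); rewrite cabs_exprz; case: (m a) => k.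
  by rewrite -exprnP lnXn// -mulr_natl.
rewrite NegzE -exprnN lnV ?posrE ?exprn_gt0// lnXn// mulrNz mulNr.
by rewrite -mulr_natl.
Qed.

(** Dividing [f] by Blaschke factors raised to its orders leaves order 0 throughout a slightly
    larger disc. At the points of [D] the value of [G] is taken from the local expansion. *)
Lemma factor f (rho : R) : mero_nz f -> 0 < rho -> generic f rho ->
  exists (D : seq C) (G : C -> C) (rho' : R), [/\ uniq D,
    forall a, a \in D -> cabs a < rho /\ ~ regular_nz f a,
    forall z, cabs z <= rho -> z \notin D -> regular_nz f z &
    [/\ rho < rho', forall w, cabs w < rho' -> derivable G w 1 /\ G w != 0 &
    forall w, cabs w <= rho -> w \notin D ->
      f w = G w * \prod_(a <- D) blaschke rho a w ^ mero_order f a]].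
Proof.
move=> Mf r0 gf; have [S uS SP] := finite_list (bad_finite (rho + 1) Mf).
pose D := [seq a <- S | cabs a < rho].
have DP a : a \in D = (a \in S) && (cabs a < rho) by rewrite mem_filter andbC.
have uD : uniq D by rewrite filter_uniq.
(* Limits for the radius of the larger disc. For a point inside, it is the modulus of the pole rho ^
   2 / conj a of its Blaschke factor, or [rho + 1] if a = 0, where there is no such pole; an
   irregular point outside must itself be avoided. *)
pose F a := if cabs a < rho then (if a == 0 then rho + 1 else rho ^+ 2 / cabs a) else cabs a.
have r1 : rho < rho + 1 by rewrite ltrDl.
have [|rho' [rr' r'1 hF]] := @min_seq R S F rho (rho + 1) r1.
  move=> a aS; rewrite /F; case: ifPn => [ar|].
    case: ifPn => // a0; rewrite ltr_pdivlMr ?cabs_gt0// expr2 ltr_pM2l//.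
  rewrite -leNgt le_eqVlt => /predU1P[/esym ra|//].
  by have [_] := (SP a).2 aS; case; exact: gf.
have Da a w : a \in D -> cabs w < rho' -> cabs a * cabs w < rho ^+ 2.
  rewrite DP => /andP[aS ar] wr; have := hF a aS; rewrite /F ar.
  case: eqVneq => [->|a0]; first by rewrite cabs0 mul0r exprn_gt0.
  rewrite ler_pdivlMr ?cabs_gt0// => /(lt_le_trans _); apply.
  by rewrite mulrC ltr_pM2r ?cabs_gt0.
have goodD w : cabs w < rho' -> w \notin D -> regular_nz f w.
  move=> wr wD; apply: contrapT => nb; have wS : w \in S.
    by apply/SP; split => //; rewrite (le_trans (ltW wr)).
  move: wD; rewrite DP wS /= -leNgt => rw; have := hF w wS.
  by rewrite /F ltNge rw /= leNgt wr.
pose B w := \prod_(a <- D) blaschke rho a w ^ (- mero_order f a).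
pose k w := f w * B w.
have ord_k z : cabs z < rho' -> has_order k z 0.
  move=> zr; have oB : has_order B z (\sum_(a <- D) (if z == a then 1 else 0) * (- mero_order f a)).
    by apply: order_prod => a aD; apply: order_expz; apply: blaschke_order => //; exact: Da.
  have := order_M (ordP z Mf) oB.
  suff -> : \sum_(a <- D) (if z == a then 1 else 0) * - mero_order f a = - mero_order f z :> int.
    by rewrite subrr.
  have [zD|zD] := boolP (z \in D).
    rewrite (bigD1_seq z)//= eqxx mul1r big1 ?addr0// => a az.
    by rewrite eq_sym (negPf az) mul0r.
  rewrite (mero_orderE (regular_nz_order (goodD z zr zD))) oppr0.
  rewrite big_seq big1// => a aD; case: eqVneq => [za|_]; last by rewrite mul0r.
  by move: zD; rewrite za aD.
have germ z : exists g : C -> C, cabs z < rho' -> [/\ holomorphic_at g z, g z != 0 &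
    \forall w \near z^', k w = g w].
  have [zr|_] := ltP (cabs z) rho'; last by exists f.
  have [g [hg g0 e]] := ord_k z zr; exists g => _; split => //.
  by apply: (pnear1 e) => w _ ->; rewrite expr0z mul1r.
pose gm z := projT1 (cid (germ z)); have gmP z := projT2 (cid (germ z)); rewrite -/(gm _) in gmP.
pose G z := if z \in D then gm z z else k z.
have Bl0 a w : a \in D -> cabs w < rho' -> w \notin D -> blaschke rho a w != 0.
  move=> aD wr wD; apply: (blaschke_dl r0 (Da a w aD wr) _).1.
  by apply: contraNneq wD => ->.
exists D, G, rho'; split => //.
- by move=> a; rewrite DP => /andP[/SP[_ ba] ar]; split; [exact: ar|exact: ba].
- by move=> z zr zD; apply: goodD => //; exact: le_lt_trans zr rr'.
split => //; last first.
  move=> w wr wD; have wr' := le_lt_trans wr rr'.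
  rewrite /G (negPf wD) /k /B -mulrA -big_split /= big_seq big1 ?mulr1// => a aD.
  by rewrite -expfzDr ?Bl0// addNr expr0z.
move=> z zr; have [hg g0 e] := gmP z zr.
have Ge : \forall w \near z^', gm z w = G w.
  apply: (pnear2 e (pnear_notin D z)) => w wz kg wD.
  by rewrite /G (negPf wD); exact: esym kg.
have [zD|zD] := boolP (z \in D).
  have Gz : G z = gm z z by rewrite /G zD.
  split; last by rewrite Gz.
  apply: hol_der; apply: hol_eq hg; have /near_pcabs[d d0 hd] := Ge.
  apply/near_cabs; exists d; first exact: d0.
  by move=> w wd; have [->|wz] := eqVneq w z; [rewrite Gz|exact: hd].
have [hf f0] := goodD z zr zD.
have kz : has_order k z 0 := ord_k z zr.
have dB a : a \in D -> logder (fun w => blaschke rho a w ^ (- mero_order f a)) z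
    ((- mero_order f a)%:~R * ((z - a)^-1 + cconj a / (rc (rho ^+ 2) - cconj a * z))).
  move=> aD; apply: logder_expz; apply: blaschke_dl => //; first exact: Da.
  by apply: contraNneq zD => ->.
have [k0 dk] := logder_M (dlP (hol_der hf) f0) (logder_prod dB).
have kG : \forall w \near z, k w = G w.
  by apply: (near1 (near_notin zD)) => w wD; rewrite /G (negPf wD).
split; first exact: cderV (cder_near kG dk).
by rewrite /G (negPf zD).
Qed.

Section PJ.
Variables (f : C -> C) (rho : R).
Hypotheses (Mf : mero_nz f) (r0 : 0 < rho) (gf : generic f rho).
Let w t : C := rc rho * eit t.

Lemma generic_con_ln : contin 0 tp (fun t => ln (cabs (f (w t)))).
Proof.
have wr t : cabs (w t) = rho by rewrite cabsM cabs_eit mulr1 cabs_rc gtr0_norm.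
move=> t t0 t1; apply: (@continuous_comp _ _ _ (fun t => cabs (f (w t))) (@ln R)).
  apply: continuous_comp; last exact: cabs_cont.
  by apply: (contin_circle (G := f)) => // s; have [hh _] := gf (wr s); exact: hol_cont.
by apply: continuous_ln; rewrite cabs_gt0; have [_] := gf (wr t).
Qed.

(* f is a zero-free G times Blaschke factors, which have modulus 1 on the circle. *)
Lemma poisson_jensen : exists (D : seq C) (G : C -> C), [/\ uniq D,
  forall a, a \in D -> cabs a < rho /\ ~ regular_nz f a,
  forall z, cabs z <= rho -> z \notin D -> regular_nz f z &
  [/\ holomorphic_at G 0 /\ G 0 != 0, forall z, cabs z <= rho -> z \notin D ->
      f z = G z * \prod_(a <- D) blaschke rho a z ^ mero_order f a,
    ln (cabs (G 0)) = mean (fun t => ln (cabs (f (w t)))),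
    forall z, cabs z < rho -> z \notin D -> ln (cabs (f z)) =
      mean (fun t => ln (cabs (f (w t))) * poisson_ker rho z t) +
      \sum_(a <- D) (mero_order f a)%:~R * ln (cabs (blaschke rho a z)) &
    forall z, cabs z < rho -> z \notin D -> derive1 f z / f z =
      cmean (fun t => rc (2 * ln (cabs (f (w t)))) * w t * (w t - z) ^- 2) +
      \sum_(a <- D) (mero_order f a)%:~R * ((z - a)^-1 + cconj a / (rc (rho ^+ 2) - cconj a * z))]].
Proof.
have [D [G [rho' [uD Dr' goodD [rr' GP fG]]]]] := factor Mf r0 gf.
have Dr a : a \in D -> cabs a < rho by move=> /Dr'[].
have wr t : cabs (w t) = rho by rewrite cabsM cabs_eit mulr1 cabs_rc gtr0_norm.
have dG z : cabs z < rho' -> derivable G z 1 by move=> /GP[].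
have G0 z : cabs z < rho' -> G z != 0 by move=> /GP[].
have Gw t : cabs (f (w t)) = cabs (G (w t)).
  have wD : w t \notin D by apply/negP => /Dr; rewrite wr ltxx.
  rewrite fG ?wr// cabsM cabs_prod big_seq big1 ?mulr1// => a aD.
  by rewrite cabs_exprz blaschke_circle ?Dr ?wr// exp1rz.
have Da a z : a \in D -> cabs z <= rho -> cabs a * cabs z < rho ^+ 2.
  move=> aD zr; apply: (@le_lt_trans _ _ (cabs a * rho)); first by rewrite ler_wpM2l ?cabs_ge0.
  by rewrite expr2 ltr_pM2r// Dr.
have Bl0 a z : a \in D -> cabs z <= rho -> z \notin D -> blaschke rho a z != 0.
  move=> aD zr zD; apply: (blaschke_dl r0 (Da a z aD zr) _).1.
  by apply: contraNneq zD => ->.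
exists D, G; split => //; split => //.
- have z0 : cabs (0 : C) < rho' by rewrite cabs0 (lt_trans r0).
  split; last exact: G0; apply/near_cabs; exists rho'; first exact: lt_trans rr'.
  by move=> z; rewrite subr0; exact: dG.
- by rewrite (log_mean dG G0 r0 rr'); apply: mean_ext => t; rewrite Gw.
- move=> z zr zD; have zr' := ltW zr; have zr'' := lt_trans zr rr'.
  rewrite fG// cabsM lnM ?posrE ?cabs_gt0 ?G0//; last first.
    by rewrite prodf_seq_neq0; apply/allP => a aD /=; rewrite expfz_neq0// Bl0.
  rewrite ln_prod_exprz => [|a aD]; last exact: Bl0.
  rewrite (log_poisson dG G0 r0 rr' zr); congr (_ + _).
  by apply: mean_ext => t; rewrite Gw.
- move=> z zr zD; have zr' := ltW zr; have zr'' := lt_trans zr rr'.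
  have dB a : a \in D -> logder (fun w => blaschke rho a w ^ mero_order f a) z
      ((mero_order f a)%:~R * ((z - a)^-1 + cconj a / (rc (rho ^+ 2) - cconj a * z))).
    move=> aD; apply: logder_expz; apply: blaschke_dl => //; first exact: Da.
    by apply: contraNneq zD => ->.
  have H := logder_M (dlP (dG z zr'') (G0 z zr'')) (logder_prod dB).
  have E : \forall u \near z, G u * \prod_(a <- D) blaschke rho a u ^ mero_order f a = f u.
    apply: (near2 (disc_near zr) (near_notin zD)) => u ur uD'.
    by rewrite fG// ltW.
  have -> := dlE (logder_eq E H); congr (_ + _).
  by rewrite (log_derivative dG G0 r0 rr' zr); apply: cmean_ext => t; rewrite Gw.
Qed.
End PJ.
End Blaschke.

(** * Counting functions as finite sums *)

Section Counting.
Context {R : realType}.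
Local Notation C := (CC R).
Local Notation tp := (2 * pi : R).
Local Notation mu := (@lebesgue_measure R).
Implicit Types (z w a : C) (f g h : C -> C) (m n : int) (r rho x y : R).

(** What a simple pole at [a] contributes to N(rho, f): the integral of 1 / t from |a| to rho, or,
    at the origin, the separate term ln rho. *)
Definition log_weight rho a : R := if a == 0 then ln rho else ln (rho / cabs a).
Definition pos_part m : R := if 0 < m then m%:~R else 0.

Lemma pos_part_ge0 m : 0 <= pos_part m.
Proof. by rewrite /pos_part; case: ifP => // h; rewrite ler0z ltW. Qed.
Lemma pmB m : m%:~R = pos_part m - pos_part (- m).
Proof.
rewrite /pos_part oppr_gt0; case: (ltgtP 0 m) => [h|h|<-]; rewrite ?subr0 ?sub0r ?mulr0z//.
by rewrite mulrNz opprK.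
Qed.
Lemma pole_multE f z m : has_order f z m -> (pole_mult f z)%:R = pos_part (- m).
Proof.
move=> h; rewrite /pole_mult (mero_orderE h) /pos_part oppr_gt0; case: ifP => // m0.
by have -> : - m = Posz `|m|%N by lia.
Qed.
Lemma log_weight_ge0 rho a : 1 <= rho -> cabs a <= rho -> 0 <= log_weight rho a.
Proof.
move=> r1 ar; rewrite /log_weight; case: eqVneq => [_|a0]; first exact: ln_ge0.
by apply: ln_ge0; rewrite ler_pdivlMr ?cabs_gt0// mul1r.
Qed.

Lemma int_eq (A : set R) (u v : R -> R) : measurable A -> (forall t, A t -> u t = v t) ->
  mu.-integrable A (EFin \o u) -> mu.-integrable A (EFin \o v).
Proof.
move=> mA uv; apply: (@eq_integrable _ _ _ mu A mA (EFin \o u) (EFin \o v)).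
by move=> t /set_mem At /=; rewrite uv.
Qed.
Lemma int_0 (A : set R) (u : R -> R) : measurable A -> (forall t, A t -> u t = 0) ->
  mu.-integrable A (EFin \o u).
Proof.
move=> mA u0; apply: (int_eq (u := fun=> 0)) => //; first by move=> t /u0.
exact: integrable0.
Qed.

Lemma inv_piece (c rho : R) : 0 < c -> c <= rho ->
  mu.-integrable `]0, rho] (EFin \o (fun t => if c <= t then t^-1 else 0)) /\
  \int[mu]_(t in `]0, rho]) (if c <= t then t^-1 else 0) = ln (rho / c).
Proof.
move=> c0 cr.
have ci : contin c rho (fun t : R => t^-1).
  by move=> t ct _; apply: inv_continuous; rewrite lt0r_neq0// (lt_le_trans c0).
have S : `]0, rho]%classic `&` `[c, rho]%classic = `[c, rho]%classic :> set R.
  apply/seteqP; split=> [t []//|t /=]; rewrite !in_itv/= => /andP[ct tr].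
  by rewrite ct tr (lt_le_trans c0 ct).
have P t : `]0, rho]%classic t -> (if c <= t then t^-1 else 0) = ((fun t : R => t^-1) \_ `[c, rho]%classic) t.
  rewrite /= in_itv/= => /andP[t0 tr]; rewrite patchE mem_setE in_itv/= tr andbT.
  by [].
have ic := contin_integrable ci.
split.
  apply: (int_eq (u := (fun t : R => t^-1) \_ `[c, rho]%classic)) => [|t|].
  - exact: measurable_itv.
  - by move=> /P.
  - rewrite -restrict_EFin.
    apply: (integrable_restrict mu (measurable_itv `[c, rho]) (measurable_itv `]0, rho]) _).1.
    by rewrite S.
have -> : \int[mu]_(t in `]0, rho]) (if c <= t then t^-1 else 0) =
    \int[mu]_(t in `]0, rho]) ((fun t : R => t^-1) \_ `[c, rho]%classic) t.
  by apply: eq_Rintegral => t /set_mem /P.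
rewrite -Rintegral_mkcondr S -/(I c rho _).
have D t : c <= t -> t <= rho -> is_derive t 1 (@ln R) t^-1.
  by move=> ct _; apply: is_derive1_ln; exact: lt_le_trans ct.
rewrite (I_FTC cr ci D).
by rewrite ln_div// posrE (lt_le_trans c0).
Qed.

Lemma Rint_sum (s : seq C) (i : interval R) (F : C -> R -> R) (A := [set` i]) :
  (forall a, mu.-integrable A (EFin \o F a)) ->
  mu.-integrable A (EFin \o (fun t => \sum_(a <- s) F a t)) /\
  \int[mu]_(t in A) (\sum_(a <- s) F a t) = \sum_(a <- s) \int[mu]_(t in A) F a t.
Proof.
move=> iF; have mA := measurable_itv i.
 elim: s => [|a s [IH1 IH2]].
  split.
    by apply: int_0 => // t _; rewrite big_nil.
  rewrite big_nil; transitivity (\int[mu]_(t in A) (0 : R)).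
    by apply: eq_Rintegral => t _; rewrite big_nil.
  by rewrite Rintegral_cst// mul0r.
have E : (fun t => \sum_(j <- a :: s) F j t) = fun t => F a t + \sum_(j <- s) F j t.
  by apply/funext => t; rewrite big_cons.
rewrite E big_cons -IH2; split.
  have H := @integrableD _ _ _ mu A mA _ _ (iF a) IH1. apply: (@eq_integrable _ _ _ mu A mA _ _ _ H).
  by move=> t _ /=; rewrite EFinD.
exact: (@RintegralD _ _ _ mu A _ _ mA (iF a) IH1).
Qed.

(** On the range of integration the unintegrated counting function is a finite sum of steps, each of
    which integrates to a logarithm. A pole at 0 cancels in the integrand and is counted by the term
    with ln rho. *)
Lemma N_sum f rho (D : seq C) : 0 < rho -> uniq D -> (forall a, a \in D -> cabs a <= rho) ->
  (forall z, cabs z <= rho -> pole_mult f z != 0%N -> z \in D) ->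
  nevanlinna_N f rho = \sum_(a <- D) (pole_mult f a)%:R * log_weight rho a.
Proof.
move=> r0 uD Dr DP.
have nE t : t <= rho -> unint_counting f t = \sum_(a <- D) (if cabs a <= t then (pole_mult f a)%:R else 0).
  move=> tr; rewrite /unint_counting.
  rewrite (@fsbigE _ _ _ _ _ [seq a <- D | cabs a <= t]).
  - rewrite big_filter_cond -big_mkcond/=; apply: eq_bigl => a.
    by case: (boolP (cabs a <= t)) => //= h; rewrite mem_set.
  - by rewrite filter_uniq.
  - by move=> a /=; rewrite mem_filter => /andP[].
  - move=> a /= at_; rewrite mem_filter at_ /= => aD; apply/eqP; rewrite pnatr_eq0.
    apply: contraNT aD; apply: DP; exact: le_trans tr.
pose F a t : R := (pole_mult f a)%:R * (if a == 0 then 0 else if cabs a <= t then t^-1 else 0).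
have FP a : a \in D -> mu.-integrable `]0, rho] (EFin \o F a) /\
    \int[mu]_(t in `]0, rho]) F a t = (pole_mult f a)%:R * (if a == 0 then 0 else ln (rho / cabs a)).
  move=> aD; rewrite /F; case: eqVneq => [_|a0].
    split; last first.
      by rewrite !mulr0 Rintegral_cst// mul0r.
    by apply: int_0 => [|t _]; [exact: measurable_itv|rewrite ?mulr0].
  have a1 : 0 < cabs a by rewrite cabs_gt0.
  have [h1 h2] := inv_piece a1 (Dr a aD).
  split; last by rewrite RintegralZl ?h2.
  have mA := measurable_itv `]0, rho].
  have H := @integrableZl _ _ _ mu _ mA ((pole_mult f a)%:R) _ h1.
  apply: (@eq_integrable _ _ _ mu _ mA _ _ _ H).
  by move=> t _ /=; rewrite EFinM.
(* [Rint_sum] asks for integrability at every index, so the summand is set to zero off [D]. *)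
pose F' a := if a \in D then F a else fun=> 0.
have iF' a : mu.-integrable `]0, rho] (EFin \o F' a).
  rewrite /F'; case: ifP => [aD|_]; first exact: (FP a aD).1.
  by apply: int_0 => //; exact: measurable_itv.
have [_ S] := Rint_sum D iF'.
rewrite /nevanlinna_N; transitivity (\int[mu]_(t in `]0, rho]) (\sum_(a <- D) F' a t) +
   unint_counting f 0 * ln rho).
  congr (_ + _); apply: eq_Rintegral => t /set_mem /=; rewrite in_itv/= => /andP[t0 tr].
  rewrite (nE t tr) (nE 0 (ltW r0)) -sumrB mulr_suml; apply: eq_big_seq => a aD.
  rewrite /F' aD /F; case: eqVneq => [->|a0]; first by rewrite cabs0 lexx (ltW t0) subrr mul0r mulr0.
  have -> : (cabs a <= 0) = false by apply/negbTE; rewrite -ltNge cabs_gt0.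
  by case: ifP => _; rewrite subr0// ?mul0r ?mulr0.
rewrite S (nE 0 (ltW r0)) mulr_suml -big_split /=; apply: eq_big_seq => a aD.
rewrite /F' aD (FP a aD).2 /log_weight; case: eqVneq => [->|a0].
  by rewrite cabs0 lexx mulr0 add0r.
have -> : (cabs a <= 0) = false by apply/negbTE; rewrite -ltNge cabs_gt0.
by rewrite mul0r addr0.
Qed.

(** The list may contain points of order 0, so that one list serves a function and its inverse and,
    later, several functions at once. *)
Lemma N_orders f rho (D : seq C) : 0 < rho -> mero_nz f -> uniq D -> (forall a, a \in D -> cabs a <= rho) ->
  (forall z, cabs z <= rho -> z \notin D -> mero_order f z = 0) ->
  nevanlinna_N f rho = \sum_(a <- D) pos_part (- mero_order f a) * log_weight rho a /\
  nevanlinna_N (fun z => (f z)^-1) rho = \sum_(a <- D) pos_part (mero_order f a) * log_weight rho a.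
Proof.
move=> r0 Mf uD Dr D0; split; rewrite (N_sum r0 uD Dr).
- by apply: eq_bigr => a _; rewrite (pole_multE (ordP a Mf)).
- move=> z zr; apply: contraNT => /(D0 z zr) E.
  by rewrite -(eqr_nat R) (pole_multE (ordP z Mf)) E /pos_part oppr0 ltxx.
- by apply: eq_bigr => a _; rewrite (pole_multE (order_V (ordP a Mf))) opprK.
- move=> z zr; apply: contraNT => /(D0 z zr) E.
  by rewrite -(eqr_nat R) (pole_multE (order_V (ordP z Mf))) E /pos_part !oppr0 ltxx.
Qed.

Lemma N_ge0 f rho : 1 <= rho -> meromorphic f -> 0 <= nevanlinna_N f rho.
Proof.
move=> r1 /mero_dich[f0|Mf]; have r0 : 0 < rho by exact: lt_le_trans r1.
  rewrite (@N_sum f rho [::]) ?big_nil// => z zr /eqP []; rewrite /pole_mult.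
  have -> : mero_order f z = 0; last by rewrite ltxx.
  rewrite /mero_order; case: xgetP => // m _ h.
  by have := order_not0 h (f0 z).
have [S uS SP] := finite_list (bad_finite rho Mf).
have [||-> _] := N_orders r0 Mf uS.
- by move=> a /SP[].
- move=> z zr; have [gz _|bz /negP []] := pselect (regular_nz f z); last exact/SP.
  exact: mero_orderE (regular_nz_order gz).
rewrite big_seq; apply: sumr_ge0 => a /SP[ar _].
by rewrite mulr_ge0 ?pos_part_ge0// log_weight_ge0.
Qed.
End Counting.

(** * The positive part of the logarithm *)

Section LogPlus.
Context {R : realType}.
Implicit Types (x y : R).

Lemma logp_ge0 x : 0 <= logp x. Proof. by rewrite /logp le_max lexx. Qed.
Lemma ln_le_logp x : ln x <= logp x. Proof. by rewrite /logp le_max lexx orbT. Qed.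
Lemma logp0 : logp (0 : R) = 0. Proof. by rewrite /logp ln0// maxxx. Qed.
Lemma logp_mono x y : 0 <= x -> x <= y -> logp x <= logp y.
Proof.
rewrite le_eqVlt => /predU1P[<-|x0] xy; first by rewrite logp0 logp_ge0.
by rewrite /logp ge_max le_max lexx /= le_max ler_ln ?posrE ?(lt_le_trans x0)// xy orbT.
Qed.
Lemma logpM x y : 0 <= x -> 0 <= y -> logp (x * y) <= logp x + logp y.
Proof.
rewrite le_eqVlt => /predU1P[<-|x0]; first by rewrite mul0r logp0 add0r logp_ge0.
rewrite le_eqVlt => /predU1P[<-|y0]; first by rewrite mulr0 logp0 addr0 logp_ge0.
rewrite {1}/logp ge_max addr_ge0 ?logp_ge0//= lnM ?posrE// lerD ?ln_le_logp//.
Qed.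
Lemma logpD x y : 0 <= x -> 0 <= y -> logp (x + y) <= logp x + logp y + ln 2.
Proof.
move=> x0 y0; have l2 : logp 2 = ln 2 :> R by rewrite /logp max_r// ln_ge0// ler1n.
have H (u v : R) : 0 <= u -> u <= v -> logp (u + v) <= logp u + logp v + ln 2.
  move=> u0 uv; have v0 := le_trans u0 uv.
  apply: (@le_trans _ _ (logp (2 * v))); first by apply: logp_mono; lra.
  apply: (le_trans (logpM _ v0)); first by [].
  by rewrite l2; have := logp_ge0 u; lra.
have [xy|/ltW yx] := leP x y; first exact: H.
by rewrite addrC (le_trans (H y x y0 yx))//; lra.
Qed.
Lemma logpV x : 0 < x -> ln x = logp x - logp x^-1.
Proof. by move=> x0; rewrite /logp lnV ?posrE// !maxEle; do ! case: ifP; lra. Qed.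
Lemma logp_abs x : 0 < x -> `|ln x| = logp x + logp x^-1.
Proof.
move=> x0; rewrite /logp lnV ?posrE//; case: (boolP (0 <= ln x)) => h.
  by rewrite ger0_norm// max_r// max_l ?oppr_le0// addr0.
rewrite -ltNge in h; rewrite ltr0_norm// max_l ?ltW// max_r ?add0r// oppr_ge0 ltW//.
Qed.
(** In this form continuity along a circle is inherited from [ln] and the absolute value. *)
Lemma logpE x : logp x = 2^-1 * (ln x + `|ln x|).
Proof.
rewrite /logp; case: (boolP (0 <= ln x)) => h; first by rewrite ger0_norm// max_r//; lra.
by rewrite -ltNge in h; rewrite ltr0_norm// max_l ?ltW//; lra.
Qed.
Lemma logpX x n : 0 <= x -> logp (x ^+ n) = n%:R * logp x.
Proof.
rewrite le_eqVlt => /predU1P[<-|x0].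
  rewrite logp0 mulr0; case: n => [|n]; last by rewrite expr0n logp0.
  by rewrite expr0 /logp ln1 maxxx.
by rewrite /logp lnXn// -[ln x *+ n]mulr_natl maxr_pMr ?ler0n// mulr0.
Qed.
End LogPlus.

(** * Jensen's formula and the characteristic *)

Section Jensen.
Context {R : realType}.
Local Notation C := (CC R).
Local Notation tp := (2 * pi : R).
Implicit Types (z w a : C) (f g h : C -> C) (m n : int) (r rho x y : R).

Lemma contin_absu (a b : R) (u : R -> R) : contin a b u -> contin a b (fun t => `|u t|).
Proof. by move=> cv t ? ?; apply: (@continuous_comp _ _ _ u (fun x => `|x|)); [exact: cv|exact: norm_continuous]. Qed.
Lemma contin_logp f rho : 0 < rho -> generic f rho ->
  contin 0 tp (fun t => logp (cabs (f (rc rho * eit t)))).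
Proof.
move=> r0 gf; have c := generic_con_ln r0 gf.
have -> : (fun t => logp (cabs (f (rc rho * eit t)))) =
    (fun t => 2^-1 * (ln (cabs (f (rc rho * eit t))) + `|ln (cabs (f (rc rho * eit t)))|)).
  by apply/funext => t; rewrite logpE.
exact: contin_Mu (@contin_cst R R 0 tp 2^-1) (contin_Du c (contin_absu c)).
Qed.
Lemma m_E f rho : nevanlinna_m f rho = mean (fun t => logp (cabs (f (rc rho * eit t)))).
Proof. by rewrite /nevanlinna_m /mean; congr (_ * _); apply: eq_Rintegral => t _; rewrite circle_ptE. Qed.
Lemma regular_nz_V f z : regular_nz f z -> regular_nz (fun w => (f w)^-1) z.
Proof. by move=> [h f0]; split; [exact: hol_V|rewrite invr_eq0]. Qed.
Lemma generic_V f r : generic f r -> generic (fun w => (f w)^-1) r.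
Proof. by move=> h z /h/regular_nz_V. Qed.
Lemma generic_cabs_gt0 f rho t : 0 < rho -> generic f rho -> 0 < cabs (f (rc rho * eit t)).
Proof.
move=> r0 gf; rewrite cabs_gt0.
by have [] : regular_nz f (rc rho * eit t) by apply: gf; rewrite cabsM cabs_eit mulr1 cabs_rc gtr0_norm.
Qed.
Lemma m_ge0 f rho : 0 < rho -> generic f rho -> 0 <= nevanlinna_m f rho.
Proof.
move=> r0 gf; rewrite m_E -[leLHS](@mean_cst R 0).
by apply: mean_le; [exact: contin_cst|exact: contin_logp|move=> t; exact: logp_ge0].
Qed.
Lemma mean_ln f rho : 0 < rho -> generic f rho ->
  mean (fun t => ln (cabs (f (rc rho * eit t)))) =
  nevanlinna_m f rho - nevanlinna_m (fun z => (f z)^-1) rho.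
Proof.
move=> r0 gf; rewrite !m_E; have c1 := contin_logp r0 gf; have c2 := contin_logp r0 (generic_V gf).
rewrite -(meanN c2) -(meanD c1 (conNu c2)); apply: mean_ext => t.
by rewrite logpV ?generic_cabs_gt0// cabsV.
Qed.

(* The orders of f in the disc, together with the circle mean of ln |f|,
   determine the leading coefficient of f at 0, which does not depend on rho. *)
Lemma jensen f : mero_nz f -> exists K : R, forall rho, 0 < rho -> generic f rho ->
  nevanlinna_m f rho - nevanlinna_m (fun z => (f z)^-1) rho =
  K + nevanlinna_N (fun z => (f z)^-1) rho - nevanlinna_N f rho.
Proof.
move=> Mf; have H0 := ordP 0 Mf; set m0 := mero_order f 0 in H0.
have [k [hk k0 fk]] := H0; exists (ln (cabs (k 0))) => rho r0 gf.
have [D [G [uD Dr gD [[hG G0] fG lnG _ _]]]] := poisson_jensen Mf r0 gf.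
have D0 z : cabs z <= rho -> z \notin D -> mero_order f z = 0.
  by move=> zr zD; apply: mero_orderE (regular_nz_order (gD z zr zD)).
have [-> ->] := N_orders r0 Mf uD (fun a aD => ltW (Dr a aD).1) D0.
rewrite -(mean_ln r0 gf) -lnG -addrA -sumrB.
have -> : \sum_(a <- D) (pos_part (mero_order f a) * log_weight rho a - pos_part (- mero_order f a) * log_weight rho a) =
   \sum_(a <- D) (mero_order f a)%:~R * log_weight rho a.
  by apply: eq_bigr => a _; rewrite -mulrBl -pmB.
(* The Blaschke factor at the origin is z / rho; its z is absorbed by the power of z that is divided
   out of [f] to give [k]. The product that remains is continuous at 0, so [k 0] can be read off
   there. *)
pose b a z : C := if a == 0 then rc rho^-1 else blaschke rho a z.
have dlb a : a \in D -> exists l, logder (fun z => b a z ^ mero_order f a) 0 l.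
  move=> aD; rewrite /b; case: eqVneq => [_|a0].
    exists ((mero_order f a)%:~R * 0); apply: (logder_expz (g := fun=> rc rho^-1)).
    split; first by rewrite rc_eq0 invr_eq0 lt0r_neq0.
    by apply: (is_derive_eq (cder_cst _ _)); rewrite mulr0.
  eexists; apply: logder_expz; apply: blaschke_dl => //; last by rewrite eq_sym.
  by rewrite cabs0 mulr0 exprn_gt0.
have b0 z : b 0 z = rc rho^-1 by rewrite /b (eqxx (0 : C)).
pose k2 z := G z * \prod_(a <- D) b a z ^ mero_order f a.
have ck2 : {for 0, continuous k2}.
  pose L a := if pselect (a \in D) is left aD then projT1 (cid (dlb a aD)) else 0.
  have dL a : a \in D -> logder (fun z => b a z ^ mero_order f a) 0 (L a).
    by move=> aD; rewrite /L; case: pselect => // aD'; exact: (projT2 (cid (dlb a aD'))).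
  have [_ d] := logder_M (dlP (hol_der hG) G0) (logder_prod dL).
  exact: is_derive_ccont d.
have E : k 0 = k2 0.
  apply: (ccont_eq (hol_cont hk) ck2).
  have z0 : cabs (0 : C) < rho by rewrite cabs0.
  apply: (pnear2 fk (pnear2 (pnear_notin D 0) (pnear_near (disc_near z0)) (T := fun z => z \notin D /\ cabs z < rho) _)) => [z zn zD zr //|].
  move=> z zn0 fz [zD zr]; have zm : z ^ m0 != 0 by rewrite expfz_neq0.
  apply: (mulfI zm); rewrite subr0 in fz; rewrite -fz fG ?(ltW zr)// /k2 mulrCA; congr (_ * _).
  have [zDD|zDD] := boolP ((0 : C) \in D).
    rewrite (bigD1_seq 0 zDD uD) [in RHS](bigD1_seq 0 zDD uD) /= mulrA.
    have -> : z ^ m0 * b 0 z ^ mero_order f 0 = blaschke rho 0 z ^ mero_order f 0.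
      rewrite b0 -/m0 -expfzMl; congr (_ ^ _).
      rewrite /blaschke subr0; have -> : cconj (0 : C) = 0 by apply: ceqP; rewrite /cconj /cRe /cIm /= ?oppr0.
      rewrite mul0r subr0 expr2 rcM rcV; field; rewrite rc_eq0 lt0r_neq0//.
    by congr (_ * _); apply: eq_bigr => a a0; rewrite /b (negPf a0).
  have -> : m0 = 0 by apply: D0 zDD; rewrite cabs0 ltW.
  rewrite expr0z mul1r; apply: eq_big_seq => a aD; rewrite /b.
  case: (eqVneq a 0) => [a0|_]; last exact: erefl.
  by move: zDD; rewrite -a0 aD.
rewrite E /k2 cabsM lnM ?posrE ?cabs_gt0//; last first.
  rewrite prodf_seq_neq0; apply/allP => a aD /=.
  by have [l [h _]] := dlb a aD.
have bn a : a \in D -> b a 0 != 0.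
  move=> aD; rewrite /b; case: (eqVneq a 0) => [_|a0]; first by rewrite rc_eq0 invr_eq0 lt0r_neq0.
  apply: (blaschke_dl r0 _ _).1; last by rewrite eq_sym.
  by rewrite cabs0 mulr0 exprn_gt0.
rewrite (ln_prod_exprz (F := fun a => b a 0))// -addrA -big_split /= big_seq big1 ?addr0// => a aD.
rewrite -mulrDr; apply/eqP; rewrite mulf_eq0; apply/orP; right; apply/eqP.
rewrite /b /log_weight; case: (eqVneq a 0) => [_|a0].
  by rewrite cabs_rc ger0_norm ?invr_ge0 ?ltW// lnV ?posrE// addrC subrr.
rewrite /blaschke mulr0 subr0 sub0r cabs_div cabsM cabsN !cabs_rc !ger0_norm ?sqr_ge0 ?ltW//.
have a1 : 0 < cabs a by rewrite cabs_gt0.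
rewrite -lnM ?posrE ?divr_gt0 ?mulr_gt0 ?exprn_gt0//.
rewrite (_ : _ * _ = 1) ?ln1//; field.
by rewrite (lt0r_neq0 r0) (lt0r_neq0 a1).
Qed.

Lemma T_inv f : mero_nz f -> exists K : R, forall rho, 0 < rho -> generic f rho ->
  nevanlinna_T f rho = nevanlinna_T (fun z => (f z)^-1) rho + K.
Proof.
move=> /jensen[K HK]; exists K => rho r0 gf; have := HK rho r0 gf.
by rewrite /nevanlinna_T; lra.
Qed.

Lemma T_ge0 f rho : 1 <= rho -> mero_nz f -> generic f rho -> 0 <= nevanlinna_T f rho.
Proof.
move=> r1 Mf gf; rewrite /nevanlinna_T addr_ge0 ?m_ge0 ?N_ge0//; first exact: lt_le_trans r1.
exact: mero_nz_mero.
Qed.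

(** If |a| > r, then z - a is zero-free in a larger disc. If |a| < r, it is replaced by r ^ 2 - conj
    a z, which is zero-free in a larger disc and has r times its modulus on the circle. *)
Lemma mean_ln_sub r a : 0 < r -> cabs a != r ->
  mean (fun s => ln (cabs (rc r * eit s - a))) = ln (Num.max r (cabs a)) /\
  contin 0 tp (fun s => ln (cabs (rc r * eit s - a))).
Proof.
move=> r0 ar; have rr s : cabs (rc r * eit s : C) = r.
  by rewrite cabsM cabs_eit mulr1 cabs_rc gtr0_norm.
split; last first.
  apply: (@generic_con_ln R (fun z => z - a) r r0) => z zr; split; first exact: hol_sub.
  by rewrite subr_eq0; apply: contra_neqN ar => /eqP <-.
have [ra|ra] := ltP r (cabs a).
  have dg w : cabs w < cabs a -> derivable (fun z => z - a) w 1.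
    by move=> _; exact: cderV (cder_B (cder_id w) (cder_cst a w)).
  have g0 w : cabs w < cabs a -> w - a != 0.
    by move=> wa; rewrite subr_eq0; apply: contraTneq wa => ->; rewrite ltxx.
  by rewrite -(log_mean dg g0 r0 ra) sub0r cabsN.
have {ra ar} ra : cabs a < r by rewrite lt_neqAle ar ra.
have den w : cabs a * cabs w < r ^+ 2 -> rc (r ^+ 2) - cconj a * w != 0 by exact: blaschke_den.
pose r' := if cabs a == 0 then r + 1 else r ^+ 2 / cabs a.
have rr' : r < r'.
  rewrite /r'; case: eqVneq => [_|a0]; first by rewrite ltrDl.
  have a1 : 0 < cabs a by rewrite lt0r a0 cabs_ge0.
  by rewrite ltr_pdivlMr// expr2 ltr_pM2l.
have ar' w : cabs w < r' -> cabs a * cabs w < r ^+ 2.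
  rewrite /r'; case: eqVneq => [->|a0]; first by rewrite mul0r exprn_gt0.
  have a1 : 0 < cabs a by rewrite lt0r a0 cabs_ge0.
  by rewrite ltr_pdivlMr// mulrC.
have dg w : cabs w < r' -> derivable (fun z => rc (r ^+ 2) - cconj a * z) w 1.
  by move=> _; exact: cderV (cder_B (cder_cst _ w) (cder_Z (cconj a) (cder_id w))).
have L := log_mean dg (fun w wr => den w (ar' w wr)) r0 rr'.
have cl := contin_lg dg (fun w wr => den w (ar' w wr)) r0 rr'.
have E s : ln (cabs (rc r * eit s - a)) = ln (cabs (rc (r ^+ 2) - cconj a * (rc r * eit s))) + - ln r.
  have -> : rc (r ^+ 2) - cconj a * (rc r * eit s) = rc r * eit s * cconj (rc r * eit s - a).
    have -> : rc (r ^+ 2) = rc r * eit s * cconj (rc r * eit s) by rewrite mul_cconj rr.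
    by rewrite cconjD cconjN; ring.
  rewrite cabsM rr cabs_conj lnM ?posrE//; first by lra.
  rewrite cabs_gt0 subr_eq0; apply: contraTneq ra => <-; by rewrite rr ltxx.
rewrite (mean_ext E) (meanD cl (@contin_cst R R 0 tp (- ln r))) mean_cst -L.
rewrite mulr0 subr0 cabs_rc ger0_norm ?sqr_ge0// expr2 lnM ?posrE//; lra.
Qed.

(** The squares of the two sides differ by (rho ^ 2 - |a| ^ 2) (rho ^ 2 - |z| ^ 2). *)
Lemma blaschke_le1 rho a z : 0 < rho -> cabs a < rho -> cabs z < rho ->
  rho * cabs (z - a) <= cabs (rc (rho ^+ 2) - cconj a * z).
Proof.
move=> r0 ar zr; rewrite -(ger0_norm (cabs_ge0 (z - a))) -{1}(gtr0_norm r0) -normrM.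
rewrite -[leRHS]ger0_norm ?cabs_ge0// -ler_sqr ?nnegrE// !real_normK ?num_real//.
rewrite exprMn !cabs_sqr !cRe_D !cIm_D !cRe_N !cIm_N cRe_M cIm_M cRe_conj cIm_conj cRe_rc cIm_rc.
rewrite -subr_ge0.
have ha : cRe a ^+ 2 + cIm a ^+ 2 <= rho ^+ 2.
  by rewrite -cabs_sqr lerXn2r ?nnegrE ?cabs_ge0 ?ltW.
have hz : cRe z ^+ 2 + cIm z ^+ 2 <= rho ^+ 2.
  by rewrite -cabs_sqr lerXn2r ?nnegrE ?cabs_ge0 ?ltW.
have -> : (rho ^+ 2 - (cRe a * cRe z - - cIm a * cIm z)) ^+ 2 + (0 - (cRe a * cIm z + - cIm a * cRe z)) ^+ 2 -
    rho ^+ 2 * ((cRe z - cRe a) ^+ 2 + (cIm z - cIm a) ^+ 2) =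
   (rho ^+ 2 - (cRe a ^+ 2 + cIm a ^+ 2)) * (rho ^+ 2 - (cRe z ^+ 2 + cIm z ^+ 2)) by ring.
by rewrite mulr_ge0// subr_ge0.
Qed.

(** The Poisson-Jensen formula with the zeros discarded: Blaschke factors have modulus at most 1 in
    the disc, so zeros lower ln |f|, while each pole raises it by a multiple of Green's function.
    Both terms on the right are nonnegative, which lets the bound pass from [ln] to [logp]. *)
Lemma logp_poisson f rho : mero_nz f -> 0 < rho -> generic f rho ->
  exists D : seq C, [/\ uniq D, forall a, a \in D -> cabs a < rho /\ ~ regular_nz f a,
   forall z, cabs z <= rho -> z \notin D -> regular_nz f z &
   forall z, cabs z < rho -> z \notin D -> logp (cabs (f z)) <=
      mean (fun t => logp (cabs (f (rc rho * eit t))) * poisson_ker rho z t) +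
      \sum_(a <- D) pos_part (- mero_order f a) *
        (ln (cabs (rc (rho ^+ 2) - cconj a * z)) - ln rho - ln (cabs (z - a)))].
Proof.
move=> Mf r0 gf; have [D [G [uD Dr gD [_ _ _ PJ _]]]] := poisson_jensen Mf r0 gf.
exists D; split => // z zr zD.
have cp := contin_PK zr; have cl := contin_logp r0 gf; have cn := generic_con_ln r0 gf.
have c1 := contin_Mu cl cp; have c2 := contin_Mu cn cp.
have g0 a : a \in D -> 0 <= ln (cabs (rc (rho ^+ 2) - cconj a * z)) - ln rho - ln (cabs (z - a)).
  move=> aD; have za : 0 < cabs (z - a) by rewrite cabs_gt0 subr_eq0; apply: contraNneq zD => ->.
  rewrite -addrA -opprD subr_ge0 -lnM ?posrE//.
  rewrite ler_ln ?posrE ?mulr_gt0// ?blaschke_le1// ?(Dr a aD).1//.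
  rewrite (lt_le_trans _ (blaschke_le1 r0 (Dr a aD).1 zr))// mulr_gt0//.
have S0 : 0 <= \sum_(a <- D) pos_part (- mero_order f a) *
        (ln (cabs (rc (rho ^+ 2) - cconj a * z)) - ln rho - ln (cabs (z - a))).
  by rewrite big_seq; apply: sumr_ge0 => a aD; rewrite mulr_ge0 ?pos_part_ge0// g0.
have M0 : 0 <= mean (fun t => logp (cabs (f (rc rho * eit t))) * poisson_ker rho z t).
  rewrite -[leLHS](@mean_cst R 0); apply: mean_le => //; first exact: contin_cst.
  by move=> t; rewrite mulr_ge0 ?logp_ge0 ?poisson_ker_ge0.
rewrite {1}/logp ge_max addr_ge0//= PJ//; apply: lerD.
  by apply: mean_le => // t; rewrite ler_wpM2r ?poisson_ker_ge0 ?ln_le_logp.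
rewrite big_seq [leRHS]big_seq; apply: ler_sum => a aD.
have za : 0 < cabs (z - a) by rewrite cabs_gt0 subr_eq0; apply: contraNneq zD => ->.
have dz : 0 < cabs (rc (rho ^+ 2) - cconj a * z).
  rewrite (lt_le_trans _ (blaschke_le1 r0 (Dr a aD).1 zr))// mulr_gt0//.
have -> : ln (cabs (blaschke rho a z)) =
    - (ln (cabs (rc (rho ^+ 2) - cconj a * z)) - ln rho - ln (cabs (z - a))).
  rewrite /blaschke cabs_div cabsM cabs_rc gtr0_norm// ln_div ?posrE ?mulr_gt0// lnM ?posrE//; ring.
rewrite pmB mulrN mulrBl; have := mulr_ge0 (pos_part_ge0 (R := R) (mero_order f a)) (g0 a aD); lra.
Qed.

(** Average [logp_poisson] over |z| = r. The Poisson integral averages to m(rho, f), and the term of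
    a simple pole [a] to ln rho - ln max(r, |a|), which is exactly the growth of its contribution to
    N between r and rho. *)
Lemma T_mono f r rho : mero_nz f -> 0 < r -> r < rho -> generic f r -> generic f rho ->
  nevanlinna_T f r <= nevanlinna_T f rho.
Proof.
move=> Mf r0 rr gr gf; have rho0 := lt_trans r0 rr.
have [D [uD Dr gD LP]] := logp_poisson Mf rho0 gf.
have sr s : cabs (rc r * eit s : C) = r by rewrite cabsM cabs_eit mulr1 cabs_rc gtr0_norm.
have aner a : a \in D -> cabs a != r.
  by move=> aD; apply: contra_notN (Dr a aD).2 => /eqP; exact: gr.
have sD s : rc r * eit s \notin D by apply/negP => /aner; rewrite sr eqxx.
have cl := contin_logp rho0 gf; have [cP mP] := poisson_mean r0 rr cl.
pose k a s := ln (cabs (rc (rho ^+ 2) - cconj a * (rc r * eit s))) - ln rho - ln (cabs (rc r * eit s - a)).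
have kP a : a \in D -> contin 0 tp (k a) /\ mean (k a) = ln rho - ln (Num.max r (cabs a)).
  move=> aD; have [ar _] := Dr a aD.
  have den w : cabs w < rho -> rc (rho ^+ 2) - cconj a * w != 0.
    by move=> wr; apply: blaschke_den; rewrite expr2; apply: ltr_pM; rewrite ?cabs_ge0.
  have dg w : cabs w < rho -> derivable (fun z => rc (rho ^+ 2) - cconj a * z) w 1.
    by move=> _; exact: cderV (cder_B (cder_cst _ w) (cder_Z (cconj a) (cder_id w))).
  have L := log_mean dg den r0 rr; have c1 := contin_lg dg den r0 rr.
  have [m2 c2] := mean_ln_sub r0 (aner a aD).
  have c3 := contin_Du c1 (@contin_cst R R 0 tp (- ln rho)).
  split; first exact: contin_Du c3 (conNu c2).
  rewrite /k (meanD c3 (conNu c2)) (meanD c1 (@contin_cst R R 0 tp (- ln rho))) (meanN c2) m2 mean_cst -L.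
  rewrite mulr0 subr0 cabs_rc ger0_norm ?sqr_ge0// expr2 lnM ?posrE//; lra.
pose k' a := if a \in D then k a else fun=> 0.
have ck' a : contin 0 tp (k' a) by rewrite /k'; case: ifP => [/kP[]//|_]; exact: contin_cst.
have ckm a : contin 0 tp (fun s => pos_part (- mero_order f a) * k' a s).
  exact: contin_Mu (@contin_cst R R 0 tp _) (ck' a).
have M1 : nevanlinna_m f r <= nevanlinna_m f rho +
    \sum_(a <- D) pos_part (- mero_order f a) * (ln rho - ln (Num.max r (cabs a))).
  rewrite !m_E -mP.
  have -> : \sum_(a <- D) pos_part (- mero_order f a) * (ln rho - ln (Num.max r (cabs a))) =
      mean (fun s => \sum_(a <- D) pos_part (- mero_order f a) * k' a s).
    rewrite (mean_sum D ckm); apply: eq_big_seq => a aD.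
    by rewrite (meanZ _ (ck' a)) /k' aD (kP a aD).2.
  rewrite -(meanD cP (contin_sum ckm)); apply: mean_le.
  - exact: contin_logp.
  - exact: contin_Du cP (contin_sum ckm).
  - move=> s; apply: (le_trans (LP _ _ (sD s))); first by rewrite sr.
    rewrite lerD2l le_eqVlt; apply/orP; left; apply/eqP; apply: eq_big_seq => a aD.
    by rewrite /k' aD.
have D0 z : cabs z <= rho -> z \notin D -> mero_order f z = 0.
  by move=> zr zD; apply: mero_orderE (regular_nz_order (gD z zr zD)).
have [N1 _] := N_orders rho0 Mf uD (fun a aD => ltW (Dr a aD).1) D0.
have [|||N2 _] := @N_orders R f r [seq a <- D | cabs a <= r] r0 Mf.
- by rewrite filter_uniq.
- by move=> a; rewrite mem_filter => /andP[].
- move=> z zr; rewrite mem_filter zr /= => zD; apply: D0 zD; exact: le_trans zr (ltW rr).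
rewrite /nevanlinna_T N1 N2 big_filter.
suff E : \sum_(a <- D) pos_part (- mero_order f a) * (ln rho - ln (Num.max r (cabs a))) +
   \sum_(a <- D | cabs a <= r) pos_part (- mero_order f a) * log_weight r a = \sum_(a <- D) pos_part (- mero_order f a) * log_weight rho a.
  by rewrite -E; lra.
rewrite [X in _ + X]big_mkcond -big_split /=; apply: eq_big_seq => a aD.
rewrite /log_weight; case: eqVneq => [->|a0].
  by rewrite cabs0 ltW// max_l ?ltW//; ring.
have a1 : 0 < cabs a by rewrite cabs_gt0.
rewrite !ln_div ?posrE//; case: (leP (cabs a) r) => [ar|ra]; first by ring.
by ring.
Qed.
End Jensen.

(** * Exceptional sets and Borel's growth lemma *)

Section AlmostAll.
Context {R : realType}.
Local Notation C := (CC R).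
Local Notation mu := (@lebesgue_measure R).
Implicit Types (P Q : R -> Prop) (r x y : R).

(** The quantifier behind S(r, f). Stability under finite intersection lets the conditions on a
    radius be collected before any estimate. *)
Definition most_radii P := exists (E : set R) (r0 : R), [/\ measurable E, (mu E < +oo)%E &
  forall r, r0 <= r -> ~ E r -> P r].

Lemma most_radii_imp P Q : most_radii P -> (forall r, P r -> Q r) -> most_radii Q.
Proof. by move=> [E [r0 [mE fE h]]] PQ; exists E, r0; split => // r rr nE; apply: PQ; exact: h. Qed.
Lemma most_radii_and P Q : most_radii P -> most_radii Q -> most_radii (fun r => P r /\ Q r).
Proof.
move=> [E [r0 [mE fE h]]] [F [r1 [mF fF k]]]; exists (E `|` F), (Num.max r0 r1); split.
- exact: measurableU.
- apply: (le_lt_trans (@measureU2 _ _ _ mu E F mE mF)); exact: lte_add_pinfty.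
- move=> r; rewrite ge_max => /andP[r0r r1r] nEF.
  by split; [apply: h => // Er; apply: nEF; left|apply: k => // Fr; apply: nEF; right].
Qed.
Lemma most_radii_ge x : most_radii (fun r => x <= r).
Proof. by exists set0, x; split; rewrite ?measure0//. Qed.
Lemma most_radii_all P : (forall r, P r) -> most_radii P.
Proof. by move=> h; apply: most_radii_imp (most_radii_ge 0) _ => r _; exact: h. Qed.
Lemma most_radii_imp2 P Q (T : R -> Prop) : most_radii P -> most_radii Q -> (forall r, P r -> Q r -> T r) -> most_radii T.
Proof. by move=> h k pqt; apply: most_radii_imp (most_radii_and h k) _ => r [p q]; exact: pqt. Qed.
Lemma most_radii_gen (f : C -> C) : mero_nz f -> most_radii (generic f).
Proof.
move=> /generic_ae[E [mE E0 h]]; exists E, 0; split => //; first by rewrite E0.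
by move=> r _; exact: h.
Qed.
Lemma generic_dense (f : C -> C) x y : mero_nz f -> x < y -> exists2 r, x < r < y & generic f r.
Proof.
move=> /generic_ae[E [mE E0 h]] xy; apply: contrapT => nex.
have sub : `]x, y[%classic `<=` E.
  move=> r /=; rewrite in_itv/= => xry; apply: contrapT => /h gr.
  by apply: nex; exists r.
have := @le_measure _ _ _ mu `]x, y[%classic E (mem_set (measurable_itv _)) (mem_set mE) sub.
move=> H; have {H} : (mu `]x, y[%classic <= mu E)%E := H.
rewrite E0 lebesgue_measure_itv/= lte_fin xy -EFinD lee_fin; lra.
Qed.

Lemma most_radii_of_cover P (F : nat -> set R) (r0 : R) :
  (forall n, measurable (F n)) -> (forall n, (mu (F n) <= (1 / (2 ^ n.+1)%:R)%:E)%E) ->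
  (forall r, r0 <= r -> (forall n, ~ F n r) -> P r) -> most_radii P.
Proof.
move=> mF hF h; exists (\bigcup_n F n), r0; split.
- exact: bigcupT_measurable.
- have mU : measurable (\bigcup_n F n) by exact: bigcupT_measurable.
  apply: (le_lt_trans (@measure_sigma_subadditive _ _ _ mu _ F mF mU _)); first by [].
  apply: (@le_lt_trans _ _ 1%:E); last exact: ltry.
  have := @epsilon_trick R (fun=> 0%E) 1 xpredT (fun _ => lexx _) ler01.
  rewrite [X in (_ <= X + _)%E]eseries0// add0e => /(le_trans _); apply.
  apply: lee_nneseries => [n _ _|n _]; first exact: measure_ge0.
  by rewrite add0e; exact: hF.
- by move=> r rr nU; apply: h => // n Fn; apply: nU; exists n.
Qed.

Lemma mu_cc x y : x <= y -> mu `[x, y]%classic = (y - x)%:E.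
Proof.
rewrite le_eqVlt => /predU1P[->|xy]; first by rewrite set_itv1 lebesgue_measure_set1 subrr.
by rewrite lebesgue_measure_itv/= lte_fin xy.
Qed.

(** Radii are sorted by the level 2 ^ n <= tau r < 2 ^ n.+1. If tau at least doubles from r to r + 1
    / tau r, it has left level n beyond that point, so the end [s n] of the level is at most r + 2
    ^- n. The bad radii of level n thus lie in an interval of length 2 ^- n. *)
Lemma borel_growth (tau : R -> R) : {in `[1, +oo[ &, {homo tau : x y / x <= y}} ->
  (forall r, 1 <= r -> r <= tau r) -> most_radii (fun r => tau (r + (tau r)^-1) < 2 * tau r).
Proof.
move=> mono rt.
pose A n := [set x : R | 1 <= x /\ tau x < 2 ^+ n.+1].
pose s n := sup (A n).
pose F n := `[s n - 2 ^- n, s n]%classic.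
have Abd n : has_ubound (A n).
  by exists (2 ^+ n.+1) => x [x1 /ltW tx]; exact: le_trans (rt x x1) tx.
have F2 n : (mu (F n.+1) <= (1 / (2 ^ n.+1)%:R)%:E)%E.
  rewrite mu_cc ?lee_fin; last by rewrite gerBl invr_ge0 exprn_ge0.
  by rewrite opprB addrC subrK natrX div1r.
(* For r >= 2 the level is at least 1, so the sets [F n.+1], of length 2 ^- n.+1, form the cover. *)
apply: (@most_radii_of_cover _ (fun n => F n.+1) 2).
- by move=> n; exact: measurable_itv.
- exact: F2.
move=> r r2 nF; rewrite ltNge; apply/negP => bad.
have r1 : 1 <= r by lra.
have t2 : 2 <= tau r by apply: le_trans (rt r r1).
have t0 : 0 < tau r by lra.
have [N hN] : exists N : nat, tau r < 2 ^+ N.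
  exists (Num.bound (tau r)); rewrite (lt_le_trans (archi_boundP (ltW t0)))//.
  by rewrite -natrX ler_nat ltnW// ltn_expl.
have ex : exists N, tau r < 2 ^+ N by exists N.
case: (ex_minnP ex) => m hm mmin.
have m2 : (1 < m)%N.
  rewrite ltnNge; apply/negP => m1; move: hm; rewrite ltNge => /negP; apply.
  by apply: le_trans t2; case: m m1 {mmin} => [|[|]]// _; rewrite ?expr0 ?expr1// ler1n.
case: m m2 hm mmin => [//|[//|m]] _ hm mmin.
have lo : 2 ^+ m.+1 <= tau r.
  by rewrite leNgt; apply/negP => /mmin; rewrite ltnn.
apply: (nF m); rewrite /F /= in_itv/=; apply/andP; split; last first.
  by apply: ub_le_sup; [exact: Abd|split].
have i0 : 0 <= (tau r)^-1 by rewrite invr_ge0 ltW.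
rewrite lerBlDr; apply: (@le_trans _ _ (r + (tau r)^-1)); last first.
  by rewrite lerD2l lef_pV2 ?posrE ?exprn_gt0.
apply: ge_sup; first by exists r.
move=> x [x1 tx]; rewrite leNgt; apply/negP => xr.
have := mono (r + (tau r)^-1) x; rewrite !in_itv/= !andbT x1 (ltW xr).
rewrite (le_trans r1) ?lerDl// => /(_ isT isT isT) h.
have := le_trans bad h; rewrite leNgt => /negP; apply; apply: (lt_le_trans tx).
by rewrite exprS ler_pM2l.
Qed.

(* With the points ordered by modulus, the j-th one has F >= j, whence a telescoping sum. *)
Lemma sum_rank (S : seq C) (F : C -> nat) : uniq S ->
  (forall a, a \in S -> (count (fun b => cabs b <= cabs a)%R S <= F a)%N) ->
  \sum_(a <- S) ((F a)%:R * (F a).+1%:R)^-1 <= 1 - (size S).+1%:R^-1 :> R.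
Proof.
move: {-1}(size S) (erefl (size S)) => n; elim: n S => [|n IH] S sS uS hF.
  by rewrite (size0nil sS) big_nil invr1 subrr.
have [a0 a0S] : exists a0, a0 \in S by case: S sS {uS hF} => // a S _; exists a; rewrite mem_head.
have [a aS amax] : exists2 a, a \in S & forall b, b \in S -> cabs b <= cabs a.
  elim: S a0 a0S {IH sS uS hF} => // b S IHS a0 _.
  case: S IHS => [|c S] IHS; first by exists b; rewrite ?mem_head// => d; rewrite inE => /eqP ->.
  have [a aS am] := IHS c (mem_head _ _).
  have [ab|/ltW ba] := leP (cabs a) (cabs b).
    exists b; rewrite ?mem_head// => d; rewrite inE => /predU1P[->//|/am da]; exact: le_trans ab.
  exists a; first by rewrite inE aS orbT.
  by move=> d; rewrite inE => /predU1P[->//|/am].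
have pS := perm_to_rem aS; rewrite (perm_big _ pS) big_cons.
have sr : size (rem a S) = n by rewrite size_rem// sS.
have Fa : (n.+1 <= F a)%N.
  apply: leq_trans (hF a aS); rewrite -sS.
  have : all (fun b => cabs b <= cabs a)%R S by apply/allP => b; exact: amax.
  by rewrite all_count => /eqP ->.
have hr b : b \in rem a S -> (count (fun c => cabs c <= cabs b)%R (rem a S) <= F b)%N.
  move=> bS; apply: leq_trans (hF b (mem_rem bS)).
  by rewrite (permP pS) /= leq_addl.
have {}IH := IH (rem a S) sr (rem_uniq _ uS) hr.
have n1 : 0 < n.+1%:R :> R by rewrite ltr0n.
have n2 : 0 < n.+2%:R :> R by rewrite ltr0n.
have e : ((F a)%:R * (F a).+1%:R)^-1 <= (n.+1%:R * n.+2%:R)^-1 :> R.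
  have f0 : (0 < F a)%N by exact: leq_trans Fa.
  rewrite lef_pV2 ?posrE ?mulr_gt0// ?ltr0n//.
  by apply: ler_pM; rewrite ?ler0n// ler_nat.
have -> : 1 - n.+2%:R^-1 = (n.+1%:R * n.+2%:R)^-1 + (1 - n.+1%:R^-1) :> R.
  move: n1 n2; rewrite -[n.+2%:R]natr1; move: (n.+1%:R : R) => x x0 x1; field.
  by rewrite (lt0r_neq0 x0) (lt0r_neq0 x1).
exact: lerD.
Qed.
End AlmostAll.

(** * The lemma on the logarithmic derivative *)

Section LogDerivativeLemma.
Context {R : realType}.
Local Notation C := (CC R).
Local Notation tp := (2 * pi : R).
Local Notation mu := (@lebesgue_measure R).
Implicit Types (z w a b : C) (f : C -> C) (r rho x y : R).

Lemma order_list f x : mero_nz f -> exists s : seq C, uniq s /\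
  forall z, z \in s <-> cabs z <= x /\ mero_order f z != 0.
Proof.
move=> Mf; have fs : finite_set [set z : C | cabs z <= x /\ mero_order f z != 0].
  apply: sub_finite_set (bad_finite x Mf) => z [zx oz]; split => // gz; move/eqP: oz; apply.
  exact: mero_orderE (regular_nz_order gz).
have [s us sP] := finite_list fs.
by exists s; split => // z; split => [/sP|zz]; last exact/sP.
Qed.

(** [F a] counts the zeros and poles of modulus at most |a|. Removing the radii within 1 / (F a (F a
    + 1)) of |a|, for every zero or pole [a], costs total length at most 2 by [sum_rank]. Tying the
    width to the rank makes 1 / |z - a|, on the remaining circles, at most quadratic in the number
    of zeros and poles of any disc about 0 that contains [a]. *)
Lemma nearby_rank f : mero_nz f -> exists F : C -> nat,
  (forall a x (D : seq C), cabs a <= x -> uniq D -> (forall b, cabs b <= x -> mero_order f b != 0 -> b \in D) ->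
    (F a <= count (fun b => mero_order f b != 0) D)%N) /\
  (forall a, mero_order f a != 0 -> (0 < F a)%N) /\
  most_radii (fun r => forall a, mero_order f a != 0 ->
    ((F a)%:R * (F a).+1%:R)^-1 < `|cabs a - r| :> R).
Proof.
move=> Mf; pose L x := projT1 (cid (order_list x Mf)).
have LP x : uniq (L x) /\ forall z, z \in L x <-> cabs z <= x /\ mero_order f z != 0.
  exact: projT2 (cid (order_list x Mf)).
clearbody L; pose F a := size (L (cabs a)); exists F; split.
  move=> a x D ax uD hD; rewrite -size_filter; apply: uniq_leq_size; first exact: (LP _).1.
  move=> b /(LP _).2 [ba ob]; rewrite mem_filter ob hD// (le_trans ba)//.
split.
  move=> a oa; have : a \in L (cabs a) by apply/(LP _).2.
  by rewrite /F; case: (L _).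
pose eta a : R := ((F a)%:R * (F a).+1%:R)^-1.
have eta0 a : 0 <= eta a by rewrite invr_ge0 mulr_ge0 ?ler0n.
pose J a := `[cabs a - eta a, cabs a + eta a]%classic : set R.
pose E k := \big[setU/set0]_(a <- L k%:R) J a.
have mE (s : seq C) : measurable (\big[setU/set0]_(a <- s) J a : set R).
  by apply: bigsetU_measurable => a _; exact: measurable_itv.
have muE (s : seq C) : (mu (\big[setU/set0]_(a <- s) J a) <= (\sum_(a <- s) 2 * eta a)%:E)%E.
  elim: s => [|a s IH]; first by rewrite !big_nil measure0.
  rewrite !big_cons; apply: (le_trans (@measureU2 _ _ _ mu (J a) _ (measurable_itv _) (mE s))).
  rewrite EFinD; apply: leeD IH.
  have le2 : cabs a - eta a <= cabs a + eta a by have := eta0 a; lra.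
  have mJ : mu (J a) = (2 * eta a)%:E.
    by rewrite /J; transitivity (cabs a + eta a - (cabs a - eta a))%:E; [exact: mu_cc|congr (_%:E); ring].
  have : (mu (J a) <= (2 * eta a)%:E)%E by rewrite mJ.
  by apply.
have E2 k : (mu (E k) <= 2%:E)%E.
  apply: (le_trans (muE _)); rewrite lee_fin -mulr_sumr -[leRHS]mulr1 ler_pM2l//.
  have [uL LL] := LP k%:R; apply: (le_trans (sum_rank uL _)); last by rewrite gerBl invr_ge0 ler0n.
  move=> a aL; rewrite -size_filter; apply: uniq_leq_size; first exact: filter_uniq.
  move=> b; rewrite mem_filter => /andP[ba /LL[_ ob]].
  by apply/(LP _).2.
have EP k r : E k r <-> exists2 a, a \in L k%:R & J a r.
  rewrite /E; elim: (L k%:R) => [|a s IH]; first by rewrite big_nil; split => // -[].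
  rewrite big_cons; split=> [[Jr|/IH[b bs Jb]]|[b]].
  - by exists a; rewrite ?mem_head.
  - by exists b; rewrite // inE bs orbT.
  - by rewrite inE => /predU1P[->|bs] Jb; [left|right; apply/IH; exists b].
exists (\bigcup_k E k), 1; split.
- by apply: bigcupT_measurable => k; exact: mE.
- have mU : measurable (\bigcup_k E k) by apply: bigcupT_measurable => k; exact: mE.
  (* The sets increase with [k] and each has measure at most 2, so the same bound holds for their
     union. *)
  have mono : {homo E : n m / (n <= m)%N >-> (n <= m)%O}.
    move=> n m nm; apply/subsetPset => r /EP[a /(LP _).2[an oa] Jr]; apply/EP; exists a => //.
    by apply/(LP _).2; split => //; rewrite (le_trans an)// ler_nat.
  have cv := @nondecreasing_cvg_mu _ _ _ mu E (fun k => mE _) mU mono.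
  apply: (@le_lt_trans _ _ 2%:E); last exact: ltry.
  rewrite -(cvg_lim _ cv)//; apply: lime_le; first exact: cvgP cv.
  by apply: nearW => k; exact: E2.
- move=> r _ nE a oa; rewrite ltNge; apply/negP => h; apply: nE.
  exists (Num.bound (cabs a)) => //; apply/EP; exists a.
    by apply/(LP _).2; split => //; rewrite ltW// archi_boundP// cabs_ge0.
  by rewrite /J /= in_itv/=; move: h; rewrite -/(eta a) distrC ler_distl.
Qed.

Lemma ln_ge1V x : 0 < x -> 1 - x^-1 <= ln x.
Proof.
move=> x0; have := @le_ln1Dx R (x^-1 - 1); rewrite ltrBrDl subrr invr_gt0 => /(_ x0).
rewrite addrC subrK lnV ?posrE//; lra.
Qed.

Lemma cmean_abs (F : R -> C) (u : R -> R) : contin 0 tp F -> contin 0 tp u ->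
  (forall t, cabs (F t) <= u t) -> cabs (cmean F) <= 2 * mean u.
Proof.
move=> cF cu Fu; have tp0 := @tpi_gt0 R.
rewrite /cmean cabsM cabs_rc ger0_norm ?invr_ge0 ?(ltW tp0)// /mean mulrCA ler_pM2l ?invr_gt0//.
by apply: cI_abs => // t _ _; exact: Fu.
Qed.

Lemma cabs_int (m : int) : cabs (m%:~R : C) = pos_part m + pos_part (- m).
Proof.
have E : (m%:~R : C) = rc m%:~R.
  case: m => n; first by rewrite -!pmulrn; exact/esym/rc_nat.
  by rewrite NegzE !mulrNz rcN; congr (- _); exact/esym/rc_nat.
rewrite E cabs_rc /pos_part oppr_gt0; have [h|h|m0] := ltgtP 0 m; rewrite ?addr0 ?add0r.
- by rewrite ger0_norm// ler0z ltW.
- by rewrite ltr0_norm ?ltrz0// mulrNz.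
- by rewrite -m0 mulr0z normr0.
Qed.

Lemma sum_sub (s t : seq C) (F : C -> R) : uniq s -> uniq t -> {subset s <= t} ->
  (forall a, a \in t -> 0 <= F a) -> \sum_(a <- s) F a <= \sum_(a <- t) F a.
Proof.
move=> us ut st F0; have -> : \sum_(a <- s) F a = \sum_(a <- t | a \in s) F a.
  rewrite -[RHS]big_filter; apply: perm_big; apply: uniq_perm; rewrite ?filter_uniq// => a.
  by rewrite mem_filter; case: (boolP (a \in s)) => //= /st ->.
rewrite [leLHS]big_mkcond /= big_seq [leRHS]big_seq; apply: ler_sum => a /F0.
by case: ifP.
Qed.

(** From ln y >= 1 - 1 / y with y = x / |a|, or y = x if a = 0. A lower bound for the weight of
    every point in a smaller disc allows points to be counted by means of N(x). *)
Lemma log_weight_lower rho x a : 1 <= rho -> rho < x -> cabs a < rho -> (x - rho) / x <= log_weight x a.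
Proof.
move=> r1 rx ar; have x0 : 0 < x by lra.
have E : (x - rho) / x = 1 - rho / x by field; exact: lt0r_neq0.
rewrite E /log_weight; case: eqVneq => [_|a0].
  apply: (le_trans _ (ln_ge1V x0)); rewrite lerD2l lerN2 -[leLHS]mul1r ler_pM2r ?invr_gt0//.
have a1 : 0 < cabs a by rewrite cabs_gt0.
apply: (le_trans _ (ln_ge1V _)); last by rewrite divr_gt0.
by rewrite lerD2l lerN2 invf_div ler_pM2r ?invr_gt0// ltW.
Qed.

(** The differentiated Poisson-Jensen formula on a circle of radius [rho] between [r] and [x]. The
    integral is controlled by m(rho, f) + m(rho, 1/f). The number [M] of zeros and poles, with
    multiplicity, is controlled by N(x, f) + N(x, 1/f), where each weighs at least (x - rho) / x.
    Each of them contributes at most M (M + 1) plus a term from its reflection in the circle, which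
    makes the bound cubic. *)
Lemma log_derivative_pointwise f : mero_nz f -> exists (F : C -> nat) (K : R), [/\ 0 <= K,
  most_radii (fun r => forall a, mero_order f a != 0 ->
    ((F a)%:R * (F a).+1%:R)^-1 < `|cabs a - r| :> R) &
  forall r x, 1 <= r -> r < x -> x <= r + 1 -> generic f r -> generic f x ->
    (forall a, mero_order f a != 0 -> ((F a)%:R * (F a).+1%:R)^-1 < `|cabs a - r| :> R) ->
    forall z, cabs z = r -> cabs (derive1 f z / f z) <=
      81 * (x / (x - r) * (2 * nevanlinna_T f x + K + 1)) ^+ 3].
Proof.
move=> Mf; have [F [FP [F0 aeF]]] := nearby_rank Mf; have [K0 HK] := T_inv Mf.
exists F, `|K0|; split => // r x r1 rx xr1 gr gx away z zr.
have r0 : 0 < r by lra.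
have x0 : 0 < x by lra.
set d := x - r; have d0 : 0 < d by rewrite /d; lra.
have d1 : d <= 1 by rewrite /d; lra.
(* The middle third: [rho] keeps distance d / 3 from both [r] and [x]. *)
have [rho /andP[rho1 rho2] grho] : exists2 rho, r + d / 3 < rho < r + 2 * d / 3 & generic f rho.
  by apply: (generic_dense Mf); lra.
have rho0 : 0 < rho by lra.
have rhor : d / 3 <= rho - r by lra.
have rrho : r < rho by lra.
have xrho : rho < x by rewrite /d in rho2; lra.
set Y := 2 * nevanlinna_T f x + `|K0| + 1.
have x1 : 1 <= x by lra.
have TV y : 0 < y -> generic f y -> nevanlinna_T (fun z => (f z)^-1) y <= nevanlinna_T f y + `|K0|.
  by move=> y0 /(HK y y0) ->; have := ler_norm (- K0); rewrite normrN; lra.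
have Tx := T_ge0 x1 Mf gx.
have [D [G [uD Dr gD [_ _ _ _ PJ]]]] := poisson_jensen Mf rho0 grho.
have zD : z \notin D by apply/negP => /Dr[_]; apply; exact: gr.
have zrho : cabs z < rho by rewrite zr.
pose q a := pos_part (R := R) (mero_order f a) + pos_part (- mero_order f a).
have q0 a : 0 <= q a by rewrite addr_ge0 ?pos_part_ge0.
pose M := \sum_(a <- D) q a.
have M0 : 0 <= M by apply: sumr_ge0.
have nzD b : cabs b <= rho -> mero_order f b != 0 -> b \in D.
  by move=> br; apply: contraNT => bD; rewrite (mero_orderE (regular_nz_order (gD b br bD))).
have MB : M <= 3 * (x / d) * Y.
  have [s us sP] := finite_list (bad_finite x Mf).
  have Ds : {subset D <= s}.
    by move=> a /Dr[ar bad]; apply/sP; split => //; exact: ltW (lt_trans ar xrho).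
  have sx a : a \in s -> cabs a <= x by move=> /sP[].
  have s0 z' : cabs z' <= x -> z' \notin s -> mero_order f z' = 0.
    move=> zx zs; apply: mero_orderE (regular_nz_order _); apply: contrapT => bz.
    by move/negP: zs; apply; apply/sP.
  have [N1 N2] := N_orders x0 Mf us sx s0.
  have NN : \sum_(a <- s) q a * log_weight x a <= 2 * nevanlinna_T f x + `|K0|.
    have -> : \sum_(a <- s) q a * log_weight x a = nevanlinna_N (fun z => (f z)^-1) x + nevanlinna_N f x.
      by rewrite N1 N2 -big_split; apply: eq_bigr => a _; rewrite /q mulrDl.
    have := TV x x0 gx; rewrite /nevanlinna_T.
    have := m_ge0 x0 gx; have := m_ge0 x0 (generic_V gx); lra.
  have : M * (d / 3 / x) <= Y - 1.
    apply: (@le_trans _ _ (\sum_(a <- D) q a * log_weight x a)).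
      rewrite mulr_suml big_seq [leRHS]big_seq; apply: ler_sum => a /Dr[ar _].
      rewrite ler_wpM2l//; apply: le_trans (log_weight_lower _ xrho ar); last by lra.
      by rewrite ler_pM2r ?invr_gt0//; rewrite /d in rho2 *; lra.
    apply: (le_trans (sum_sub uD us Ds _)); last by rewrite /Y; lra.
    by move=> a /sx ax; rewrite mulr_ge0// log_weight_ge0.
  rewrite -ler_pdivlMr ?divr_gt0// => /le_trans; apply.
  have -> : (Y - 1) / (d / 3 / x) = 3 * (x / d) * (Y - 1) by field; rewrite !lt0r_neq0.
  have xd : 0 < x / d by rewrite divr_gt0.
  have xd3 : 0 <= 3 * (x / d) by rewrite mulr_ge0 ?ler0n ?(ltW xd).
  by apply: (ler_wpM2l xd3); rewrite gerBl ler01.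
pose lg t := ln (cabs (f (rc rho * eit t))).
have clg : contin 0 tp lg := generic_con_ln rho0 grho.
pose A := cmean (fun t => rc (2 * lg t) * (rc rho * eit t) * (rc rho * eit t - z) ^- 2).
(* The constant 36 is the product of the 2 of [cmean_abs], the 2 in the integrand and the 9 from the
   inverse square of d / 3. *)
have AB : cabs A <= 36 * (x / d ^+ 2) * Y.
  have c1 : contin 0 tp (fun t => rc (2 * lg t) * (rc rho * eit t) * (rc rho * eit t - z) ^- 2).
    exact: contin_M (contin_2v (rho := rho) clg) (contin_kernel 2 zrho).
  have c2 := contin_Mu (@contin_cst R R 0 tp (2 * (rho / (rho - r) ^+ 2))) (contin_absu clg).
  apply: (le_trans (cmean_abs c1 c2 _)).
    move=> t; rewrite !cabsM cabs_eit mulr1 cabsV cabsX !cabs_rc normrM (ger0_norm (ltW rho0)).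
    rewrite [`|2|]ger0_norm//; have -> : 2 * (rho / (rho - r) ^+ 2) * `|lg t| = 2 * `|lg t| * rho * (rho - r) ^- 2 by ring.
    apply: ler_wpM2l.
      by apply: mulr_ge0 (ltW rho0); apply: mulr_ge0; [exact: ler0n|exact: normr_ge0].
    rewrite lef_pV2 ?posrE ?exprn_gt0 ?subr_gt0//.
      by rewrite lerXn2r ?nnegrE ?cabs_ge0 ?subr_ge0 ?(ltW rrho)// -zr circ_sub.
    by rewrite cabs_gt0 circ_neq.
  rewrite (meanZ _ (contin_absu clg)).
  have -> : mean (fun t => `|lg t|) = nevanlinna_m f rho + nevanlinna_m (fun z => (f z)^-1) rho.
    rewrite !m_E -(meanD (contin_logp rho0 grho) (contin_logp rho0 (generic_V grho))).
    by apply: mean_ext => t; rewrite /lg logp_abs ?generic_cabs_gt0// cabsV.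
  have mm : nevanlinna_m f rho + nevanlinna_m (fun z => (f z)^-1) rho <= Y.
    have rho_1 : 1 <= rho by lra.
    have := TV rho rho0 grho; have := T_mono Mf rho0 xrho grho gx; rewrite /Y {1 2 4}/nevanlinna_T.
    have := N_ge0 rho_1 (mero_nz_mero Mf); have := N_ge0 rho_1 (mero_nz_mero (mero_nz_V Mf)).
    rewrite /nevanlinna_T; lra.
  rewrite mulrA; apply: ler_pM => //.
  - by rewrite !mulr_ge0 ?invr_ge0 ?exprn_ge0 ?subr_ge0 ?(ltW rrho) ?(ltW rho0).
  - by rewrite addr_ge0 ?m_ge0//; exact: generic_V.
  - have -> : 36 * (x / d ^+ 2) = 2 * (2 * (x / (d / 3) ^+ 2)) by field; exact: lt0r_neq0.
    rewrite !ler_pM2l//; apply: ler_pM; rewrite ?invr_ge0 ?exprn_ge0 ?subr_ge0 ?(ltW rrho) ?(ltW rho0) ?(ltW xrho)//.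
    rewrite lef_pV2 ?posrE ?exprn_gt0 ?subr_gt0 ?divr_gt0//.
    by rewrite lerXn2r ?nnegrE ?subr_ge0 ?divr_ge0 ?(ltW d0) ?(ltW rrho).
have term a : a \in D -> cabs ((mero_order f a)%:~R * ((z - a)^-1 + cconj a / (rc (rho ^+ 2) - cconj a * z))) <=
    q a * (M * (M + 1) + 3 / d).
  move=> aD; have [ar _] := Dr a aD; rewrite cabsM cabs_int -/(q a).
  have [zo|oa] := eqVneq (mero_order f a) 0.
    by rewrite /q zo oppr0 /pos_part ltxx addr0 !mul0r.
  rewrite ler_wpM2l//; apply: (le_trans (cabsD _ _)); apply: lerD.
    (* Every zero or pole in [D] adds at least 1 to [M], so F a <= M, and 1 / |z - a| is at most F a
       (F a + 1) off the removed radii. *)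
    have FM : (F a)%:R <= M.
      have h := FP a rho D (ltW ar) uD nzD.
      apply: (@le_trans _ _ (count (fun b => mero_order f b != 0) D)%:R); first by rewrite ler_nat.
      rewrite -sum1_count natr_sum /M big_mkcond /=; apply: ler_sum => b _.
      case: ifP => // ob; rewrite /q /pos_part oppr_gt0.
      have [h0|h0|h0] := ltgtP 0 (mero_order f b); rewrite ?addr0 ?add0r.
      - by rewrite (ler_int R 1) -gtz0_ge1.
      - by rewrite (ler_int R 1) -gtz0_ge1 oppr_gt0.
      - by rewrite -h0 eqxx in ob.
    have aw := away a oa.
    have za : `|cabs a - r| <= cabs (z - a) by rewrite -zr distrC cabs_dist.
    have F1 : 0 < (F a)%:R :> R by rewrite ltr0n F0.
    have Fp : 0 < (F a)%:R * (F a).+1%:R :> R by apply: mulr_gt0 F1 _; rewrite ltr0n.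
    have Fi : 0 < ((F a)%:R * (F a).+1%:R)^-1 :> R by rewrite invr_gt0.
    have za0 : 0 < cabs (z - a) := lt_trans Fi (lt_le_trans aw za).
    apply: (@le_trans _ _ ((F a)%:R * (F a).+1%:R)).
      rewrite cabsV -[leRHS]invrK lef_pV2 ?posrE//; exact: ltW (lt_le_trans aw za).
    by apply: ler_pM; rewrite ?ler0n// -natr1 lerD2r.
  rewrite cabs_div cabs_conj.
  (* The reflected point: |a z| <= rho r keeps the denominator at least rho (rho - r). *)
  have den : rho * (rho - r) <= cabs (rc (rho ^+ 2) - cconj a * z).
    apply: le_trans (cabs_sub _ _); rewrite cabs_rc cabsM cabs_conj zr ger0_norm ?sqr_ge0//.
    have : cabs a * r <= rho * r by rewrite ler_pM2r// ltW.
    by lra.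
  have den0 : 0 < rho * (rho - r) by rewrite mulr_gt0// subr_gt0.
  apply: (@le_trans _ _ (rho / (rho * (rho - r)))).
    by apply: ler_pM; rewrite ?cabs_ge0 ?invr_ge0 ?cabs_ge0 ?(ltW ar)// lef_pV2 ?posrE// (lt_le_trans den0).
  have -> : rho / (rho * (rho - r)) = (rho - r)^-1 by field; rewrite subr_eq0 (gt_eqF rrho) lt0r_neq0.
  have -> : 3 / d = (d / 3)^-1 by field; exact: lt0r_neq0.
  by rewrite lef_pV2 ?posrE ?divr_gt0 ?subr_gt0.
rewrite (PJ z zrho zD) -/A.
apply: (le_trans (cabsD _ _)).
have SB : cabs (\sum_(a <- D) (mero_order f a)%:~R * ((z - a)^-1 + cconj a / (rc (rho ^+ 2) - cconj a * z))) <=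
    M * (M * (M + 1) + 3 / d).
  apply: (le_trans (cabs_sum _ _)); rewrite /M mulr_suml big_seq [leRHS]big_seq.
  by apply: ler_sum => a /term.
apply: (le_trans (lerD AB SB)).
set u := x / d; set X := u * Y.
have u1 : 1 <= u by rewrite /u ler_pdivlMr// mul1r; lra.
have Y1 : 1 <= Y by rewrite /Y; have := normr_ge0 K0; lra.
have X1 : 1 <= X by rewrite /X -[leLHS]mulr1; apply: ler_pM.
have X0 : 0 <= X by lra.
have uX : u <= X by rewrite /X ler_peMr//; lra.
have MX : M <= 3 * X by rewrite /X mulrA.
have XX : X <= X ^+ 2 by rewrite expr2 ler_peMr.
have XXX : X ^+ 2 <= X ^+ 3 by rewrite [X ^+ 3]exprS ler_peMl ?sqr_ge0.
have A1 : 36 * (x / d ^+ 2) * Y <= 36 * X ^+ 2.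
  rewrite -mulrA ler_pM2l//; have -> : X ^+ 2 = (x * x / d ^+ 2) * (Y * Y).
    by rewrite /X /u; field; exact: lt0r_neq0.
  have x2 : x / d ^+ 2 <= x * x / d ^+ 2.
    by rewrite ler_pM2r ?invr_gt0 ?exprn_gt0// ler_peMl// ltW.
  have y2 : Y <= Y * Y by rewrite ler_peMl//; lra.
  apply: ler_pM x2 y2; last by lra.
  by rewrite divr_ge0 ?exprn_ge0 ?(ltW d0) ?(ltW x0).
have d3 : 3 / d <= 3 * X.
  rewrite ler_pM2l//; apply: le_trans uX; rewrite /u -[leLHS]mul1r ler_pM2r ?invr_gt0//.
have B1 : M * (M * (M + 1) + 3 / d) <= 3 * X * (3 * X * (3 * X + 1) + 3 * X).
  have M3 : M + 1 <= 3 * X + 1 by rewrite lerD2r.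
  have M31 : 0 <= M + 1 := addr_ge0 M0 ler01.
  have M1 : M * (M + 1) <= 3 * X * (3 * X + 1) := ler_pM M0 M31 MX M3.
  have d4 : 0 <= 3 / d by rewrite divr_ge0 ?(ltW d0).
  exact: ler_pM M0 (addr_ge0 (mulr_ge0 M0 M31) d4) MX (lerD M1 d3).
apply: (le_trans (lerD A1 B1)).
(* The constants add up to 36 + 18 + 27 = 81, as X ^ 2 <= X ^ 3. *)
have -> : 3 * X * (3 * X * (3 * X + 1) + 3 * X) = 27 * X ^+ 3 + 18 * X ^+ 2 by ring.
by lra.
Qed.
End LogDerivativeLemma.

(** * The bound for m(r, f'/f) *)

Section LogDerivativeLemma.
Context {R : realType}.
Local Notation C := (CC R).
Local Notation tp := (2 * pi : R).
Implicit Types (z w a b : C) (f : C -> C) (r rho x y : R).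

(** Monotonicity of T(r, f) is available between generic radii only, so the supremum is taken over
    generic radii up to [r]; the value 0 keeps the set nonempty. The summand [r] of [Tsup] gives tau
    r >= r, as Borel's lemma asks, and [Tsup f r] is r + T(r, f) at generic r >= 1. *)
Definition Tset f r := [set x : R | x = 0 \/ exists y, [/\ 1 <= y, y <= r, generic f y & x = nevanlinna_T f y]].
Definition Tsup f r := r + sup (Tset f r).

Lemma Tset_ub f r y : mero_nz f -> 1 <= y -> r <= y -> generic f y -> ubound (Tset f r) (nevanlinna_T f y).
Proof.
move=> Mf y1 ry gy x [->|[y' [y1' yr gy' ->]]]; first exact: T_ge0.
have yy' : y' <= y := le_trans yr ry.
have [<-//|ne] := eqVneq y' y.
have yy : y' < y by rewrite lt_neqAle ne.
by apply: T_mono => //; lra.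
Qed.
Lemma Tset_has_ub f r : mero_nz f -> has_ubound (Tset f r).
Proof.
move=> Mf; have m1 : Num.max 1 r < Num.max 1 r + 1 by rewrite ltrDl.
have [y /andP[]] := generic_dense Mf m1; rewrite gt_max => /andP[y1 ry] _ gy.
by exists (nevanlinna_T f y); apply: Tset_ub => //; exact: ltW.
Qed.
Lemma Tset0 f r : Tset f r 0. Proof. by left. Qed.
Lemma Tsup_mono f : mero_nz f -> {in `[1, +oo[ &, {homo Tsup f : x y / x <= y}}.
Proof.
move=> Mf x y _ _ xy; apply: lerD => //; apply: ge_sup; first by exists 0; exact: Tset0.
move=> t [->|[y' [y1' yx gy' ->]]]; apply: (ub_le_sup (Tset_has_ub y Mf)); first exact: Tset0.
by right; exists y'; split => //; exact: le_trans yx xy.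
Qed.
Lemma Tsup_ge f r : mero_nz f -> r <= Tsup f r.
Proof. by move=> Mf; rewrite lerDl; apply: (ub_le_sup (Tset_has_ub r Mf)); exact: Tset0. Qed.
Lemma TsupE f r : mero_nz f -> 1 <= r -> generic f r -> Tsup f r = r + nevanlinna_T f r.
Proof.
move=> Mf r1 gr; congr (_ + _); apply/eqP; rewrite eq_le; apply/andP; split.
  by apply: ge_sup; [exists 0; exact: Tset0|exact: Tset_ub].
by apply: (ub_le_sup (Tset_has_ub r Mf)); right; exists r.
Qed.

(** Put t = r + T(r, f). Borel's lemma allows a generic x between r + 1 / (2 t) and r + 1 / t with
    T(x, f) <= 2 t. Then x / (x - r) <= 4 t ^ 2, the pointwise bound is a constant times t ^ 9, and
    its logarithm has the required size. *)
Lemma log_derivative_lemma f : mero_nz f -> mero_nz (derive1 f) -> exists2 C0 : R, 0 <= C0 &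
  most_radii (fun r => nevanlinna_m (fun z => derive1 f z / f z) r <= C0 * (1 + ln r + logp (nevanlinna_T f r))).
Proof.
move=> Mf Mf'; have [F [K [K0 aeF H]]] := log_derivative_pointwise Mf.
(* Here 81 is the constant of the pointwise bound, 4 comes from x / (x - r) <= (2 t) (2 t), and 5 +
   K from 2 T(x, f) + K + 1 <= 4 t + K t + t. *)
pose c := 81 * (4 * (5 + K)) ^+ 3.
have c0 : 0 <= c by rewrite mulr_ge0// exprn_ge0//; lra.
have l2 : 0 <= ln 2 :> R by apply: ln_ge0; lra.
have lc := logp_ge0 c.
exists (logp c + 9 * ln 2 + 9); first lra.
have Mg : mero_nz (fun z => derive1 f z / f z) := mero_nz_M Mf' (mero_nz_V Mf).
have ae := most_radii_and (most_radii_and (most_radii_gen Mf) (most_radii_gen Mg)) (most_radii_and aeF (most_radii_and (most_radii_ge 1)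
  (borel_growth (Tsup_mono Mf) (fun r _ => Tsup_ge r Mf)))).
apply: most_radii_imp ae _ => r [[gr gg] [away [r1 gro]]].
have r0 : 0 < r by lra.
have T0 := T_ge0 r1 Mf gr.
have tE := TsupE Mf r1 gr.
set t := Tsup f r in tE gro *.
have t1 : 1 <= t by lra.
have t0 : 0 < t by lra.
have rt : r <= t by lra.
have tV : 0 < t^-1 by rewrite invr_gt0.
have tV1 : t^-1 <= 1 by rewrite invf_le1.
have [x /andP[rx xr] gx] : exists2 x, r + t^-1 / 2 < x < r + t^-1 & generic f x.
  by apply: generic_dense => //; lra.
have x1 : 1 <= x by lra.
have Tx : nevanlinna_T f x <= 2 * t.
  apply: ltW; apply: le_lt_trans gro; apply: (@le_trans _ _ (Tsup f x)).
    by rewrite (TsupE Mf x1 gx); lra.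
  by apply: Tsup_mono => //; rewrite ?in_itv/= ?andbT; lra.
have Tx0 := T_ge0 x1 Mf gx.
have rx' : r < x by lra.
have xr1 : x <= r + 1 by lra.
have HX := H r x r1 rx' xr1 gr gx away.
have d0 : 0 < x - r by lra.
have dV : (x - r)^-1 <= 2 * t.
  by rewrite -[leRHS]invrK lef_pV2 ?posrE ?invr_gt0 ?mulr_gt0// invfM mulrC; lra.
have X1 : x / (x - r) * (2 * nevanlinna_T f x + K + 1) <= 4 * (5 + K) * t ^+ 3.
  have -> : 4 * (5 + K) * t ^+ 3 = (2 * t) * (2 * t) * ((5 + K) * t) by ring.
  have u1 : x / (x - r) <= (2 * t) * (2 * t) by apply: ler_pM => //; rewrite ?invr_ge0; lra.
  have u2 : 2 * nevanlinna_T f x + K + 1 <= (5 + K) * t.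
    have : K <= K * t by rewrite ler_peMr.
    by lra.
  by apply: ler_pM u1 u2; [rewrite divr_ge0//; lra|lra].
have Xn : 0 <= x / (x - r) * (2 * nevanlinna_T f x + K + 1).
  by apply: mulr_ge0; [rewrite divr_ge0//; lra|lra].
have B z : cabs z = r -> cabs (derive1 f z / f z) <= c * t ^+ 9.
  move=> zr; apply: (le_trans (HX z zr)).
  have -> : c * t ^+ 9 = 81 * (4 * (5 + K) * t ^+ 3) ^+ 3 by rewrite /c; ring.
  by rewrite ler_pM2l// lerXn2r// nnegrE// (le_trans Xn X1).
rewrite m_E; apply: (@le_trans _ _ (logp (c * t ^+ 9))).
  rewrite -[leRHS]mean_cst; apply: (mean_le (contin_logp r0 gg)).
    exact: contin_cst.
  move=> s; apply: logp_mono; first exact: cabs_ge0.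
  by apply: B; rewrite cabsM cabs_eit mulr1 cabs_rc gtr0_norm.
apply: (le_trans (logpM _ _)) => //; first by rewrite exprn_ge0// ltW.
rewrite logpX ?(ltW t0)// tE.
have := logpD (ltW r0) T0; have lr : logp r = ln r by rewrite /logp max_r// ln_ge0.
have lT := logp_ge0 (nevanlinna_T f r); have lr0 := ln_ge0 r1.
rewrite lr => h.
set L := ln r + logp (nevanlinna_T f r); have L0 : 0 <= L by rewrite addr_ge0.
have p1 : 0 <= logp c * L by rewrite mulr_ge0.
have p2 : 0 <= ln 2 * L by rewrite mulr_ge0.
have LE : L = ln r + logp (nevanlinna_T f r) by [].
have -> : 1 + ln r + logp (nevanlinna_T f r) = 1 + L by rewrite LE addrA.
rewrite -LE in h; clearbody L; clear LE.
have -> : (logp c + 9 * ln 2 + 9) * (1 + L) = logp c + 9 * (L + ln 2) + 9 + logp c * L + 9 * (ln 2 * L) by ring.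
by lra.
Qed.
End LogDerivativeLemma.

(** * Growth of transcendental functions *)

Section Growth.
Context {R : realType}.
Local Notation C := (CC R).
Local Notation tp := (2 * pi : R).
Implicit Types (z w a b : C) (f g h : C -> C) (r rho x y K : R) (s : seq C).

(** Each value is taken from the local holomorphic extension at that very point; neighbouring
    extensions agree by continuity. *)
Lemma entire_patch h : (forall z, removable h z) -> exists2 G : C -> C, (forall w, derivable G w 1) & mero_eq h G.
Proof.
move=> hx.
have hx' z : exists g : C -> C, holomorphic_at g z /\ \forall w \near z^', h w = g w.
  by have [g h1 h2] := hx z; exists g.
pose g z := projT1 (cid (hx' z)).
have gP z : holomorphic_at (g z) z /\ \forall w \near z^', h w = g z w := projT2 (cid (hx' z)).
clearbody g; pose G z := g z z.
have E z : \forall w \near z^', G w = g z w.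
  have [hz ez] := gP z.
  apply: (pnear2 (pnear_near (hol_near hz)) (pnear_near_all ez)) => w wz hw ew.
  have [hw' ew'] := gP w.
  apply: (ccont_eq (hol_cont hw') (hol_cont hw)).
  by apply: (pnear2 (pnear_near ew) ew') => u _ -> ->.
exists G; last by move=> z; apply: (pnear2 (E z) (gP z).2) => w _ -> ->.
move=> z; apply: hol_der; apply: hol_eq (gP z).1.
have /near_pcabs[d d0 hd] := E z; apply/near_cabs; exists d => // w wd.
by have [->|wz] := eqVneq w z; last exact/esym/hd.
Qed.

Lemma hol_prod (I : Type) (t : seq I) (F : I -> C -> C) z : (forall i, holomorphic_at (F i) z) ->
  holomorphic_at (fun w => \prod_(i <- t) F i w) z.
Proof.
move=> hF; elim: t => [|i t IH].
  by apply: hol_eq (hol_cst 1 z); apply: near_all => w; rewrite big_nil.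
by apply: hol_eq (hol_M (hF i) IH); apply: near_all => w; rewrite big_cons.
Qed.

(** Otherwise every list can be extended by a further point, and lists of every length exist. *)
Lemma max_list (P : C -> Prop) n : (forall s, uniq s -> (forall a, a \in s -> P a) -> (size s <= n)%N) ->
  exists2 s, uniq s & forall a, P a <-> a \in s.
Proof.
move=> H; apply: contrapT => nex.
have : forall k, exists s, [/\ uniq s, forall a, a \in s -> P a & size s = k].
  elim=> [|k [s [us sP sk]]]; first by exists [::].
  have [a Pa as_] : exists2 a, P a & a \notin s.
    apply: contrapT => na; apply: nex; exists s => // a; split; last exact: sP.
    by move=> Pa; apply: contrapT => /negP as_; apply: na; exists a.
  exists (a :: s); split; rewrite /= ?as_ ?sk//.
  by move=> b; rewrite in_cons => /predU1P[->//|/sP].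
by move=> /(_ n.+1)[s [us sP sk]]; have := H s us sP; rewrite sk ltnn.
Qed.

Lemma le_sum_cabs s a : a \in s -> cabs a <= \sum_(b <- s) cabs b.
Proof.
elim: s => // b s IH; rewrite in_cons big_cons => /predU1P[->|/IH h].
  by rewrite lerDl sumr_ge0// => c _; exact: cabs_ge0.
by apply: (le_trans h); rewrite lerDr cabs_ge0.
Qed.

(** If r is at least the square of each modulus, then r / |a| is at least the square root of r, so a
    pole weighs at least (ln r) / 2 in N(r, f), against a total of at most K ln r. *)
Lemma few_poles_of_slow_growth f K : mero_nz f -> (forall r0, exists r, [/\ r0 <= r, generic f r & nevanlinna_T f r <= K * ln r]) ->
  forall s, uniq s -> (forall a, a \in s -> mero_order f a < 0) -> (size s)%:R <= 2 * K.
Proof.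
move=> Mf H s us sP; set B := \sum_(b <- s) cabs b.
have [r [r0 gr Tr]] := H (Num.max 2 (B ^+ 2)).
have [r2 rB] : 2 <= r /\ B ^+ 2 <= r by move: r0; rewrite ge_max => /andP.
have rp : 0 < r by lra.
have lr : 0 < ln r by apply: ln_gt0; lra.
have sr a : a \in s -> cabs a ^+ 2 <= r.
  move=> as_; apply: le_trans rB; rewrite lerXn2r ?nnegrE ?cabs_ge0 ?le_sum_cabs//.
  by apply: (le_trans (cabs_ge0 a)); exact: le_sum_cabs.
have sr1 a : a \in s -> cabs a <= r.
  move=> /sr h; have [a1|a1] := leP (cabs a) 1; first by lra.
  by apply: le_trans h; rewrite expr2 ler_peMr ?cabs_ge0// ltW.
have ws a : a \in s -> ln r / 2 <= log_weight r a.
  move=> as_; rewrite /log_weight; have [_|a0] := eqVneq a 0; first by lra.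
  have a0' : 0 < cabs a by rewrite cabs_gt0.
  have : ln (cabs a ^+ 2) <= ln r by rewrite ler_ln ?posrE ?exprn_gt0// sr.
  by rewrite lnXn// ln_div ?posrE// => h; rewrite mulr2n in h; lra.
have [D [uD DP]] := order_list r Mf.
have [NE _] := N_orders rp Mf uD (fun a aD => ((DP a).1 aD).1) (fun z zr zD => 
  contrapT (fun n => negP zD ((DP z).2 (conj zr (introN eqP n))))).
have r1 : 1 <= r by lra.
have h1 : (size s)%:R * (ln r / 2) <= nevanlinna_N f r.
  rewrite NE; apply: (@le_trans _ _ (\sum_(a <- s) pos_part (- mero_order f a) * log_weight r a)).
    rewrite -sum1_size natr_sum mulr_suml big_seq [leRHS]big_seq; apply: ler_sum => a as_.
    apply: ler_pM; rewrite ?divr_ge0 ?(ltW lr)// ?ws//.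
    by rewrite /pos_part oppr_gt0 sP// (ler_int R 1) -gtz0_ge1 oppr_gt0 sP.
  apply: sum_sub => //.
    by move=> a as_; apply/DP; split; [exact: sr1|exact: ltr0_neq0 (sP a as_)].
  by move=> a /DP[ar _]; rewrite mulr_ge0 ?pos_part_ge0 ?log_weight_ge0.
have m0 := m_ge0 rp gr.
have : (size s)%:R * (ln r / 2) <= K * ln r by move: Tr; rewrite /nevanlinna_T; lra.
have -> : (size s)%:R * (ln r / 2) = (size s)%:R / 2 * ln r by ring.
by rewrite ler_pM2r//; lra.
Qed.

Lemma prod_sub_le s (n : C -> nat) w r : cabs w = r -> (forall a, a \in s -> cabs a <= r) ->
  cabs (\prod_(a <- s) (w - a) ^+ n a) <= (2 * r) ^+ (\sum_(a <- s) n a)%N.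
Proof.
move=> wr; have r0 : 0 <= r by rewrite -wr cabs_ge0.
elim: s => [|a s IH] h; first by rewrite !big_nil cabs1.
rewrite !big_cons exprD cabsM; apply: ler_pM; rewrite ?cabs_ge0//.
  rewrite cabsX lerXn2r ?nnegrE ?cabs_ge0 ?mulr_ge0//.
  by have := cabsBD w a; have := h a (mem_head _ _); rewrite wr; lra.
by apply: IH => b bs; apply: h; rewrite in_cons bs orbT.
Qed.

Lemma transcendental_growth f : mero_nz f -> transcendental f -> forall K, exists r0, forall r, r0 <= r -> generic f r ->
  K * ln r <= nevanlinna_T f r.
Proof.
move=> Mf tf K; apply: contrapT => nex; apply: tf.
have H r0 : exists r, [/\ r0 <= r, generic f r & nevanlinna_T f r <= K * ln r].
  apply: contrapT => nr; apply: nex; exists r0 => r rr gr; rewrite leNgt; apply/negP => h.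
  by apply: nr; exists r; split => //; exact: ltW.
(* The bound on the number of poles, applied to the empty list, shows that [K] is nonnegative. *)
have K0 : 0 <= K.
  have h0 a : a \in [::] -> mero_order f a < 0 by [].
  have := few_poles_of_slow_growth Mf H (s := [::]) isT h0; rewrite /=; lra.
have [s us sP] : exists2 s, uniq s & forall a, mero_order f a < 0 <-> a \in s.
  apply: (@max_list (fun a => mero_order f a < 0) (Num.bound (2 * K))) => s us sP.
  rewrite -(ler_nat R); apply: (le_trans (few_poles_of_slow_growth Mf H us sP)).
  by apply/ltW/archi_boundP; lra.
pose n a := `|mero_order f a|%N.
pose P : {poly C} := \prod_(a <- s) ('X - a%:P) ^+ n a.
have PE w : P.[w] = \prod_(a <- s) (w - a) ^+ n a.
  by rewrite horner_prod; apply: eq_bigr => a _; rewrite horner_exp hornerXsubC.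
have P0 w : w \notin s -> P.[w] != 0.
  move=> ws; rewrite PE prodf_seq_neq0; apply/allP => a as_ /=.
  by rewrite expf_neq0// subr_eq0; apply: contraNneq ws => ->.
have hP z : holomorphic_at (fun w => P.[w]) z.
  apply: hol_eq (hol_prod s (F := fun a w => (w - a) ^+ n a) _); last by move=> a; exact: hol_X (hol_sub a z).
  by apply: near_all => w; rewrite PE.
have oP z : has_order (fun w => P.[w]) z (\sum_(a <- s) (if z == a then 1 else 0) *+ n a).
  apply: has_order_eq (order_prod (F := fun a w => (w - a) ^+ n a) _).
    by apply: pnear0 => w _; rewrite PE.
  by move=> a _; exact: order_X (order_sub a z).
have hx z : removable (fun w => f w * P.[w]) z.
  apply/(order_ge0 (order_M (ordP z Mf) (oP z))).
  have s0 (t : seq C) : 0 <= \sum_(a <- t) (if z == a then 1 else 0) *+ n a :> int.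
    by apply: sumr_ge0 => a _; case: ifP => // _; rewrite ?mul0rn// mulrn_wge0.
  have [zs|zs] := boolP (z \in s).
    rewrite (bigD1_seq z)//= eqxx natz /n.
    have := (sP z).2 zs; have := sumr_ge0; set S := \sum_(_ <- _ | _) _ => _ oz.
    have S0 : 0 <= S by apply: sumr_ge0 => a _; case: ifP => // _; rewrite ?mul0rn// mulrn_wge0.
    by lia.
  rewrite addr_ge0// leNgt; apply/negP => /(sP z).1; exact/negP.
have [G dG hG] := entire_patch hx.
have hGz z : holomorphic_at G z by apply: near_all.
have MG : mero_nz G.
  apply: (mero_nz_eq hG) => z; eexists; exact: order_M (ordP z Mf) (oP z).
pose d := (\sum_(a <- s) n a)%N.
pose B := \sum_(b <- s) cabs b.
have regular_nz_G z : regular_nz f z -> regular_nz G z /\ G z = f z * P.[z].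
  move=> gz; have [hz fz] := gz.
  have zs : z \notin s.
    by apply/negP => /(sP z).2; rewrite (mero_orderE (regular_nz_order gz)).
  have e : f z * P.[z] = G z := ccont_eq (hol_cont (hol_M hz (hP z))) (hol_cont (hGz z)) (hG z).
  have Gz0 : G z != 0 by rewrite -e; exact: mulf_neq0 fz (P0 z zs).
  exact: (conj (conj (hGz z) Gz0) (esym e)).
have [p Hp] : exists p : {poly C}, forall w, G w = p.[w].
  (* The exponent: m(r, G) <= (K + 2 d) ln r, where 2 d comes from ln (2 r) <= 2 ln r for the
     polynomial factor of degree [d]. A factor 3 bounds the Poisson kernel at half the radius, and a
     factor 2 comes from ln r <= 2 ln (r / 2) for r >= 4. *)
  have [N HN] : exists N : nat, 6 * (K + 2 * d%:R) <= N%:R.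
    exists (Num.bound (6 * (K + 2 * d%:R))); apply/ltW/archi_boundP.
    by rewrite mulr_ge0// addr_ge0// mulr_ge0.
  apply: (liouville_poly (K := N)) => // X.
  have [r [r0 gr Tr]] := H (Num.max 4 (Num.max (2 * X) B)).
  have [r4 rX rB] : [/\ 4 <= r, 2 * X <= r & B <= r] by move: r0; rewrite !ge_max => /andP[? /andP[]].
  exists (r / 2); first by lra.
  move=> t; set z := rc (r / 2) * eit t.
  have zr : cabs z = r / 2 by rewrite /z cabsM cabs_eit mulr1 cabs_rc gtr0_norm//; lra.
  have rp : 0 < r by lra.
  have gG : generic G r by move=> w /gr /regular_nz_G[].
  have mG : nevanlinna_m G r <= (K + 2 * d%:R) * ln r.
    have lr2 : ln (2 * r) <= 2 * ln r.
      by rewrite [leRHS]mulr_natl -lnXn// ler_ln ?posrE ?exprn_gt0 ?mulr_gt0// expr2 ler_pM2r//; lra.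
    have Pb w : cabs w = r -> logp (cabs P.[w]) <= d%:R * ln (2 * r).
      move=> wr; rewrite PE.
      apply: (@le_trans _ _ (logp ((2 * r) ^+ d))).
        apply: logp_mono; first exact: cabs_ge0.
        exact: (prod_sub_le n wr (fun a as_ => le_trans (le_sum_cabs as_) rB)).
      rewrite logpX; last by lra.
      rewrite ler_wpM2l// /logp ge_max lexx andbT ln_ge0//; lra.
    have gf0 := contin_logp rp gr.
    have mb : nevanlinna_m G r <= nevanlinna_m f r + d%:R * ln (2 * r).
      rewrite !m_E -[X in _ + X]mean_cst -(meanD gf0 (@contin_cst R R 0 tp _)).
      apply: mean_le.
      - exact: contin_logp.
      - exact: contin_Du gf0 (@contin_cst R R 0 tp _).
      - move=> u; set w := rc r * eit u.
        have wr : cabs w = r by rewrite /w cabsM cabs_eit mulr1 cabs_rc gtr0_norm.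
        have [_ ->] := regular_nz_G w (gr w wr).
        by rewrite cabsM; apply: (le_trans (logpM (cabs_ge0 _) (cabs_ge0 _))); rewrite lerD2l; exact: Pb.
    have r1 : 1 <= r by lra.
    have N0 := N_ge0 r1 (mero_nz_mero Mf).
    have : d%:R * ln (2 * r) <= d%:R * (2 * ln r) :> R by rewrite ler_wpM2l.
    by move: Tr; rewrite /nevanlinna_T; lra.
  (* [G] has no poles, so only the Poisson integral of [logp] remains; at |z| = r / 2 the kernel is
     at most (r + r / 2) / (r - r / 2) = 3. *)
  have bz : logp (cabs (G z)) <= 3 * nevanlinna_m G r.
    have [D [uD DP gD pb]] := logp_poisson MG rp gG.
    have zr' : cabs z < r by lra.
    have [zD|zD] := boolP (z \in D).
      have [_ nb] := DP z zD; have -> : G z = 0.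
        by apply/eqP; apply: contrapT => /negP gz; apply: nb.
      by rewrite cabs0 logp0 mulr_ge0// m_ge0.
    apply: (le_trans (pb z zr' zD)); rewrite big1 ?addr0; last first.
      move=> a _; rewrite /pos_part oppr_gt0.
      have -> : (mero_order G a < 0) = false; last by rewrite mul0r.
      apply/negbTE; rewrite -leNgt; apply/(order_ge0 (ordP a MG)).
      by exists G => //; exact: pnear0.
    rewrite m_E -(meanZ 3 (contin_logp rp gG)); apply: mean_le.
    - exact: contin_Mu (contin_logp rp gG) (contin_PK zr').
    - exact: contin_Mu (@contin_cst R R 0 tp _) (contin_logp rp gG).
    - move=> u; rewrite mulrC ler_wpM2r ?logp_ge0//; apply: (le_trans (poisson_ker_le u zr')).
      by rewrite zr ler_pdivrMr; lra.
  have [->|Gz] := eqVneq (G z) 0; first by rewrite cabs0 exprn_ge0//; lra.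
  have Gz0 : 0 < cabs (G z) by rewrite cabs_gt0.
  have r20 : 0 < r / 2 by lra.
  rewrite -ler_ln ?posrE ?exprn_gt0// lnXn//.
  apply: (le_trans (ln_le_logp _)); apply: (le_trans bz).
  have lr2 : ln r <= 2 * ln (r / 2).
    rewrite [leRHS]mulr_natl -lnXn// ler_ln ?posrE ?exprn_gt0// expr2.
    have r44 : r * 4 <= r * r by rewrite ler_pM2l.
    by rewrite (_ : r / 2 * (r / 2) = r * r / 4); [rewrite ler_pdivlMr|field].
  have lr0 : 0 <= ln (r / 2) by apply: ln_ge0; lra.
  rewrite -[leRHS]mulr_natl.
  apply: (@le_trans _ _ (6 * (K + 2 * d%:R) * ln (r / 2))); last by rewrite ler_wpM2r.
  have KK : 0 <= K + 2 * d%:R by rewrite addr_ge0 ?mulr_ge0.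
  have : (K + 2 * d%:R) * ln r <= (K + 2 * d%:R) * (2 * ln (r / 2)) by rewrite ler_wpM2l.
  by lra.
exists p, P; split.
  have [w /P0] := pnear_ex (pnear_notin s 0).
  by apply: contraNneq => ->; rewrite horner0.
move=> z; apply: (pnear2 (hG z) (pnear_notin s z)) => w _ e /P0 Pw.
by rewrite -Hp -e mulfK.
Qed.
End Growth.

(** * Derivatives of transcendental functions *)

Section Polynomials.
Context {R : realType}.
Local Notation C := (CC R).
Implicit Types (z w : C) (f g h : C -> C) (p q : {poly C}).

Lemma cder_horner p z : is_derive z 1 (fun w => p.[w]) p^`().[z].
Proof.
elim/poly_ind: p => [|p c IH].
  rewrite deriv0 horner0; apply: cder_near (cder_cst 0 z).
  by apply: near_all => w; rewrite horner0.
have D := cder_D (cder_M IH (cder_id z)) (cder_cst c z).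
have E : \forall w \near z, p.[w] * w + c = (p * 'X + c%:P).[w].
  by apply: near_all => w; rewrite !hornerE.
apply: (is_derive_eq (cder_near E D)).
by rewrite derivD derivC addr0 derivM derivX mulr1 !hornerE; ring.
Qed.

Lemma antiderivative p : exists q, q^`() = p.
Proof.
exists (\poly_(i < (size p).+1) (p`_i.-1 / i%:R)); apply/polyP => i.
rewrite coef_deriv coef_poly ltnS /=; case: ltnP => ip; last by rewrite mul0rn nth_default.
by rewrite -[LHS]mulr_natr divfK// pnatr_eq0.
Qed.

Lemma derive_poly f p : meromorphic f -> mero_eq (derive1 f) (fun z => p.[z]) ->
  exists q, mero_eq f (fun z => q.[z]).
Proof.
move=> mf fp; have [q qp] := antiderivative p.
have mq : meromorphic (fun z => - q.[z]).
  apply/meroP => z; apply: hol_lmero; apply: near_all => w.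
  exact: cderV (cder_N (cder_horner q w)).
have [c hc] : exists c, mero_eq (fun z => f z + - q.[z]) (fun=> c).
  apply: derive0_const (mero_D mf mq) _ => z.
  have [f0|Mf] := mero_dich mf.
    have e : \forall w \near z^', f w + - q.[w] = - q.[w] by apply: (pnear1 (f0 z)) => w _ ->; rewrite add0r.
    have d := pnear_derive (f0 z).
    apply: (pnear2 (pnear_derive e) (pnear2 d (fp z) (fun w _ a b => etrans (esym a) b))) => w _ -> pw.
    rewrite (cderE (cder_N (cder_horner q w))) qp -pw.
    by rewrite (cderE (cder_cst 0 w)) oppr0.
  have [m hm] := Mf z; apply: (pnear2 (order_good hm) (fp z)) => w _ [hf _] fw.
  rewrite (cderE (cder_D (derivableP (hol_der hf)) (cder_N (cder_horner q w)))) qp -fw derive1E subrr //.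
exists (q + c%:P) => z; apply: (pnear1 (hc z)) => w _ <-.
by rewrite hornerD hornerC addrCA subrr addr0.
Qed.

(** Induction on the stronger fact that no derivative is a polynomial: a function whose derivative
    is a polynomial is one itself, and [f] is not even rational. *)
Lemma derive1n_MZ f i : mero_nz f -> transcendental f -> mero_nz (derive1n i f).
Proof.
move=> Mf tf; have mi j : meromorphic (derive1n j f).
  by elim: j => [|j IH]; [exact: mero_nz_mero|rewrite derive1nS; exact: mero_derive].
have np j : ~ exists p, mero_eq (derive1n j f) (fun z => p.[z]).
  elim: j => [[p fp]|j IH].
    apply: tf; exists p, 1; split; first exact: oner_neq0.
    by move=> z; apply: (pnear1 (fp z)) => w _ e; rewrite [LHS]e; rewrite hornerC divr1.
  by rewrite derive1nS => -[p fp]; apply: IH; exact: derive_poly fp.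
apply: (mero_nz_of (mi i)) => e; apply: (np i); exists 0 => z.
by apply: (pnear1 (e z)) => w _ ->; rewrite horner0.
Qed.
End Polynomials.

(** * Proximity and counting functions of sums, products and derivatives *)

Section Calculus.
Context {R : realType}.
Local Notation C := (CC R).
Local Notation tp := (2 * pi : R).
Implicit Types (z w : C) (f g h F G : C -> C) (r : R) (m n k : int).

Lemma generic_M f g r : generic f r -> generic g r -> generic (fun z => f z * g z) r.
Proof. by move=> gf gg z zr; have [h1 n1] := gf z zr; have [h2 n2] := gg z zr; split; [exact: hol_M|exact: mulf_neq0]. Qed.
Lemma m_le f g h r (c : R) : 0 < r -> generic f r -> generic g r -> generic h r ->
  (forall z, cabs z = r -> logp (cabs (f z)) <= logp (cabs (g z)) + logp (cabs (h z)) + c) ->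
  nevanlinna_m f r <= nevanlinna_m g r + nevanlinna_m h r + c.
Proof.
move=> r0 gf gg gh H.
have c1 := contin_logp r0 gg; have c2 := contin_logp r0 gh; have c3 := @contin_cst R R 0 tp c.
rewrite !m_E -(meanD c1 c2) -[X in _ + X]mean_cst -(meanD (contin_Du c1 c2) c3).
apply: (mean_le (contin_logp r0 gf) (contin_Du (contin_Du c1 c2) c3)) => t.
by apply: H; rewrite cabsM cabs_eit mulr1 cabs_rc gtr0_norm.
Qed.
Lemma m_M f g r : 0 < r -> generic f r -> generic g r ->
  nevanlinna_m (fun z => f z * g z) r <= nevanlinna_m f r + nevanlinna_m g r.
Proof.
move=> r0 gf gg; rewrite -[leRHS]addr0; apply: m_le => //; first exact: generic_M.
by move=> z _; rewrite addr0 cabsM logpM ?cabs_ge0.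
Qed.
Lemma m_D f g r : 0 < r -> generic f r -> generic g r -> generic (fun z => f z + g z) r ->
  nevanlinna_m (fun z => f z + g z) r <= nevanlinna_m f r + nevanlinna_m g r + ln 2.
Proof.
move=> r0 gf gg gfg; apply: m_le => // z _.
apply: (le_trans (logp_mono (cabs_ge0 _) (cabsD _ _))).
exact: logpD (cabs_ge0 _) (cabs_ge0 _).
Qed.

(** Multiplication by the power of w - z that makes both summands holomorphic makes the sum
    holomorphic too. *)
Lemma order_add_ge f g z m n k : has_order f z m -> has_order g z n ->
  has_order (fun w => f w + g w) z k -> (m <= k) || (n <= k).
Proof.
move=> hf hg hk; rewrite -ge_min; set l := Num.min m n.
have e := order_expz (- l) (order_sub z z); rewrite eqxx mul1r in e.
have /(order_ge0 (order_M hf e)) [f1 h1 e1] : 0 <= m + - l by rewrite subr_ge0 ge_min lexx.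
have /(order_ge0 (order_M hg e)) [g1 h2 e2] : 0 <= n + - l by rewrite subr_ge0 ge_min lexx orbT.
rewrite -subr_ge0; apply/(order_ge0 (order_M hk e)).
exists (fun w => f1 w + g1 w); first exact: hol_D.
by apply: (pnear2 e1 e2) => w _ <- <-; rewrite mulrDl.
Qed.

Lemma common_list (l : seq (int * (C -> C))) r : List.Forall (fun cF => mero_nz cF.2) l ->
  exists D : seq C, [/\ uniq D, forall a, a \in D -> cabs a <= r &
    List.Forall (fun cF => forall z, cabs z <= r -> mero_order cF.2 z != 0 -> z \in D) l].
Proof.
elim=> [|cF l' MF _ [D [uD Dr HD]]]; first by exists [::].
have [D1 [_ D1P]] := order_list r MF.
exists (undup (D1 ++ D)); split; first exact: undup_uniq.
  by move=> a; rewrite mem_undup mem_cat => /orP[/D1P[]|/Dr].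
constructor.
  by move=> z zr oz; rewrite mem_undup mem_cat (introT idP ((D1P z).2 (conj zr oz))).
apply: List.Forall_impl HD => dG hG z zr oz.
by rewrite mem_undup mem_cat (hG z zr oz) orbT.
Qed.

(** Linear inequalities between counting functions reduce to integer inequalities between pole
    multiplicities at each point, since the weights are nonnegative for r >= 1. This leaves goals
    for [lia]. *)
Lemma N_lin (l : seq (int * (C -> C))) r : 1 <= r -> List.Forall (fun cF => mero_nz cF.2) l ->
  (forall z, 0 <= \sum_(cF <- l) cF.1 * Num.max 0 (- mero_order cF.2 z)) ->
  0 <= \sum_(cF <- l) cF.1%:~R * nevanlinna_N cF.2 r.
Proof.
move=> r1 Ml H; have r0 : 0 < r by lra.
have [D [uD Dr HD]] := common_list r Ml.
have pmE m : pos_part (R := R) m = (Num.max 0 m)%:~R.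
  by rewrite /pos_part; case: (ltrP 0 m).
have -> : \sum_(cF <- l) cF.1%:~R * nevanlinna_N cF.2 r =
    \sum_(a <- D) (\sum_(cF <- l) cF.1 * Num.max 0 (- mero_order cF.2 a))%:~R * log_weight r a.
  elim: l Ml HD {H} => [|cF l IH] Ml HD.
    by rewrite big_nil big1// => a _; rewrite big_nil mul0r.
  have [MF Ml'] : mero_nz cF.2 /\ List.Forall (fun cF => mero_nz cF.2) l by inversion Ml.
  have [HF HD'] : (forall z, cabs z <= r -> mero_order cF.2 z != 0 -> z \in D) /\
    List.Forall (fun cF => forall z, cabs z <= r -> mero_order cF.2 z != 0 -> z \in D) l by inversion HD.
  have D0 z : cabs z <= r -> z \notin D -> mero_order cF.2 z = 0.
    by move=> zr zD; apply/eqP; apply: contraNT zD; exact: HF.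
  have [NE _] := N_orders r0 MF uD Dr D0.
  rewrite big_cons NE IH// mulr_sumr -big_split; apply: eq_bigr => a _ /=.
  by rewrite big_cons intrD intrM mulrDl mulrA pmE.
rewrite big_seq; apply: sumr_ge0 => a /Dr ar.
by rewrite mulr_ge0 ?ler0z// log_weight_ge0.
Qed.

Lemma N_M f g r : 1 <= r -> mero_nz f -> mero_nz g ->
  nevanlinna_N (fun z => f z * g z) r <= nevanlinna_N f r + nevanlinna_N g r.
Proof.
move=> r1 Mf Mg.
have := @N_lin [:: (1, f); (1, g); (-1, fun z => f z * g z)] r r1.
rewrite !big_cons !big_nil /= => H; suff : 0 <= nevanlinna_N f r + nevanlinna_N g r - nevanlinna_N (fun z => f z * g z) r by lra.
rewrite (_ : _ - _ = 1%:~R * nevanlinna_N f r + (1%:~R * nevanlinna_N g r + ((-1)%:~R * nevanlinna_N (fun z => f z * g z) r + 0))); last by ring.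
apply: H; first by do !constructor => //; exact: mero_nz_M.
move=> z; rewrite !big_cons !big_nil /= (mero_orderE (order_M (ordP z Mf) (ordP z Mg))); lia.
Qed.
Lemma N_D f g r : 1 <= r -> mero_nz f -> mero_nz g -> mero_nz (fun z => f z + g z) ->
  nevanlinna_N (fun z => f z + g z) r <= nevanlinna_N f r + nevanlinna_N g r.
Proof.
move=> r1 Mf Mg Mfg.
have := @N_lin [:: (1, f); (1, g); (-1, fun z => f z + g z)] r r1.
rewrite !big_cons !big_nil /= => H; suff : 0 <= nevanlinna_N f r + nevanlinna_N g r - nevanlinna_N (fun z => f z + g z) r by lra.
rewrite (_ : _ - _ = 1%:~R * nevanlinna_N f r + (1%:~R * nevanlinna_N g r + ((-1)%:~R * nevanlinna_N (fun z => f z + g z) r + 0))); last by ring.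
apply: H; first by do !constructor => //.
move=> z; rewrite !big_cons !big_nil /=.
have [k hk] := Mfg z; have := order_add_ge (ordP z Mf) (ordP z Mg) hk; rewrite (mero_orderE hk); lia.
Qed.
Lemma N_derive f r : 1 <= r -> mero_nz f -> mero_nz (derive1 f) ->
  nevanlinna_N (derive1 f) r <= 2 * nevanlinna_N f r.
Proof.
move=> r1 Mf Mf'.
have := @N_lin [:: (2, f); (-1, derive1 f)] r r1.
rewrite !big_cons !big_nil /= => H; suff : 0 <= 2 * nevanlinna_N f r - nevanlinna_N (derive1 f) r by lra.
rewrite (_ : _ - _ = 2%:~R * nevanlinna_N f r + ((-1)%:~R * nevanlinna_N (derive1 f) r + 0)); last by ring.
apply: H; first by do !constructor => //.
move=> z; rewrite !big_cons !big_nil /=.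
have of_ := ordP z Mf; have of' := ordP z Mf'.
have [f0|f0] := leP 0 (mero_order f z).
  have /(order_ge0 of')h := removable_derive ((order_ge0 of_).2 f0); lia.
rewrite (mero_orderE (order_derive of_ _)); lia.
Qed.
End Calculus.

(** * Small terms *)

Section SmallTerms.
Context {R : realType} (f : CC R -> CC R).
Local Notation C := (CC R).
Local Notation T := (nevanlinna_T f).
Local Notation mu := (@lebesgue_measure R).
Context (Mf : mero_nz f) (tf : transcendental f).
Implicit Types (z w : C) (g h F G : C -> C) (r : R) (s : R -> R).

(* One-sided form of [is_S]: it says that max(0, s) is S(r, f). *)
Definition negl s := exists E : set R, [/\ measurable E, (mu E < +oo)%E &
  forall e, 0 < e -> exists r0, forall r, r0 <= r -> ~ E r -> s r <= e * T r].
(** The functions with T(r, F) = O(T(r, f)). For them the error in the lemma on the logarithmic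
    derivative is S(r, f), and the class is stable under the operations that form M[f] and F. *)
Definition T_bounded F := mero_nz F /\ exists c : R, most_radii (fun r => nevanlinna_T F r <= c * T r).

Lemma T_ln c : most_radii (fun r => c * ln r <= T r).
Proof.
have [r0 H] := transcendental_growth Mf tf c.
by apply: most_radii_imp2 (most_radii_ge r0) (most_radii_gen Mf) _ => r; exact: H.
Qed.
Lemma T_large c : most_radii (fun r => c <= T r).
Proof.
apply: most_radii_imp2 (T_ln `|c|) (most_radii_ge (expR 1)) _ => r h re.
apply: le_trans h; apply: (le_trans (ler_norm c)); rewrite ler_peMr//.
by rewrite -[leLHS]expRK ler_ln ?posrE ?expR_gt0// (lt_le_trans (expR_gt0 1)).
Qed.
Lemma most_radii_T0 : most_radii (fun r => 0 <= T r).
Proof. exact: T_large. Qed.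

Lemma negl_AE s e : negl s -> 0 < e -> most_radii (fun r => s r <= e * T r).
Proof. by move=> [E [mE fE H]] e0; have [r0 Hr] := H e e0; exists E, r0. Qed.
Lemma negl_le s s' : most_radii (fun r => s r <= s' r) -> negl s' -> negl s.
Proof.
move=> [E [r0 [mE fE H]]] [F [mF fF K]]; exists (E `|` F); split.
- exact: measurableU.
- apply: (le_lt_trans (@measureU2 _ _ _ mu E F mE mF)); exact: lte_add_pinfty.
- move=> e e0; have [r1 Kr] := K e e0; exists (Num.max r0 r1) => r.
  rewrite ge_max => /andP[h0 h1] nEF; apply: (@le_trans _ _ (s' r)).
    by apply: H => // Er; apply: nEF; left.
  by apply: Kr => // Fr; apply: nEF; right.
Qed.
Lemma negl_D s s' : negl s -> negl s' -> negl (fun r => s r + s' r).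
Proof.
move=> [E [mE fE H]] [F [mF fF K]]; exists (E `|` F); split.
- exact: measurableU.
- apply: (le_lt_trans (@measureU2 _ _ _ mu E F mE mF)); exact: lte_add_pinfty.
- move=> e e0; have e2 : 0 < e / 2 by rewrite divr_gt0.
  have [r0 Hr] := H _ e2; have [r1 Kr] := K _ e2; exists (Num.max r0 r1) => r.
  rewrite ge_max => /andP[h0 h1] nEF; have -> : e * T r = e / 2 * T r + e / 2 * T r by field.
  by apply: lerD; [apply: Hr => // Er; apply: nEF; left|apply: Kr => // Fr; apply: nEF; right].
Qed.
Lemma negl_Z c s : 0 <= c -> negl s -> negl (fun r => c * s r).
Proof.
rewrite le_eqVlt => /predU1P[<-|c0] [E [mE fE H]].
  apply: negl_le (_ : negl (fun=> 0)); first by apply: most_radii_all => r; rewrite mul0r.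
  have [F [r0 [mF fF K]]] := most_radii_T0; exists F; split => // e e0; exists r0 => r h nF.
  by rewrite mulr_ge0 ?(ltW e0)// K.
exists E; split => // e e0; have [r0 Hr] := H (e / c) (divr_gt0 e0 c0); exists r0 => r h nE.
by have := Hr r h nE; rewrite mulrAC ler_pdivlMr// mulrC.
Qed.
Lemma negl_log : negl (fun r => 1 + ln r + logp (T r)).
Proof.
have [E [mE E0 hg]] := generic_ae Mf; exists E; split => //; first by rewrite E0.
move=> e e0; pose d := e / 3; have d0 : 0 < d by rewrite divr_gt0.
(* Since T >= K ln r, the first bound on K gives ln r <= d T, and the second, with ln r >= 1, gives
   1 + |ln d| <= d T. Moreover ln T = ln (d T) - ln d <= d T + |ln d|. Together this makes three
   portions of size d T = e T / 3. *)
pose K := Num.max d^-1 ((1 + `|ln d|) / d).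
have [r0 H] := transcendental_growth Mf tf K; exists (Num.max r0 (expR 1)) => r.
rewrite ge_max => /andP[h0 h1] nE.
have gr := hg r nE; have TK := H r h0 gr.
have rp : 0 < r := lt_le_trans (expR_gt0 1) h1.
have l1 : 1 <= ln r by rewrite -[leLHS]expRK ler_ln ?posrE ?expR_gt0.
have [K1 K2] : d^-1 <= K /\ (1 + `|ln d|) / d <= K by rewrite !le_max !lexx orbT.
have a1 : ln r <= d * T r.
  rewrite mulrC -ler_pdivrMr// mulrC; apply: le_trans TK; rewrite ler_wpM2r//; lra.
have a2 : 1 + `|ln d| <= d * T r.
  rewrite mulrC -ler_pdivrMr//; apply: (le_trans K2); apply: le_trans TK.
  by rewrite ler_peMr// (le_trans _ K1)// invr_ge0 ltW.
have T0 : 0 < T r by rewrite -(pmulr_rgt0 _ d0); lra.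
have a3 : ln (T r) <= d * T r + `|ln d|.
  have := @le_ln1Dx R (d * T r - 1); rewrite ltrBrDl subrr mulr_gt0// addrC subrK => /(_ isT).
  by rewrite lnM ?posrE//; have := ler_norm (- ln d); rewrite normrN; lra.
have a4 : logp (T r) <= d * T r + `|ln d|.
  by rewrite /logp ge_max a3 andbT; have := normr_ge0 (ln d); lra.
have -> : e * T r = d * T r + d * T r + d * T r by rewrite /d; field.
lra.
Qed.
Lemma negl_cst c : negl (fun=> c).
Proof.
apply: negl_le (negl_Z (normr_ge0 c) negl_log).
apply: most_radii_imp2 (most_radii_ge 1) most_radii_T0 _ => r r1 _; apply: (le_trans (ler_norm c)).
by rewrite ler_peMr// -addrA lerDl addr_ge0 ?ln_ge0// logp_ge0.
Qed.

Lemma T_bounded_MZ F : T_bounded F -> mero_nz F. Proof. by case. Qed.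
Lemma T_bounded_pos F : T_bounded F -> exists2 c : R, 0 <= c & most_radii (fun r => nevanlinna_T F r <= c * T r).
Proof.
move=> [_ [c H]]; exists `|c| => //; apply: most_radii_imp2 H most_radii_T0 _ => r h T0.
by apply: (le_trans h); rewrite ler_wpM2r// ler_norm.
Qed.
Lemma T_bounded_f : T_bounded f.
Proof. by split => //; exists 1; apply: most_radii_all => r; rewrite mul1r. Qed.
Lemma T_bounded_le F c (d : R) : mero_nz F -> most_radii (fun r => nevanlinna_T F r <= c * T r + d) -> T_bounded F.
Proof.
move=> MF H; split => //; exists (c + `|d|); apply: most_radii_imp2 H (T_large 1) _ => r h T1.
apply: (le_trans h); rewrite mulrDl lerD2l; apply: (le_trans (ler_norm d)).
by rewrite ler_peMr.
Qed.
Lemma T_bounded_SS F : mero_nz F -> negl (nevanlinna_T F) -> T_bounded F.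
Proof. by move=> MF H; split => //; exists 1; exact: negl_AE. Qed.
Lemma T_bounded_cst (c : C) : c != 0 -> T_bounded (fun=> c).
Proof.
move=> c0; have Mc : mero_nz (fun=> c) by move=> z; exists 0; exact: order_cst.
apply: (@T_bounded_le _ 0 (logp (cabs c))) => //; apply: most_radii_imp2 (most_radii_ge 1) (most_radii_gen Mc) _ => r r1 gr.
rewrite mul0r add0r /nevanlinna_T m_E mean_cst.
have n0 (a : C) : a \in [::] -> cabs a <= r by [].
have o0 z : cabs z <= r -> z \notin [::] -> mero_order (fun=> c) z = 0.
  by move=> _ _; exact: mero_orderE (order_cst z c0).
have [-> _] := N_orders (lt_le_trans ltr01 r1) Mc (D := [::]) isT n0 o0.
by rewrite big_nil addr0.
Qed.
Lemma T_bounded_M F G : T_bounded F -> T_bounded G -> T_bounded (fun z => F z * G z).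
Proof.
move=> [MF [c HF]] [MG [d HG]]; split; first exact: mero_nz_M.
exists (c + d); apply: most_radii_imp2 (most_radii_and HF HG) (most_radii_and (most_radii_ge 1) (most_radii_and (most_radii_gen MF) (most_radii_gen MG))) _.
move=> r [hF hG] [r1 [gF gG]]; rewrite mulrDl.
have := m_M (lt_le_trans ltr01 r1) gF gG; have := N_M r1 MF MG; rewrite /nevanlinna_T in hF hG *; lra.
Qed.
Lemma T_bounded_V F : T_bounded F -> T_bounded (fun z => (F z)^-1).
Proof.
move=> [MF [c HF]]; have [K HK] := T_inv MF; apply: (@T_bounded_le _ c (- K)); first exact: mero_nz_V.
apply: most_radii_imp2 HF (most_radii_and (most_radii_ge 1) (most_radii_gen MF)) _ => r h [r1 gr].
have := HK r (lt_le_trans ltr01 r1) gr; lra.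
Qed.
Lemma T_bounded_X F n : T_bounded F -> T_bounded (fun z => F z ^+ n).
Proof.
move=> HF; elim: n => [|n IH].
  by under [X in T_bounded X]eq_fun do rewrite expr0; exact: T_bounded_cst (oner_neq0 _).
by under [X in T_bounded X]eq_fun do rewrite exprS; exact: T_bounded_M.
Qed.
Lemma T_bounded_D F G : T_bounded F -> T_bounded G -> mero_nz (fun z => F z + G z) -> T_bounded (fun z => F z + G z).
Proof.
move=> [MF [c HF]] [MG [d HG]] MFG; apply: (@T_bounded_le _ (c + d) (ln 2)) => //.
apply: most_radii_imp2 (most_radii_and HF HG) (most_radii_and (most_radii_ge 1) (most_radii_and (most_radii_gen MFG) (most_radii_and (most_radii_gen MF) (most_radii_gen MG)))) _.
move=> r [hF hG] [r1 [gFG [gF gG]]]; rewrite mulrDl.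
have := m_D (lt_le_trans ltr01 r1) gF gG gFG; have := N_D r1 MF MG MFG; rewrite /nevanlinna_T in hF hG *; lra.
Qed.
Lemma negl_log_derivative F : T_bounded F -> mero_nz (derive1 F) -> negl (nevanlinna_m (fun z => derive1 F z / F z)).
Proof.
move=> HF MF'; have [c c0 Hc] := T_bounded_pos HF; have MF := T_bounded_MZ HF.
have [k k0 H] := log_derivative_lemma MF MF'.
apply: negl_le (negl_D (negl_Z k0 negl_log) (negl_cst (k * logp c))).
apply: most_radii_imp2 (most_radii_and H Hc) (most_radii_and most_radii_T0 (most_radii_and (most_radii_ge 1) (most_radii_gen MF))) _ => r [h hc] [T0 [r1 gr]].
apply: (le_trans h); rewrite -mulrDr ler_wpM2l// -[leRHS]addrA lerD2l.
apply: (le_trans (logp_mono (T_ge0 r1 MF gr) hc)); apply: (le_trans (logpM c0 T0)).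
by rewrite addrC.
Qed.
(** m(r, F') <= m(r, F'/F) + m(r, F), and differentiation at most doubles the order of a pole. *)
Lemma T_bounded_derive F : T_bounded F -> mero_nz (derive1 F) -> T_bounded (derive1 F).
Proof.
move=> HF MF'; have [c c0 Hc] := T_bounded_pos HF; have MF := T_bounded_MZ HF.
have Mg : mero_nz (fun z => derive1 F z / F z) := mero_nz_M MF' (mero_nz_V MF).
split => //; exists (2 * c + 1).
apply: most_radii_imp2 (most_radii_and Hc (negl_AE (negl_log_derivative HF MF') ltr01))
  (most_radii_and (most_radii_ge 1) (most_radii_and (most_radii_gen MF) (most_radii_and (most_radii_gen MF') (most_radii_gen Mg)))) _ => r [hc hs] [r1 [gF [gF' gg]]].
have r0 := lt_le_trans ltr01 r1.
have hm : nevanlinna_m (derive1 F) r <= nevanlinna_m (fun z => derive1 F z / F z) r + nevanlinna_m F r + 0.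
  apply: m_le => // z zr; rewrite addr0; have [_ Fz] := gF z zr.
  have -> : derive1 F z = (derive1 F z / F z) * F z by rewrite divfK.
  by rewrite mulfK// cabsM logpM ?cabs_ge0.
have hN := N_derive r1 MF MF'; have m0 := m_ge0 r0 gF.
rewrite mulrDl mul1r -mulrA; rewrite /nevanlinna_T in hc *; rewrite /nevanlinna_T in hs; lra.
Qed.
End SmallTerms.

(** * Comparison of orders at a point *)

Section LocalCount.
Context {R : realType}.
Local Notation C := (CC R).
Implicit Types (z w : C) (f g h F G H : C -> C) (p m n e : int).

Lemma derive1_subc F (c : C) : derive1 (fun z => F z - c) = derive1 F.
Proof.
apply/funext => z; rewrite /derive1.
have -> : (fun u : C => u^-1 *: (F (u + z) - c - (F z - c))) = (fun u => u^-1 *: (F (u + z) - F z)).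
  by apply/funext => u; rewrite opprB addrA subrK.
by [].
Qed.

Lemma order_dlog H z e n : has_order H z e -> has_order (fun w => derive1 H w / H w) z n ->
  -1 <= n /\ (e = 0 -> 0 <= n).
Proof.
move=> he hn; have [e0|ne] := eqVneq e 0; last first.
  by have := order_uniq hn (order_M (order_derive he ne) (order_V he)); split; lia.
rewrite e0 in he; have hv := order_V he; rewrite oppr0 in hv.
have h1 : removable H z := (order_ge0 he).2 (lexx 0).
have h2 : removable (fun w => (H w)^-1) z := (order_ge0 hv).2 (lexx 0).
have := (order_ge0 hn).1 (removable_M (removable_derive h1) h2); split => //; lia.
Qed.

(** From 1 = F - (F - 1): the orders of the two terms cannot both be positive. *)
Lemma order_sub1 F z n e : has_order F z n -> has_order (fun w => F w - 1) z e ->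
  (0 <= n -> 0 <= e) /\ (0 < n -> e = 0).
Proof.
move=> hn he; have n1 : (-1 : C) != 0 by rewrite oppr_eq0 oner_neq0.
have h1 := order_add_ge hn (order_cst z n1) he.
have h2 := order_M (order_cst z n1) he.
have h3 : has_order (fun w => F w + (-1) * (F w - 1)) z 0.
  apply: has_order_eq (order_cst z (oner_neq0 _)); apply: pnear0 => w _; ring.
have := order_add_ge hn h2 h3; lia.
Qed.

Lemma derive1n_holx f z i : removable f z -> removable (derive1n i f) z.
Proof. by move=> hf; elim: i => // i IH; rewrite derive1nS; exact: removable_derive. Qed.

(** Here [p], [al], [be], [m] are the orders of f, a, phi, M[f], and [ga], [e], [om], [g] those of
    F, F - 1, M[f] - phi, G. A pole of G is simple and is charged to a pole of f, to a zero of M[f]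
    - phi, or to a zero or pole of a or phi. At a zero of f, either F vanishes and g = ga - 1 is at
    least n p - 1 + al - be, or ga <= 0 and n p is itself at most be - al. *)
Lemma local_count (p al be ga m e om g : int) (n : nat) : (0 < n)%N ->
  m = ga + be -> om = be + e -> -1 <= g -> (e = 0 -> 0 <= g) -> (0 < ga -> e = 0 /\ g = ga - 1) ->
  (0 <= ga -> 0 <= e) -> (0 <= p -> al + p *+ n <= m) ->
  (n.-1)%:Z * Num.max 0 p - g <= Num.max 0 (- p) + Num.max 0 om + Num.max 0 al + Num.max 0 (- al)
    + Num.max 0 be + Num.max 0 (- be).
Proof.
case: n => // n _ em eo g1 ge gg gae hp /=.
have [p0|p0] := leP p 0.
  rewrite mulr0; have hp' : p = 0 -> al <= m.
    by move=> pz; rewrite pz mul0rn addr0 in hp; exact: hp.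
  lia.
have := hp (ltW p0); rewrite mulrS -mulr_natl natz.
move: (Posz n * p) => u; lia.
Qed.

(** Where [f] is holomorphic so are its derivatives, and their factors can only raise the order. *)
Lemma order_monomial k (q : 'I_k.+1 -> nat) a f z al : mero_nz f -> (forall i, mero_nz (derive1n i f)) ->
  has_order a z al -> exists2 m, has_order (diff_monomial q a f) z m &
    (0 <= mero_order f z -> al + mero_order f z *+ q ord0 <= m).
Proof.
move=> Mf Md ha.
have hp := @order_prod R 'I_k.+1 (index_enum 'I_k.+1) (fun i w => derive1n i f w ^+ q i) z
   (fun i => mero_order (derive1n i f) z *+ q i) (fun i _ => order_X (q i) (ordP z (Md i))).
exists (al + \sum_(i < k.+1) mero_order (derive1n i f) z *+ q i); first exact: order_M ha hp.
move=> p0; rewrite lerD2l (bigD1 ord0)//= lerDl; apply: sumr_ge0 => i _.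
by apply: mulrn_wge0; apply/(order_ge0 (ordP z (Md i))); apply: derive1n_holx; exact/(order_ge0 (ordP z Mf)).
Qed.
End LocalCount.

(** * Functions with small proximity function *)

Section Multiplicative.
Context {R : realType} (f : CC R -> CC R).
Local Notation C := (CC R).
Context (Mf : mero_nz f) (tf : transcendental f).
Implicit Types (z w : C) (g h F G : C -> C) (r : R).

(** Smallness is asked of the proximity function alone, since quotients such as f'/f may have many
    poles. *)
Definition m_negl g := mero_nz g /\ negl f (nevanlinna_m g).

Lemma m_negl_M g h : m_negl g -> m_negl h -> m_negl (fun z => g z * h z).
Proof.
move=> [Mg sg] [Mh sh]; split; first exact: mero_nz_M.
apply: negl_le (negl_D sg sh).
apply: most_radii_imp2 (most_radii_ge 1) (most_radii_and (most_radii_gen Mg) (most_radii_gen Mh)) _ => r r1 [gg gh].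
exact: m_M (lt_le_trans ltr01 r1) gg gh.
Qed.
Lemma m_negl_1 : m_negl (fun=> 1).
Proof.
split; first by move=> z; exists 0; exact: order_cst (oner_neq0 _).
apply: negl_le (negl_cst Mf tf 0); apply: most_radii_all => r.
by rewrite m_E mean_cst cabs1 /logp ln1 maxxx.
Qed.
Lemma m_negl_X g n : m_negl g -> m_negl (fun z => g z ^+ n).
Proof.
move=> sg; elim: n => [|n IH].
  by under [X in m_negl X]eq_fun do rewrite expr0; exact: m_negl_1.
by under [X in m_negl X]eq_fun do rewrite exprS; exact: m_negl_M.
Qed.
Lemma m_negl_prod (I : Type) (t : seq I) (F : I -> C -> C) : (forall i, m_negl (F i)) ->
  m_negl (fun z => \prod_(i <- t) F i z).
Proof.
move=> sF; elim: t => [|i t IH].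
  by under [X in m_negl X]eq_fun do rewrite big_nil; exact: m_negl_1.
by under [X in m_negl X]eq_fun do rewrite big_cons; exact: m_negl_M.
Qed.
Lemma m_negl_T g : mero_nz g -> negl f (nevanlinna_T g) -> m_negl g.
Proof.
move=> Mg sg; split => //; apply: negl_le sg; apply: most_radii_imp (most_radii_ge 1) _ => r r1.
by rewrite lerDl N_ge0//; exact: mero_nz_mero.
Qed.
Lemma negl_TV g : mero_nz g -> negl f (nevanlinna_T g) -> negl f (nevanlinna_T (fun z => (g z)^-1)).
Proof.
move=> Mg sg; have [K HK] := T_inv Mg; apply: negl_le (negl_D sg (negl_cst Mf tf (- K))).
apply: most_radii_imp2 (most_radii_ge 1) (most_radii_gen Mg) _ => r r1 gr.
by rewrite (HK r (lt_le_trans ltr01 r1) gr) addrK.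
Qed.
Lemma negl_NT g : mero_nz g -> negl f (nevanlinna_T g) -> negl f (nevanlinna_N g).
Proof.
move=> Mg sg; apply: negl_le sg; apply: most_radii_imp2 (most_radii_ge 1) (most_radii_gen Mg) _ => r r1 gr.
by rewrite lerDr m_ge0// (lt_le_trans ltr01 r1).
Qed.

Lemma T_bounded_derive1n i : T_bounded f (derive1n i f).
Proof.
elim: i => [|i IH]; first exact: T_bounded_f.
rewrite derive1nS; apply: T_bounded_derive => //; exact: (derive1n_MZ i.+1 Mf tf).
Qed.
(** The quotient is a product of successive logarithmic derivatives, to which the lemma applies
    because every derivative of [f] has characteristic O(T(r, f)). *)
Lemma m_negl_derive1n i : m_negl (fun z => derive1n i f z / f z).
Proof.
have Mi j := derive1n_MZ j Mf tf.
elim: i => [|i [MI sI]].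
  split; first exact: mero_nz_M Mf (mero_nz_V Mf).
  apply: negl_le (negl_cst Mf tf 0); apply: most_radii_imp2 (most_radii_ge 1) (most_radii_gen Mf) _ => r r1 gr.
  rewrite m_E (@mean_ext _ _ (fun=> 0)) ?mean_cst// => t.
  have r0 := lt_le_trans ltr01 r1.
  rewrite derive1n0 divff; first by rewrite cabs1 /logp ln1 maxxx.
  by rewrite -cabs_gt0; exact: generic_cabs_gt0.
have Mq := mero_nz_M (Mi i.+1) (mero_nz_V (Mi i)); rewrite derive1nS in Mq.
have Mn := mero_nz_M (Mi i.+1) (mero_nz_V Mf); split => //.
have sd : negl f (nevanlinna_m (fun z => derive1 (derive1n i f) z / derive1n i f z)).
  by apply: negl_log_derivative => //; [exact: T_bounded_derive1n|exact: (Mi i.+1)].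
apply: negl_le (negl_D sd sI).
apply: most_radii_imp2 (most_radii_and (most_radii_ge 1) (most_radii_gen (Mi i))) (most_radii_and (most_radii_gen Mn) (most_radii_and (most_radii_gen Mq) (most_radii_gen MI))) _.
move=> r [r1 gi] [gn [gq gI]]; rewrite -[leRHS]addr0; apply: m_le => //; first exact: lt_le_trans r1.
move=> z zr; have [_ iz] := gi z zr; rewrite addr0 derive1nS.
have -> : derive1 (derive1n i f) z / f z = (derive1 (derive1n i f) z / derive1n i f z) * (derive1n i f z / f z).
  by rewrite mulrA divfK.
by apply: (le_trans _ (logpM (cabs_ge0 _) (cabs_ge0 _))); rewrite -cabsM.
Qed.
Lemma m_X g n r : 0 < r -> generic g r -> nevanlinna_m (fun z => g z ^+ n) r = n%:R * nevanlinna_m g r.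
Proof.
move=> r0 gg; rewrite !m_E -(meanZ _ (contin_logp r0 gg)); apply: mean_ext => t.
by rewrite cabsX logpX ?cabs_ge0.
Qed.
Lemma T_bounded_prod (I : Type) (t : seq I) (F : I -> C -> C) : (forall i, T_bounded f (F i)) ->
  T_bounded f (fun z => \prod_(i <- t) F i z).
Proof.
move=> sF; elim: t => [|i t IH].
  by under [X in T_bounded f X]eq_fun do rewrite big_nil; exact: T_bounded_cst (oner_neq0 _).
by under [X in T_bounded f X]eq_fun do rewrite big_cons; exact: T_bounded_M.
Qed.
End Multiplicative.

(** * The main estimate *)

Section Main.
Context {R : realType} (f phi a : CC R -> CC R) (k : nat) (q : 'I_k.+1 -> nat).
Local Notation C := (CC R).
Local Notation mu := (@lebesgue_measure R).
Context (Mf : mero_nz f) (tf : transcendental f) (Mp : mero_nz phi) (Ma : mero_nz a).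
Context (sp : negl f (nevanlinna_T phi)) (sa : negl f (nevanlinna_T a)).
Implicit Types (z w : C) (r : R) (s : R -> R).
Local Notation M := (diff_monomial q a f).
Local Notation h i := (derive1n i f).
Local Notation F := (fun z => M z / phi z).

Lemma negl_of_isS s : is_S f s -> negl f s.
Proof.
(* Radii that are not generic are added to the exceptional set, so that T(r, f) >= 0 and the
   absolute value in [is_S] disappears. *)
move=> [E [mE _ fE H]]; have [E0 [mE0 z0 g0]] := generic_ae Mf; exists (E `|` E0); split.
- exact: measurableU.
- have fE0 : (mu E0 < +oo)%E by rewrite z0.
  by apply: (le_lt_trans (@measureU2 _ _ _ mu E E0 mE mE0)); exact: lte_add_pinfty.
- move=> e e0; have [r0 [_ Hr]] := H e e0; exists (Num.max 1 (r0 + 1)) => r.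
  rewrite ge_max => /andP[r1 rr] nE.
  have gr : generic f r by apply: g0 => E0r; apply: nE; right.
  have nEr : ~ E r by move=> Er; apply: nE; left.
  have rr0 : r0 < r by lra.
  have := Hr r rr0 nEr; rewrite (ger0_norm (T_ge0 r1 Mf gr)); apply: le_trans.
  exact: ler_norm.
Qed.
Lemma isS_of_SS s : negl f s -> is_S f (fun r => Num.max 0 (s r)).
Proof.
move=> [E [mE fE H]]; exists (E `&` [set r | 0 < r]); split.
- apply: measurableI => //; rewrite (_ : [set r | 0 < r] = `]0, +oo[%classic).
    exact: measurable_itv.
  by apply/seteqP; split => r /=; rewrite in_itv/= andbT.
- by move=> r [].
- apply: le_lt_trans fE; apply: (@le_measure _ _ _ mu); rewrite ?inE//.
    apply: measurableI => //; rewrite (_ : [set r | 0 < r] = `]0, +oo[%classic).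
      exact: measurable_itv.
    by apply/seteqP; split => r /=; rewrite in_itv/= andbT.
- move=> e e0; have [r0 Hr] := H e e0; exists (Num.max 0 r0); split; first exact: num_real.
  move=> r; rewrite gt_max => /andP[rp rr] nE.
  have nEr : ~ E r by move=> Er; apply: nE; split.
  have et : 0 <= e * `|nevanlinna_T f r| by rewrite mulr_ge0 ?(ltW e0).
  rewrite ger0_norm ?le_max ?lexx// ge_max et /=.
  by apply: (le_trans (Hr r (ltW rr) nEr)); rewrite ler_wpM2l ?(ltW e0)// ler_norm.
Qed.

Let Mh i : mero_nz (h i) := derive1n_MZ i Mf tf.
Let d := (\sum_(i < k.+1) q i)%N.
Definition W z := a z / phi z * \prod_(i < k.+1) (h i z / f z) ^+ q i.

Lemma m_negl_W : m_negl f W.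
Proof.
apply: m_negl_M.
  apply: m_negl_M; first exact: (m_negl_T Ma sa).
  exact: (m_negl_T (mero_nz_V Mp) (negl_TV Mf tf Mp sp)).
by apply: m_negl_prod => // i; apply: m_negl_X => //; exact: m_negl_derive1n.
Qed.

Lemma T_bounded_monomial : T_bounded f M.
Proof.
apply: T_bounded_M; first exact: T_bounded_SS.
by apply: T_bounded_prod => // i; apply: T_bounded_X => //; exact: T_bounded_derive1n.
Qed.
Lemma T_bounded_quotient : T_bounded f F.
Proof. by apply: T_bounded_M; [exact: T_bounded_monomial|apply: T_bounded_V => //; exact: T_bounded_SS]. Qed.

Lemma most_radii_proximity : most_radii (fun r => d%:R * nevanlinna_m (fun z => (f z)^-1) r <=
  nevanlinna_m (fun z => (F z)^-1) r + nevanlinna_m W r).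
Proof.
have [MW _] := m_negl_W; have MF := T_bounded_MZ T_bounded_quotient.
apply: most_radii_imp2 (most_radii_and (most_radii_ge 1) (most_radii_gen MW)) (most_radii_and (most_radii_gen Mf) (most_radii_gen MF)) _ => r [r1 gW] [gf gF].
have r0 : 0 < r := lt_le_trans ltr01 r1.
rewrite -(m_X _ r0 (generic_V gf)) -[leRHS]addr0; apply: m_le => //.
- by move=> z zr; have [hz fz] := generic_V gf zr; split; [exact: hol_X|exact: expf_neq0].
- exact: generic_V.
move=> z zr; rewrite addr0; apply: (le_trans _ (logpM (cabs_ge0 _) (cabs_ge0 _))); rewrite -cabsM.
have [_ Fz] := gF z zr; have [_ fz] := gf z zr.
suff -> : (f z)^-1 ^+ d = (F z)^-1 * W z by [].
have E : W z = F z * (f z)^-1 ^+ d.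
  rewrite /W /diff_monomial /d -prodrXr.
  have -> : \prod_(i < k.+1) (h i z / f z) ^+ q i =
      \prod_(i < k.+1) h i z ^+ q i * \prod_(i < k.+1) (f z)^-1 ^+ q i.
    by rewrite -big_split; apply: eq_bigr => i _; exact: exprMn.
  ring.
by rewrite E mulKf.
Qed.

Lemma mero_nz_diff : mero_nz (fun z => F z - 1) -> mero_nz (fun z => M z - phi z).
Proof.
move=> MH; apply: (mero_nz_eq _ (mero_nz_M Mp MH)) => z.
apply: (pnear1 (order_good (ordP z Mp))) => w _ [_ pw].
by rewrite mulrBr mulr1 mulrC divfK.
Qed.

(** By [N_lin] this is the inequality of [local_count] at every point. Its hypotheses come from M[f]
    - phi = phi (F - 1), and from G being the logarithmic derivative of F - 1, which has order 0
    where F vanishes. *)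
Lemma count r : (0 < q ord0)%N -> 1 <= r -> mero_nz (fun z => F z - 1) ->
  mero_nz (fun z => derive1 F z / (F z - 1)) ->
  (q ord0).-1%:R * nevanlinna_N (fun z => (f z)^-1) r +
    nevanlinna_N (fun z => derive1 F z / (F z - 1)) r
    - nevanlinna_N (fun z => (derive1 F z / (F z - 1))^-1) r <=
  nevanlinna_N f r + nevanlinna_N (fun z => (M z - phi z)^-1) r + nevanlinna_N a r
  + nevanlinna_N (fun z => (a z)^-1) r + nevanlinna_N phi r + nevanlinna_N (fun z => (phi z)^-1) r.
Proof.
move=> q0 r1 MH MG; have MD := mero_nz_diff MH; set G := (fun z => derive1 F z / (F z - 1)) in MG *.
have := @N_lin R [:: (1, f); (1, fun z => (M z - phi z)^-1); (1, a); (1, fun z => (a z)^-1); (1, phi);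
  (1, fun z => (phi z)^-1); (- (q ord0).-1%:Z, fun z => (f z)^-1); (-1, G); (1, fun z => (G z)^-1)] r r1.
rewrite !big_cons !big_nil /= => H.
rewrite -subr_ge0.
rewrite (_ : _ - _ = 1%:~R * nevanlinna_N f r + (1%:~R * nevanlinna_N (fun z => (M z - phi z)^-1) r +
 (1%:~R * nevanlinna_N a r + (1%:~R * nevanlinna_N (fun z => (a z)^-1) r + (1%:~R * nevanlinna_N phi r +
 (1%:~R * nevanlinna_N (fun z => (phi z)^-1) r + ((- (q ord0).-1%:Z)%:~R * nevanlinna_N (fun z => (f z)^-1) r +
 ((-1)%:~R * nevanlinna_N G r + (1%:~R * nevanlinna_N (fun z => (G z)^-1) r + 0))))))))); last first.
  rewrite mulrNz -pmulrn; ring.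
apply: H.
  by do !constructor; rewrite /=; try exact: mero_nz_V.
move=> z; rewrite !big_cons !big_nil /=.
have of_ := ordP z Mf; have oa := ordP z Ma; have op := ordP z Mp; have oG := ordP z MG.
rewrite (mero_orderE (order_V oa)) (mero_orderE (order_V op)) (mero_orderE (order_V of_)) (mero_orderE (order_V oG)).
have [m om mp] := order_monomial q Mf Mh oa.
have oF := order_M om (order_V op).
have oH := ordP z MH; move: (mero_order _ z) oH => e oH.
have oD : has_order (fun z => M z - phi z) z (mero_order phi z + e).
  apply: has_order_eq (order_M op oH); apply: (pnear1 (order_good op)) => w _ [_ pw].
  by rewrite mulrBr mulr1 mulrC divfK.
rewrite (mero_orderE (order_V oD)).
have [g1 g2] : -1 <= mero_order G z /\ (e = 0 -> 0 <= mero_order G z).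
  by apply: (order_dlog oH); rewrite derive1_subc.
have [s1 s2] := order_sub1 oF oH.
have s3 : 0 < m - mero_order phi z -> e = 0 /\ mero_order G z = m - mero_order phi z - 1.
  move=> ga; have e0 := s2 ga; split => //; apply: (order_uniq oG).
  have := order_M (order_derive oF (lt0r_neq0 ga)) (order_V oH); rewrite e0 oppr0 addr0; exact.
have := @local_count (mero_order f z) (mero_order a z) (mero_order phi z) (m - mero_order phi z) m e
  (mero_order phi z + e) (mero_order G z) (q ord0) q0.
rewrite subrK => /(_ erefl erefl g1 g2 s3 s1 mp); rewrite !opprK.
set u := _.-1%:Z * _ => hu.
by rewrite mulNr -/u; lia.
Qed.

(** With F constant, M[f] and phi have the same order everywhere. At a zero of f of order p, the
    order of a plus q_0 p is then at most that of phi, so zeros of f are paid for by zeros and poles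
    of a and phi. *)
Lemma count0 r : (0 < q ord0)%N -> 1 <= r -> (exists2 c : C, c != 0 & mero_eq F (fun=> c)) ->
  nevanlinna_N (fun z => (f z)^-1) r <= nevanlinna_N a r
  + nevanlinna_N (fun z => (a z)^-1) r + nevanlinna_N phi r + nevanlinna_N (fun z => (phi z)^-1) r.
Proof.
move=> q0 r1 [c c0 Fc].
have := @N_lin R [:: (1, a); (1, fun z => (a z)^-1); (1, phi);
  (1, fun z => (phi z)^-1); (-1, fun z => (f z)^-1)] r r1.
rewrite !big_cons !big_nil /= => H.
rewrite -subr_ge0.
rewrite (_ : _ - _ = 
 (1%:~R * nevanlinna_N a r + (1%:~R * nevanlinna_N (fun z => (a z)^-1) r + (1%:~R * nevanlinna_N phi r +
 (1%:~R * nevanlinna_N (fun z => (phi z)^-1) r + ((-1)%:~R * nevanlinna_N (fun z => (f z)^-1) r + 0)))))); last by ring.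
apply: H.
  by do !constructor; rewrite /=; try exact: mero_nz_V.
move=> z; rewrite !big_cons !big_nil /=.
have of_ := ordP z Mf; have oa := ordP z Ma; have op := ordP z Mp.
rewrite (mero_orderE (order_V oa)) (mero_orderE (order_V op)) (mero_orderE (order_V of_)).
have [m om mp] := order_monomial q Mf Mh oa.
have oF := order_M om (order_V op).
have m0 : m - mero_order phi z = 0.
  by apply: (order_uniq oF); apply: has_order_eq (order_cst z c0); apply: (pnear1 (Fc z)) => w _ ->.
have [p0|p0] := leP 0 (mero_order f z); last by lia.
have := mp p0; rewrite -(prednK q0) mulrS; have := mulrn_wge0 (q ord0).-1 p0; lia.
Qed.

Lemma mult_ge (x : R) : 0 <= x -> (q ord0).-1%:R * x <= d%:R * x.
Proof.
move=> x0; rewrite ler_wpM2r// ler_nat /d (bigD1 ord0)//=.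
by apply: leq_trans (leq_pred _) _; exact: leq_addr.
Qed.

Lemma main_estimate : (3 <= q ord0)%N ->
  negl f (fun r => nevanlinna_T f r - 1 / ((q ord0)%:R - 2) * nevanlinna_N (fun z => (M z - phi z)^-1) r).
Proof.
move=> q3; have q0 : (0 < q ord0)%N by lia.
have MF := T_bounded_MZ T_bounded_quotient; have [K HK] := T_inv Mf.
have [MW sW] := m_negl_W.
have sN : negl f (fun r => nevanlinna_N a r + nevanlinna_N (fun z => (a z)^-1) r + nevanlinna_N phi r
    + nevanlinna_N (fun z => (phi z)^-1) r).
  apply: negl_D; last exact: negl_NT (mero_nz_V Mp) (negl_TV Mf tf Mp sp).
  apply: negl_D; last exact: negl_NT Mp sp.
  apply: negl_D; last exact: negl_NT (mero_nz_V Ma) (negl_TV Mf tf Ma sa).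
  exact: negl_NT Ma sa.
have sc := negl_cst Mf tf.
have ageM := most_radii_and (most_radii_and (most_radii_ge 1) (most_radii_gen Mf)) (most_radii_and (most_radii_gen MF) most_radii_proximity).
have [F0|MF'] := mero_dich (mero_derive (mero_nz_mero MF)).
  have [c Fc] := derive0_const (mero_nz_mero MF) F0.
  have c0 : c != 0 by apply/eqP => c0; apply: (mero_nz_neq0 MF); rewrite c0 in Fc.
  have sT : negl f (nevanlinna_T f).
    apply: negl_le (negl_D (negl_D sW sN) (sc (logp (cabs c^-1) + K))).
    apply: most_radii_imp ageM _ => r [[r1 gf] [gF hm]].
    have r0 : 0 < r := lt_le_trans ltr01 r1.
    have mF : nevanlinna_m (fun z => (F z)^-1) r = logp (cabs c^-1).
      rewrite m_E -[RHS]mean_cst; apply: mean_ext => t; congr (logp (cabs _^-1)).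
      have zr : cabs (rc r * eit t) = r by rewrite cabsM cabs_eit mulr1 cabs_rc gtr0_norm.
      have [hz _] := gF _ zr.
      exact: ccont_eq (hol_cont hz) (hol_cont (hol_cst c _)) (Fc _).
    have m0 := m_ge0 r0 (generic_V gf); have dm := mult_ge m0.
    have m1 : nevanlinna_m (fun z => (f z)^-1) r <= (q ord0).-1%:R * nevanlinna_m (fun z => (f z)^-1) r.
      by rewrite ler_peMl// ler1n; lia.
    have hN := count0 q0 r1 (ex_intro2 _ _ c c0 Fc).
    rewrite (HK r r0 gf) {1}/nevanlinna_T; rewrite mF in hm; lra.
  (* T <= T / 2 and T >= 1 hold for most radii but never together, so most radii satisfy any
     claim. *)
  have e2 : 0 < 2^-1 :> R by rewrite invr_gt0.
  apply: negl_le (sc 0); apply: most_radii_imp2 (negl_AE sT e2) (T_large Mf tf 1) _ => r h1 h2.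
  by exfalso; lra.
have MH : mero_nz (fun z => F z - 1).
  have [H0|//] := mero_dich (mero_D (mero_nz_mero MF) (mero_cst (-1))).
  exfalso; apply: (mero_nz_neq0 MF') => z; rewrite -(derive1_subc F 1).
  apply: (pnear1 (pnear_derive (H0 z))) => w _ e; rewrite [LHS]e.
  exact: cderE (cder_cst 0 w).
have MG := mero_nz_M MF' (mero_nz_V MH).
have n1 : (-1 : C) != 0 by rewrite oppr_eq0 oner_neq0.
have BH : T_bounded f (fun z => F z - 1) := T_bounded_D Mf tf T_bounded_quotient (T_bounded_cst Mf tf n1) MH.
have MH' : mero_nz (derive1 (fun z => F z - 1)) by rewrite derive1_subc.
have sG := negl_log_derivative Mf tf BH MH'; rewrite derive1_subc in sG.
have sF := negl_log_derivative Mf tf T_bounded_quotient MF'.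
have Mg := mero_nz_M MF' (mero_nz_V MF).
have [KG HG] := jensen MG.
have n2 : 0 < (q ord0)%:R - 2 :> R by rewrite subr_gt0 ltr_nat.
have n2' : 0 <= 1 / ((q ord0)%:R - 2) :> R by rewrite divr_ge0// ltW.
(* The constant collects ln 2 from the proximity function of a sum, - KG from Jensen's formula for
   G, and q_0 - 1 times the constant K of T(r, f) = T(r, 1/f) + K. *)
apply: negl_le (negl_Z Mf tf n2' (negl_D (negl_D (negl_D sG sF) (negl_D sW sN)) (sc (ln 2 - KG + (q ord0).-1%:R * K)))).
apply: most_radii_imp2 ageM (most_radii_and (most_radii_and (most_radii_gen MH) (most_radii_gen MG)) (most_radii_and (most_radii_gen MF') (most_radii_gen Mg))) _.
move=> r [[r1 gf] [gF hm]] [[gH gG] [gF' gg]].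
have r0 : 0 < r := lt_le_trans ltr01 r1.
have mF : nevanlinna_m (fun z => (F z)^-1) r <= nevanlinna_m (fun z => derive1 F z / F z) r
    + nevanlinna_m (fun z => (derive1 F z / (F z - 1))^-1) r + ln 2.
  apply: m_le => //; [exact: generic_V|exact: generic_V|].
  move=> z zr; have [_ Fz] := gF z zr; have [_ Hz] := gH z zr; have [_ F'z] := gF' z zr.
  have E : (F z)^-1 = 1 - (derive1 F z / F z) * (derive1 F z / (F z - 1))^-1.
    have id (x y : C) : x != 0 -> y != 0 -> y - 1 != 0 -> y^-1 = 1 - x / y * (x / (y - 1))^-1.
      by move=> x0 y0 y1; field; rewrite x0 y0 y1.
    exact: id.
  rewrite [in leLHS]E.
  apply: (le_trans (logp_mono (cabs_ge0 _) (cabsBD _ _))); rewrite cabs1.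
  apply: (le_trans (logpD ler01 (cabs_ge0 _))); rewrite [logp 1]/logp ln1 maxxx add0r lerD2r.
  by apply: (le_trans _ (logpM (cabs_ge0 _) (cabs_ge0 _))); rewrite -cabsM.
have m0 := m_ge0 r0 (generic_V gf); have dm := mult_ge m0.
have hN := count q0 r1 MH MG.
have jG := HG r r0 gG; have mf0 := m_ge0 r0 gf; have tf' := HK r r0 gf.
have qE : (q ord0)%:R = (q ord0).-1%:R + 1 :> R by rewrite natr1 prednK.
rewrite lerBlDr -mulrDr div1r ler_pdivlMl// {1}qE.
have tn : (q ord0).-1%:R * nevanlinna_T f r = (q ord0).-1%:R * (nevanlinna_T (fun z => (f z)^-1) r + K) :> R.
  by rewrite tf'.
(* Linear arithmetic with n = q_0 - 1. The pairs [x1], [x2] and [y1], [y2] are m and N of f and of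
   1/f; [A] and [B], which are N of G and of 1/G, cancel; [om] is N(r, 1/(M[f] - phi)). Moving [x2]
   to the left and completing it by the nonnegative [x1] to T(r, f) lowers the coefficient from n to
   n - 1. *)
have ar (n d' x1 x2 y1 y2 KK J u v' A B W' s1 s2 s3 s4 om l t : R) : 0 <= x1 ->
    n * y2 + A - B <= x2 + om + s1 + s2 + s3 + s4 -> u - v' = J + B - A -> n * y1 <= d' * y1 ->
    d' * y1 <= W' + t -> W' <= l + v' + ln 2 -> n * (x1 + x2) = n * (y1 + y2 + KK) ->
    (n + 1 - 2) * (x1 + x2) <= u + l + (t + (s1 + s2 + s3 + s4)) + (ln 2 - J + n * KK) + om.
  by move=> *; lra.
exact: (ar _ _ _ _ _ _ _ _ _ _ _ _ _ _ _ _ _ _ _ _ mf0 hN jG dm hm mF tn).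
Qed.
End Main.

Theorem theorem2p2 (R : realType) (f phi a : CC R -> CC R) (k : nat)
    (q : 'I_k.+1 -> nat)
    (mero_f : meromorphic f) (trans_f : transcendental f)
    (small_phi : small_function f phi) (small_a : small_function f a)
    (k_ge1 : (1 <= k)%N) (q0_ge3 : (3 <= q ord0)%N)
    (qk_ge1 : (1 <= q ord_max)%N) :
  exists2 S : R -> R, is_S f S &
    forall r : R, 0 < r ->
      nevanlinna_T f r
        <= 1 / ((q ord0)%:R - 2)
             * nevanlinna_N (fun z => 1 / (diff_monomial q a f z - phi z)) r
           + S r.
Proof.
have Mf : mero_nz f.
  apply: (mero_nz_of mero_f) => f0; apply: trans_f; exists 0, 1; split; first exact: oner_neq0.
  by move=> z; apply: (pnear1 (f0 z)) => w _ ->; rewrite horner0 mul0r.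
have [mp p0 sp] := small_phi; have [ma a0 sa] := small_a.
have H := main_estimate Mf trans_f (mero_nz_of mp p0) (mero_nz_of ma a0) (negl_of_isS Mf sp) (negl_of_isS Mf sa) q0_ge3.
(* The positive part of the difference makes the inequality hold at every r > 0, exceptional radii
   included; what has to be proved is that it is S(r, f). *)
exists (fun r => Num.max 0 (nevanlinna_T f r - 1 / ((q ord0)%:R - 2) *
    nevanlinna_N (fun z => (diff_monomial q a f z - phi z)^-1) r)).
  exact: isS_of_SS H.
move=> r _; under [X in nevanlinna_N X]eq_fun do rewrite div1r.
by rewrite -lerBlDl le_max lexx orbT.
Qed.
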